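(* Let $k=\overline{\mathbb{F}_2}$. Assume that for every $\alpha\in k\setminus\{0\}$ and all integers $n\ge 1$ and $0\le j<2^n$ one has $$\langle n,j,\alpha\rangle=e_{n+1}\left(g_\alpha^{2j+1}\right)-\tfrac12\left(e_{n+1}\left(g_\alpha^{2j}\right)+e_{n+1}\left(g_\alpha^{2j+2}\right)\right).$$ Let $t\ge 1$ and let $\alpha_1,\dots,\alpha_t\in k\setminus\{0\}$ have degrees $m_1,\dots,m_t>1$ over $\mathbb{F}_2$, respectively. For each $i$ let $g_{\alpha_i}=g_{\alpha_i}(x_i,y_i,z_i)$ be the quartic in the (pairwise disjoint) variables $x_i,y_i,z_i$. Then the $(3t+1)$-dimensional hypersurface $$R_{\alpha_1,\dots,\alpha_t}:=\frac{k[[x_i,y_i,z_i,u,v\mid 1\le i\le t]]}{(uv+g_{\alpha_1}+\cdots+g_{\alpha_t})}$$ has Hilbert–Kunz multiplicity $$e_{HK}(R_{\alpha_1,\ldots,\alpha_t})=\frac 32 + \frac{3^t}{2^{3t+2}-2^{t+1}}+\sum_{r=1}^t\ \sum_{1\le i_1<\dots<i_r\le t} \frac{3^{t-r}}{2^{(2t+1)\operatorname{lcm}(m_{i_1}, \dots, m_{i_r})+t+1}-2^{t+1}}$$ and $F$-signature $$s(R_{\alpha_1,\ldots,\alpha_t})=\frac 12 - \frac{3^t}{2^{3t+2}-2^{t+1}}-\sum_{r=1}^t\ \sum_{1\le i_1<\dots<i_r\le t} \frac{3^{t-r}}{2^{(2t+1)\operatorname{lcm}(m_{i_1}, \dots,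 m_{i_r})+t+1}-2^{t+1}}.$$
   Context: Let $k=\overline{\mathbb{F}_2}$; for $\beta\in k$ put $m_\beta=[\mathbb{F}_2(\beta):\mathbb{F}_2]$. For $0\ne\alpha\in k$ let $g_\alpha=g_\alpha(x,y,z)=\alpha x^2y^2+z^4+xyz^2+(x^3+y^3)z\in k[x,y,z]$ (the Brenner–Monsky quartic). For a polynomial $f\in k[x_1,\dots,x_d]$ and $n\ge 0$, $e_n(f)=\dim_k k[x_1,\dots,x_d]/(x_1^{2^n},\dots,x_d^{2^n},f)$ (so $e_n(1)=0$). Hilbert–Kunz multiplicity and $F$-signature: for a complete local $F$-finite domain $(R,\mathfrak m)$ of characteristic $p>0$, dimension $d$ and perfect residue field, $e_{HK}(R)=\lim_{e\to\infty}\ell_R(R/\mathfrak m^{[p^e]})/p^{ed}$ and $s(R)=\lim_{e\to\infty}\ell_R(R/I_e)/p^{ed}$, where $I_e=\{r\in R: \text{the }R\text{-linear map }R\to R^{1/p^e},\ 1\mapsto r^{1/p^e},\text{ does not split}\}$. Definition of $\langle n,j,\alpha\rangle$: let $0\neq\alpha\in k$, write $\alpha=\lambda^2+\lambda$ with $\lambda\in k$, and put $m=m_\alpha$. Let $P=$ ''even'', $Q=$ ''odd'' if $m_\lambda\ne m_\alpha$, and $P=$ ''odd'', $Q=$ ''even'' if $m_\lambda=m_\alpha$. Let $\Gamma$ be the free abelian group on symbols $A_n,B_n$ ($n\in\mathbb{N}$), $C$, $D$. Define homomorphisms $\sigma_0,\sigma_1:\Gamma\to\Gamma$ by: - $\sigma_0(A_n)=B_{n+1}$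 if $m\mid n+1$ and $\frac{n+1}{m}$ has parity $P$; otherwise $\sigma_0(A_n)=A_{n+1}$. - $\sigma_1(A_n)=B_{n+1}$ if $m\mid n+1$ and $\frac{n+1}{m}$ has parity $Q$; otherwise $\sigma_1(A_n)=A_{n+1}$. - $\sigma_0(B_n)=0$ if $m\mid n$ and $\frac nm$ has parity $P$; otherwise $\sigma_0(B_n)=A_{n+1}+C$. - $\sigma_1(B_n)=0$ if $m\mid n$ and $\frac nm$ has parity $Q$; otherwise $\sigma_1(B_n)=A_{n+1}+C$. - $\sigma_0(C)=\sigma_1(C)=C$, $\sigma_0(D)=A_1$, $\sigma_1(D)=0$. For $n\ge0$ and $0\le j<2^n$ define $f(n,j)\in\Gamma$ recursively by $f(0,0)=2C+D$, $f(n+1,2j)=\sigma_0(f(n,j))$, $f(n+1,2j+1)=\sigma_1(f(n,j))$. Then $f(n,j)=aA_n+bB_n+cC+dD$ for some integers $a,b,c,d$, and $\langle n,j,\alpha\rangle:=(3a+5b+d)2^c$. *)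

(* Defs.v *)
From HB Require Import structures.
From mathcomp Require Import all_boot all_order all_algebra all_field.
From mathcomp Require Import ring_quotient.
From mathcomp Require Import boolp classical_sets functions reals filter.
(* [normedtype] is not imported: its notations clash with those of [mpoly] *)
From mathcomp Require Import topology_theory.num_topology.
From mathcomp Require Import freeg mpoly.

Set Implicit Arguments.
Unset Strict Implicit.
Unset Printing Implicit Defensive.

Import Order.TTheory GRing.Theory Num.Theory.
Import numFieldTopology.Exports.

Local Open Scope classical_set_scope.
Local Open Scope ring_scope.

(* The classes of e_0, ..., e_(d-1) form a basis of U / (U `&` W), for
   subspaces U and W of V. *)
Definition basis_mod (K : fieldType) (V : lmodType K) (U W : set V)
    (d : nat) (e : 'I_d -> V) : Prop :=
  (forall i, U (e i)) /\
  (forall v, U v -> exists! c : {ffun 'I_d -> K}, W (v - \sum_i c i *: e i)).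

(* Junk value 0 if U / (U `&` W) is infinite-dimensional. *)
Definition qdim (K : fieldType) (V : lmodType K) (U W : set V) : nat :=
  xget 0%N [set d | exists e : 'I_d -> V, basis_mod U W e].

Definition is_ideal (R : comNzRingType) (J : set R) : Prop :=
  [/\ J 0, (forall x y, J x -> J y -> J (x + y)) &
      (forall a x, J x -> J (a * x))].

Definition is_prime_ideal (R : comNzRingType) (J : set R) : Prop :=
  [/\ is_ideal J, ~ J 1 & forall x y, J (x * y) -> J x \/ J y].

Definition is_maximal_ideal (R : comNzRingType) (m : set R) : Prop :=
  [/\ is_ideal m, ~ m 1 &
      forall J, is_ideal J -> m `<=` J -> J = m \/ J = setT].

(* m is the unique maximal ideal of R. *)
Definition is_local_ring (R : comNzRingType) (m : set R) : Prop :=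
  is_maximal_ideal m /\ forall m', is_maximal_ideal m' -> m' = m.

Definition ideal_gen (R : comNzRingType) (A : set R) : set R :=
  smallest (@is_ideal R) A.

Definition strict_chain (T : Type) (P : set (set T)) (n : nat)
    (J : nat -> set T) : Prop :=
  (forall i, (i <= n)%N -> P (J i)) /\
  (forall i, (i < n)%N -> J i `<` J i.+1).

Definition max_chain_length (T : Type) (P : set (set T)) (n : nat) : Prop :=
  (exists J, strict_chain P n J) /\
  (forall n' J, strict_chain P n' J -> (n' <= n)%N).

(* The length of the R-module R / I; its submodules are the ideals of R
   containing I. *)
Definition is_length (R : comNzRingType) (I : set R) (l : nat) : Prop :=
  max_chain_length [set J | is_ideal J /\ I `<=` J] l.

Definition is_krull_dim (R : comNzRingType) (d : nat) : Prop :=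
  max_chain_length (@is_prime_ideal R) d.

Definition frob_power (R : comNzRingType) (m : set R) (q : nat) : set R :=
  ideal_gen [set x ^+ q | x in m].

Definition is_HK_multiplicity (RR : realType) (p : nat) (R : comNzRingType)
    (l : RR) : Prop :=
  exists (m : set R) (d : nat) (len : nat -> nat),
    [/\ is_local_ring m, is_krull_dim R d,
        forall e, is_length (frob_power m (p ^ e)) (len e) &
        (fun e => (len e)%:R / (p ^ (e * d))%:R : RR) @ \oo --> l].

Section FrobRoot.
Context (R : comNzRingType) (p : nat) (chR : p \in [pchar R]) (e : nat).

(* The R-module R^(1/p^e), for R reduced of characteristic p: the element r of
   the carrier stands for r^(1/p^e), so that a in R, being (a^(p^e))^(1/p^e),
   acts as multiplication by a^(p^e). *)
Definition frob_root of p \in [pchar R] & nat : Type := R.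
Local Notation Q := (frob_root chR e).

HB.instance Definition _ := GRing.Zmodule.on Q.

Definition frob_root_scale (a : R) (x : Q) : Q := a ^+ (p ^ e) * (x : R).

Lemma frob_root_scaleA a b x :
  frob_root_scale a (frob_root_scale b x) = frob_root_scale (a * b) x.
Proof. by rewrite /frob_root_scale exprMn mulrA. Qed.

Lemma frob_root_scale1 : left_id 1 frob_root_scale.
Proof. by move=> x; rewrite /frob_root_scale expr1n mul1r. Qed.

Lemma frob_root_scaleDr : right_distributive frob_root_scale +%R.
Proof. by move=> a x y; rewrite /frob_root_scale mulrDr. Qed.

Lemma frob_root_scaleDl x : {morph frob_root_scale^~ x : a b / a + b}.
Proof.
move=> a b; rewrite /frob_root_scale -mulrDl; congr (_ * _).
by apply: exprDn_pchar; rewrite pnatX (pnatE _ (pcharf_prime chR)) chR.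
Qed.

HB.instance Definition _ := GRing.Zmodule_isLmodule.Build R Q
  frob_root_scaleA frob_root_scale1 frob_root_scaleDr frob_root_scaleDl.

Definition root_elt (r : R) : Q := r.

(* [a *: root_elt r] is the value at a of the R-linear map R -> R^(1/p^e),
   1 |-> r^(1/p^e). *)
Definition root_map_splits (r : R) : Prop :=
  exists psi : {linear Q -> R^o}, forall a : R, psi (a *: root_elt r) = a.

Definition nonsplit_ideal : set R := [set r | ~ root_map_splits r].

End FrobRoot.

Definition is_F_signature (RR : realType) (p : nat) (R : comNzRingType)
    (chR : p \in [pchar R]) (l : RR) : Prop :=
  exists (d : nat) (len : nat -> nat),
    [/\ is_krull_dim R d,
        forall e, is_length (nonsplit_ideal chR e) (len e) &
        (fun e => (len e)%:R / (p ^ (e * d))%:R : RR) @ \oo --> l].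

Definition mpseries (n : nat) (A : comNzRingType) : Type := 'X_{1..n} -> A.

Section MPSeries.
Context (n : nat) (A : comNzRingType).
Local Notation S := (mpseries n A).

HB.instance Definition _ := GRing.Lmodule.copy S ('X_{1..n} -> A^o).

Implicit Types f g h : S.

Definition mps_const (c : A) : S := fun m => c *+ (m == 0%MM).
Definition mps_var (i : 'I_n) : S := fun m => (m == U_(i)%MM)%:R.
Definition mps_mul f g : S := fun m =>
  \sum_(a : 'X_{1..n < (mdeg m).+1} | (a <= m)%MM) f a * g (m - a)%MM.

Definition mps_trunc (b : nat) f : {mpoly A[n]} :=
  \sum_(a : 'X_{1..n < b}) f a *: 'X_[a].

Lemma mcoeff_trunc b f m : (mdeg m < b)%N -> (mps_trunc b f)@_m = f m.
Proof. by move=> lt; rewrite /mps_trunc (mcoeff_mpoly _ lt). Qed.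

Lemma mps_eqP f g : (forall m, f m = g m) <-> f = g.
Proof. by split=> [fg|->//]; apply/funext. Qed.

Lemma mcoeffM_lin b (p q : {mpoly A[n]}) m : (mdeg m < b)%N ->
  (p * q)@_m = \sum_(a : 'X_{1..n < b} | (a <= m)%MM) p@_a * q@_(m - a).
Proof. exact: mcoeff_poly_mul_lin. Qed.

Lemma mcoeffM_eq b (p p' q q' : {mpoly A[n]}) m : (mdeg m < b)%N ->
    (forall a, (mdeg a < b)%N -> p@_a = p'@_a) ->
    (forall a, (mdeg a < b)%N -> q@_a = q'@_a) ->
  (p * q)@_m = (p' * q')@_m.
Proof.
move=> lt pp qq; rewrite !(mcoeffM_lin _ _ lt).
apply: eq_bigr => a _; rewrite pp ?bmdeg // qq //.
by apply: leq_ltn_trans lt; rewrite mdegB.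
Qed.

Lemma mps_mulE b f g m : (mdeg m < b)%N ->
  mps_mul f g m = (mps_trunc b f * mps_trunc b g)@_m.
Proof.
move=> lt; rewrite (mcoeffM_eq (b := (mdeg m).+1) (p' := mps_trunc (mdeg m).+1 f)
  (q' := mps_trunc (mdeg m).+1 g)) //; last 2 first.
- by move=> a la; rewrite !mcoeff_trunc //; apply: leq_trans lt.
- by move=> a la; rewrite !mcoeff_trunc //; apply: leq_trans lt.
rewrite (mcoeffM_lin _ _ (ltnSn _)); apply: eq_bigr => a _.
by rewrite !mcoeff_trunc ?bmdeg // ltnS mdegB.
Qed.

Lemma mps_mulA : associative mps_mul.
Proof.
move=> f g h; apply/mps_eqP => m; rewrite !(mps_mulE _ _ (ltnSn _)).
pose T := mps_trunc (mdeg m).+1.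
rewrite (mcoeffM_eq (p' := T f) (q' := T g * T h) (ltnSn _)) //; last first.
  by move=> a la; rewrite mcoeff_trunc // (mps_mulE _ _ la).
rewrite mulrA; symmetry.
apply: (mcoeffM_eq (ltnSn _)) => // a la.
by rewrite mcoeff_trunc // (mps_mulE _ _ la).
Qed.

Lemma mps_mulC : commutative mps_mul.
Proof.
by move=> f g; apply/mps_eqP => m; rewrite !(mps_mulE _ _ (ltnSn _)) mulrC.
Qed.

Lemma mps_mulDl : left_distributive mps_mul +%R.
Proof.
move=> f g h; apply/mps_eqP => m; rewrite [RHS]/GRing.add /=.
rewrite /mps_mul -big_split /=; apply: eq_bigr => a _.
by rewrite -mulrDl.
Qed.

Lemma mps_constM c f m : mps_mul (mps_const c) f m = c * f m.
Proof.
rewrite (mps_mulE _ _ (ltnSn _)).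
rewrite (mcoeffM_eq (p' := c%:MP) (q' := mps_trunc (mdeg m).+1 f) (ltnSn _)) //.
  by rewrite mcoeffCM mcoeff_trunc.
by move=> a la; rewrite mcoeff_trunc // mcoeffC /mps_const eq_sym mulr_natr.
Qed.

Lemma mps_mul1 : left_id (mps_const 1) mps_mul.
Proof. by move=> f; apply/mps_eqP => m; rewrite mps_constM mul1r. Qed.

Lemma mps_1neq0 : mps_const 1 != 0.
Proof.
apply/eqP => /mps_eqP/(_ 0%MM); rewrite /mps_const eqxx mulr1n => /eqP.
by rewrite oner_eq0.
Qed.

HB.instance Definition _ := GRing.Zmodule_isComNzRing.Build S
  mps_mulA mps_mulC mps_mul1 mps_mulDl mps_1neq0.

Lemma mps_scaleAl (c : A) f g : c *: (f * g) = (c *: f) * g.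
Proof.
apply/mps_eqP => m; transitivity (c * mps_mul f g m) => //.
transitivity (mps_mul (c *: f) g m) => //; rewrite /mps_mul big_distrr /=.
by apply: eq_bigr => a _; rewrite mulrA.
Qed.

HB.instance Definition _ := GRing.Lmodule_isLalgebra.Build A S mps_scaleAl.
HB.instance Definition _ := GRing.Lalgebra_isComAlgebra.Build A S.

Lemma mps_mul0E f g : (f * g) 0%MM = f 0%MM * g 0%MM.
Proof.
transitivity (mps_mul f g 0%MM) => //.
rewrite (mps_mulE _ _ (b := 1%N)) ?mdeg0 //.
by rewrite rmorphM /= !mcoeff_trunc ?mdeg0.
Qed.

Lemma mps_sum0E (I : finType) (F : I -> S) :
  (\sum_i F i) 0%MM = \sum_i F i 0%MM.
Proof. by apply: (big_morph (fun f : S => f 0%MM)). Qed.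

Lemma mps_nonunit f : f 0%MM = 0 -> ~ exists h, h * f = 1.
Proof.
move=> f0 [h /mps_eqP/(_ 0%MM)]; rewrite mps_mul0E f0 mulr0.
rewrite [in RHS]/GRing.one /= /mps_const eqxx mulr1n => /eqP.
by rewrite eq_sym oner_eq0.
Qed.

End MPSeries.

Section PrincipalQuotient.
Context (S : comNzRingType) (F : S) (hF : ~ exists h, h * F = 1).

Definition principal of (~ exists h, h * F = 1) : pred S :=
  fun x => `[< exists h, x = h * F >].

Lemma principal_closed : idealr_closed (principal hF).
Proof.
split.
- by apply/asboolP; exists 0; rewrite mul0r.
- by apply/negP => /asboolP[h e]; apply: hF; exists h.
- move=> a x y /asboolP[h ->] /asboolP[h' ->]; apply/asboolP.
  by exists (a * h + h'); rewrite mulrDl mulrA.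
Qed.

HB.instance Definition _ := isIdealr.Build S (principal hF) principal_closed.

Definition principal_idealr : idealr S := Idealr.clone S (principal hF) _.

Definition principal_quot : Type := {ideal_quot principal_idealr}.
HB.instance Definition _ := GRing.ComNzRing.on principal_quot.

End PrincipalQuotient.

Section Quartic.
Context (k : closedFieldType) (iota : {rmorphism 'F_2 -> k}).

Lemma char2 : 2%N \in [pchar k].
Proof. by apply: (rmorph_pchar iota); apply: pchar_Fp. Qed.

Definition F2_adjoin (b : k) : set k :=
  [set x | forall E : {pred k}, GRing.divring_closed E -> b \in E -> x \in E].

(* [F_2(b) : F_2]; [pPrimeCharType char2] is k as a vector space over F_2. *)
Definition degF2 (b : k) : nat :=
  qdim (V := pPrimeCharType char2) (F2_adjoin b) [set 0].

Definition quartic (A : comAlgType k) (a : k) (x y z : A) : A :=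
  a *: (x ^+ 2 * y ^+ 2) + z ^+ 4 + x * y * z ^+ 2 + (x ^+ 3 + y ^+ 3) * z.

Definition quartic_poly (a : k) : {mpoly k[3]} :=
  quartic a 'X_(inord 0) 'X_(inord 1) 'X_(inord 2).

Definition e_n (d n : nat) (f : {mpoly k[d]}) : nat :=
  qdim (V := {mpoly k[d]}) setT
    (ideal_gen ([set 'X_i ^+ (2 ^ n) | i in [set: 'I_d]] `|` [set f])).

Lemma exists_artin_schreier_root (a : k) :
  exists l : k, a == l ^+ 2 + l.
Proof.
have [l] := @solve_monicpoly k 2 (fun i => if i == 0%N then a else - 1) isT.
rewrite !big_ord_recl big_ord0 /= expr0 expr1 mulr1 addr0 mulN1r => e.
by exists l; rewrite e addrNK.
Qed.

(* Of the two roots l, l + 1 one is chosen; they have the same degree over F_2. *)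
Definition artin_schreier_root (a : k) : k :=
  xchoose (exists_artin_schreier_root a).

End Quartic.

Inductive gsym : Type := GA of nat | GB of nat | GC | GD.

Definition gsym_code (s : gsym) : nat + nat + bool :=
  match s with
  | GA n => inl (inl n) | GB n => inl (inr n) | GC => inr true | GD => inr false
  end.
Definition gsym_decode (c : nat + nat + bool) : gsym :=
  match c with
  | inl (inl n) => GA n | inl (inr n) => GB n
  | inr true => GC | inr false => GD
  end.
Lemma gsym_codeK : cancel gsym_code gsym_decode.
Proof. by case. Qed.
HB.instance Definition _ := Choice.copy gsym (can_type gsym_codeK).

Notation Gamma := {freeg gsym / int}.

Definition gen (s : gsym) : Gamma := << s >>.

Section Bracket.
Context (k : closedFieldType) (iota : {rmorphism 'F_2 -> k}) (alpha : k).

Local Notation m := (degF2 iota alpha).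

(* Parities are encoded as booleans, [true] being "odd"; P is [parity false]
   and Q is [parity true]. *)
Definition parity (s : bool) : bool :=
  (degF2 iota (artin_schreier_root alpha) == m) (+) s.

Definition hit (s : bool) (n : nat) : bool :=
  (m %| n)%N && (odd (n %/ m) == parity s).

Definition sigma_gen (s : bool) (x : gsym) : Gamma :=
  match x with
  | GA n => if hit s n.+1 then gen (GB n.+1) else gen (GA n.+1)
  | GB n => if hit s n then 0 else gen (GA n.+1) + gen GC
  | GC => gen GC
  | GD => if s then 0 else gen (GA 1)
  end.

(* sigma_0 is [sigma false], sigma_1 is [sigma true] *)
Definition sigma (s : bool) : Gamma -> Gamma := fglift (sigma_gen s).

Fixpoint f_elt (n j : nat) : Gamma :=
  if n is n'.+1 then sigma (odd j) (f_elt n' j./2) else gen GC *+ 2 + gen GD.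

Definition bracket (n j : nat) : rat :=
  let a := coeff (GA n) (f_elt n j) in
  let b := coeff (GB n) (f_elt n j) in
  let c := coeff GC (f_elt n j) in
  let d := coeff GD (f_elt n j) in
  (3 * a + 5 * b + d)%:~R * 2 ^ c.

End Bracket.

Section Hypersurface.
Context (k : closedFieldType) (iota : {rmorphism 'F_2 -> k}).
Context (t : nat) (alpha : 'I_t -> k).

(* The 3t+2 variables, in the order x_0, y_0, z_0, x_1, y_1, z_1, ..., u, v. *)
Local Notation var j := (mps_var k (inord j : 'I_(3 * t).+2)).

Definition hyp_eq : mpseries (3 * t).+2 k :=
  var (3 * t)%N * var (3 * t).+1 +
  \sum_(i < t)
     quartic (alpha i) (var (3 * i)%N) (var (3 * i).+1) (var (3 * i).+2).

Lemma hyp_eq_nonunit : ~ exists h, h * hyp_eq = 1.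
Proof.
apply: mps_nonunit.
have v0 j : var j 0%MM = 0 by rewrite /mps_var eq_sym mnm1_eq0.
have D (f g : mpseries (3 * t).+2 k) : (f + g) 0%MM = f 0%MM + g 0%MM by [].
have Z c (f : mpseries (3 * t).+2 k) : (c *: f) 0%MM = c * f 0%MM by [].
rewrite /hyp_eq D mps_mul0E v0 mul0r add0r mps_sum0E big1 // => i _.
rewrite /quartic !D Z !(mps_mul0E, exprS) !v0.
by rewrite !mulr0 !mul0r mulr0 !addr0.
Qed.

Definition hyp_ring : comNzRingType := principal_quot hyp_eq_nonunit.

Lemma hyp_ring_char2 : 2%N \in [pchar hyp_ring].
Proof.
apply: (rmorph_pchar
  (\pi_{ideal_quot (principal_idealr hyp_eq_nonunit)}%qT \o
   (in_alg (mpseries (3 * t).+2 k) \o iota))).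
exact: pchar_Fp.
Qed.

End Hypersurface.

(* Main.v *)
Require Import Defs.
From HB Require Import structures.
From mathcomp Require Import all_boot all_order all_algebra all_field.
From mathcomp Require Import ring_quotient.
From mathcomp Require Import boolp classical_sets functions reals filter.
From mathcomp Require Import topology_theory.num_topology.
From mathcomp Require Import freeg mpoly mxtens zify ring lra.

(** Write [q = 2 ^ e] and let [S] be the power series ring in the [3 t + 2]
    variables, [F = u v + G] with [G] the sum of the quartics.

    Lengths are ranks. Multiplication by [F] on [S] modulo the [q]-th powers of
    the variables is a nilpotent matrix [M]. The colength of the Frobenius power
    of the maximal ideal of [S / (F)] is the corank of [M]
    ([hypersurface_HK_length]). By the criterion of Fedder the nonsplit ideal is
    the colon ideal of the [q]-th powers by [F ^ (q - 1)], so its colength is the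
    rank of [M ^ (q - 1)] ([hypersurface_nonsplit_length]).

    Tensor sums. As the summands of [F] have disjoint variables, [M] is the
    iterated tensor sum [A *t 1 + 1 *t B] of the matrices of [u v] and of the
    quartics ([coefmx_hyp], [coefmx_tower]). A nilpotent matrix is similar to a
    sum of Jordan blocks, and its rank drop at [l] counts the blocks of size
    larger than [l]. In characteristic two [x + y] is as good a coordinate as
    [y] on [k[x, y]/(x^q, y^q)], which determines the ranks of tensor sums of
    blocks well enough to express corank and top rank by the rank drops
    ([corank_tsum], [rank_tsum_pred]). The rank drops of [u v] are
    [2 (q - l) - 1], so the two colengths are weighted sums of the rank drops of
    [G], and the weights add up to [2 q]. The binary expansion
    [2 (q - l) - 1 = q + \sum_b 2^b (-1)^(l %/ 2^b)] gives the colengths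
    [q ^ (3 t + 1)] plus or minus [\sum_b 2^b R_b], where [R_b] is the alternating
    sum of the rank drops of [G ^ (2^b)], that is, its number of Jordan blocks of
    odd size ([corank_hyp], [rank_hyp_pred]).

    Multiplicativity. Replacing a block of size [j] by its syzygy, of size
    [q - j], reflects the ranks of tensor sums ([rank_tsum_reflect]). It follows
    that two blocks have a tensor sum with one odd block if both are odd and
    none otherwise, so [R_b] is the product of the numbers of odd blocks of the
    [g_i ^ (2^b)] ([altsum_tsum], [altsum_tower]). Frobenius reduces these to
    [b = 0], and there the hypothesis on the brackets determines them: the sum of
    the brackets over [j] is [2 ^ (n + 1) (3 + (m %| n))] by a count of the
    letters [A] and [B] ([bracket_sum], [altsum_quartic]).

    Limits. The product over the blocks of [3 + (m_i %| s)] expands over the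
    subsets of blocks, with one condition on the least common multiple of the
    degrees for each subset. Dividing the correction by [q ^ (3 t + 1)] thus
    leaves [1 / 2] and one geometric series over the multiples of each least
    common multiple ([relative_correctionE]), with the limit of the theorem.

    Krull dimension. Chains of primes of a power series ring in [n] variables
    have length at most [n], by Weierstrass division after a change of
    coordinates and induction ([prime_chain_le]). A chain of length [3 t + 1] in
    [S / (F)] comes from the blow-up chart [x_i = u x_i'], [v = u^3 G(x')] by
    setting the coordinates to zero one after the other ([hyp_krull_dim]). *)

Set Implicit Arguments.
Unset Strict Implicit.
Unset Printing Implicit Defensive.

Import Order.TTheory GRing.Theory Num.Theory.
Import numFieldTopology.Exports.

Local Open Scope classical_set_scope.
Local Open Scope ring_scope.

(** * Similarity and Jordan blocks of nilpotent matrices *)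

Section Similarity.
Context (F : fieldType).

(** The two formats are kept distinct: block sums and Kronecker products, whose
    formats agree only up to an equation, are then compared without casts. *)
Definition mxsim m n (A : 'M[F]_m) (B : 'M[F]_n) : Prop :=
  exists (P : 'M[F]_(m, n)) (Q : 'M[F]_(n, m)),
    [/\ P *m Q = 1%:M, Q *m P = 1%:M & A = P *m B *m Q].

Lemma mxsim_refl m (A : 'M[F]_m) : mxsim A A.
Proof. by exists 1%:M, 1%:M; rewrite !mulmx1 mul1mx. Qed.

Lemma mxsim_sym m n (A : 'M[F]_m) (B : 'M[F]_n) : mxsim A B -> mxsim B A.
Proof.
move=> [P [Q [PQ QP ->]]]; exists Q, P; split=> //.
by rewrite !mulmxA QP mul1mx -mulmxA QP mulmx1.
Qed.

Lemma mxsim_intertwine m n (A : 'M[F]_m) (B : 'M[F]_n) P Q :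
  P *m Q = 1%:M -> Q *m P = 1%:M -> Q *m A = B *m Q -> mxsim A B.
Proof.
by move=> PQ QP QA; exists P, Q; split=> //; rewrite -mulmxA -QA mulmxA PQ mul1mx.
Qed.

Lemma mxsimX m n (A : 'M[F]_m) (B : 'M[F]_n) l :
  mxsim A B -> mxsim (A ^+ l) (B ^+ l).
Proof.
move=> [P [Q [PQ QP eA]]]; apply: (mxsim_intertwine PQ QP).
have QA : Q *m A = B *m Q by rewrite eA !mulmxA QP mul1mx.
elim: l => [|l IH]; first by rewrite !expr0 mulmx1 mul1mx.
by rewrite !exprS -!mulmxE mulmxA QA -mulmxA IH mulmxA.
Qed.

Lemma mxsim_rank m n (A : 'M[F]_m) (B : 'M[F]_n) : mxsim A B -> \rank A = \rank B.
Proof.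
have le m' n' (A' : 'M[F]_m') (B' : 'M[F]_n') : mxsim A' B' -> (\rank A' <= \rank B')%N.
  move=> [P [Q [_ _ ->]]].
  by apply: leq_trans (mxrankM_maxl _ _) (mxrankM_maxr _ _).
by move=> s; apply/eqP; rewrite eqn_leq !le //; apply: mxsim_sym.
Qed.

Lemma mxsim_rankX m n (A : 'M[F]_m) (B : 'M[F]_n) l :
  mxsim A B -> \rank (A ^+ l) = \rank (B ^+ l).
Proof. by move=> /mxsimX s; apply: mxsim_rank (s l). Qed.

Lemma mxsim_eq0X m n (A : 'M[F]_m) (B : 'M[F]_n) l :
  mxsim A B -> A ^+ l = 0 -> B ^+ l = 0.
Proof.
by move=> s /eqP; rewrite -mxrank_eq0 (mxsim_rankX _ s) mxrank_eq0 => /eqP.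
Qed.

Definition mxdsum m n (A : 'M[F]_m) (B : 'M[F]_n) : 'M[F]_(m + n) := block_mx A 0 0 B.

Lemma mxdsumX m n (A : 'M[F]_m) (B : 'M[F]_n) l :
  mxdsum A B ^+ l = mxdsum (A ^+ l) (B ^+ l).
Proof.
elim: l => [|l IH]; first by rewrite !expr0 /mxdsum -scalar_mx_block.
rewrite !exprS IH /mxdsum -!mulmxE mulmx_block.
by rewrite !mul0mx !mulmx0 !add0r !addr0.
Qed.

Lemma rank_mxdsumX m n (A : 'M[F]_m) (B : 'M[F]_n) l :
  \rank (mxdsum A B ^+ l) = (\rank (A ^+ l) + \rank (B ^+ l))%N.
Proof. by rewrite mxdsumX rank_diag_block_mx. Qed.

Lemma mxdsum_eq0X m n (A : 'M[F]_m) (B : 'M[F]_n) l :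
  mxdsum A B ^+ l = 0 -> A ^+ l = 0 /\ B ^+ l = 0.
Proof.
move=> /eqP; rewrite -mxrank_eq0 rank_mxdsumX addn_eq0 !mxrank_eq0.
by move=> /andP[/eqP -> /eqP ->].
Qed.

(** Multiplication by [x] on the monomial basis of [F[x]/(x^n)], acting on row
    vectors. *)
Definition jblock n : 'M[F]_n := \matrix_(i, j) (j == i.+1 :> nat)%:R.

Lemma jblockXE n l i j : (jblock n ^+ l) i j = (j == i + l :> nat)%N%:R.
Proof.
elim: l i j => [|l IH] i j.
  by rewrite expr0 mxE addn0 eq_sym.
rewrite exprS -mulmxE mxE addnS.
have [lt|ge] := ltnP i.+1 n.
  rewrite (bigD1 (Ordinal lt)) //= mxE eqxx mul1r IH /= addSn big1 ?addr0 //.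
  by move=> k /eqP ne; rewrite mxE; case: eqP => [e|_]; rewrite ?mul0r //; case: ne; apply/val_inj.
rewrite big1 => [|k _]; last first.
  by rewrite mxE; case: eqP => [e|_]; rewrite ?mul0r //; move: (ltn_ord k); rewrite e ltnNge ge.
case: eqP => // e; move: (ltn_ord j); rewrite e ltnNge -addSn.
by rewrite (leq_trans ge) // leq_addr.
Qed.

Lemma jblock_nilp n l : (n <= l)%N -> jblock n ^+ l = 0.
Proof.
move=> le; apply/matrixP=> i j; rewrite jblockXE mxE; case: eqP => // e.
by move: (ltn_ord j); rewrite e ltnNge (leq_trans le) // leq_addl.
Qed.

Lemma jblock_eq0X n l : jblock n ^+ l = 0 -> (n <= l)%N.
Proof.
case: n => // n /matrixP e; rewrite leqNgt; apply/negP => lt.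
move: (e ord0 (Ordinal lt)); rewrite jblockXE mxE add0n eqxx => /eqP.
by rewrite oner_eq0.
Qed.

Lemma rank_mul_linv_rinv m n p r (P' : 'M[F]_(n, m)) (P : 'M[F]_(m, n))
    (B : 'M[F]_(n, p)) (Q : 'M[F]_(p, r)) (Q' : 'M[F]_(r, p)) :
  P' *m P = 1%:M -> Q *m Q' = 1%:M -> \rank (P *m B *m Q) = \rank B.
Proof.
move=> PP QQ; apply/eqP; rewrite eqn_leq; apply/andP; split.
  by apply: leq_trans (mxrankM_maxl _ _) (mxrankM_maxr _ _).
have {1}-> : B = P' *m (P *m B *m Q) *m Q'.
  by rewrite !mulmxA PP mul1mx -mulmxA QQ mulmx1.
by apply: leq_trans (mxrankM_maxl _ _) (mxrankM_maxr _ _).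
Qed.

(** The ideal generated by [x^(q - i)] in [F[x]/(x^q)] is a copy of
    [F[x]/(x^i)]: multiplication by [x^(q - i)] is a split surjection [U]
    followed by a split injection [V] that commutes with [x]. *)
Lemma jblock_factor q i : (i <= q)%N ->
  exists (U : 'M[F]_(q, i)) (V : 'M[F]_(i, q)),
    [/\ U^T *m U = 1%:M, V *m V^T = 1%:M, jblock q ^+ (q - i) = U *m V
      & jblock i *m V = V *m jblock q].
Proof.
move=> le; set l := (q - i)%N.
have e : (i + l = q)%N by rewrite subnKC.
pose U : 'M[F]_(q, i) := \matrix_(i, k) (i == k :> nat)%:R.
pose V : 'M[F]_(i, q) := \matrix_(k, j) (j == k + l :> nat)%N%:R.
have widU (k : 'I_i) : (k < q)%N by apply: leq_trans le.
have widV (k : 'I_i) : (k + l < q)%N by rewrite -e ltn_add2r.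
exists U, V; split.
- apply/matrixP=> r c; rewrite mxE (bigD1 (Ordinal (widU r))) //= big1 => [|k /eqP ne].
    by rewrite !mxE /= eqxx mul1r addr0.
  by rewrite !mxE; case: eqP => [ek|_]; rewrite ?mul0r //; case: ne; apply/val_inj.
- apply/matrixP=> r c; rewrite mxE (bigD1 (Ordinal (widV r))) //= big1 => [|k /eqP ne].
    by rewrite !mxE /= eqxx mul1r addr0 eqn_add2r.
  by rewrite !mxE; case: eqP => [ek|_]; rewrite ?mul0r //; case: ne; apply/val_inj.
- apply/matrixP=> r c; rewrite mxE jblockXE; have [lt|ge] := ltnP r i.
    rewrite (bigD1 (Ordinal lt)) //= big1 => [|k /eqP ne].
      by rewrite !mxE /= eqxx mul1r addr0.
    by rewrite !mxE; case: eqP => [ek|_]; rewrite ?mul0r //; case: ne; apply/val_inj.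
  rewrite big1 => [|k _]; first by case: eqP => // ec; move: (ltn_ord c); lia.
  by rewrite !mxE; case: eqP => [ek|_]; rewrite ?mul0r //; move: (ltn_ord k); lia.
- apply/matrixP=> r c; transitivity ((c == (r.+1 + l)%N :> nat)%:R : F); rewrite mxE.
    have [lt|ge] := ltnP r.+1 i.
      rewrite (bigD1 (Ordinal lt)) //= big1 => [|k /eqP ne].
        by rewrite !mxE /= eqxx mul1r addr0.
      by rewrite !mxE; case: eqP => [ek|_]; rewrite ?mul0r //; case: ne; apply/val_inj.
    rewrite big1 => [|k _]; first by case: eqP => // ec; move: (ltn_ord c); lia.
    by rewrite !mxE; case: eqP => [ek|_]; rewrite ?mul0r //; move: (ltn_ord k); lia.
  rewrite (bigD1 (Ordinal (widV r))) //= big1 => [|k /eqP ne].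
    by rewrite !mxE /= eqxx mul1r addr0 -addSn.
  by rewrite !mxE; case: eqP => [ek|_]; rewrite ?mul0r //; case: ne; apply/val_inj.
Qed.

Lemma rank_jblockX n l : \rank (jblock n ^+ l) = (n - l)%N.
Proof.
have [le|/ltnW lt] := leqP n l.
  by rewrite jblock_nilp // mxrank0; apply/esym/eqP.
have [U [V [UU VV eJ _]]] := jblock_factor (leq_subr l n).
rewrite -[l in LHS](subKn lt) eJ -[U]mulmx1.
by rewrite (rank_mul_linv_rinv _ UU VV) mxrank1.
Qed.

End Similarity.

Section Jordan.
Context (F : fieldType).

Lemma mxsim_of_row_free m n (A : 'M[F]_m) (B : 'M[F]_n) (Q : 'M[F]_(n, m)) :
  n = m -> row_free Q -> Q *m A = B *m Q -> mxsim A B.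
Proof.
move=> e; subst n => fQ QA; have uQ : Q \in unitmx by rewrite -row_free_unit.
by apply: (@mxsim_intertwine _ _ _ A B (invmx Q) Q); rewrite ?mulVmx ?mulmxV.
Qed.

(** If [A^l = 0] and the entry [(i0, j0)] of [A^(l-1)] is nonzero, the rows
    [i0] of the powers of [A] span a cyclic submodule of dimension [l], and the
    vectors orthogonal to the columns [j0] of the powers of [A] form an
    invariant complement: the pairing of the two families is triangular. *)
Lemma nilp_split m (A : 'M[F]_m) q : (0 < m)%N -> A ^+ q = 0 ->
  exists l m' (A' : 'M[F]_m'), [/\ (0 < l)%N, (l + m' = m)%N & mxsim A (mxdsum (jblock F l) A')].
Proof.
move=> m0 Aq0.
have exl : exists l, A ^+ l == 0 by exists q; apply/eqP.
case: (ex_minnP exl) => l /eqP Al0 lmin.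
have l0 : (0 < l)%N.
  rewrite lt0n; apply/eqP => e; move: Al0; rewrite e expr0 => /eqP.
  by rewrite -mxrank_eq0 mxrank1 -leqn0 leqNgt m0.
have /matrix0Pn[i0 [j0 nz]] : A ^+ l.-1 != 0.
  by apply/negP => /lmin; rewrite leqNgt prednK ?leqnn.
have AX0 k : (l <= k)%N -> A ^+ k = 0.
  by move=> le; rewrite -(subnK le) exprD Al0 mulr0.
pose U : 'M[F]_(l, m) := \matrix_(i, j) (A ^+ i) i0 j.
pose W : 'M[F]_(m, l) := \matrix_(i, j) (A ^+ j) i j0.
have UWE i j : (U *m W) i j = (A ^+ (i + j)) i0 j0.
  by rewrite exprD -mulmxE !mxE; apply: eq_bigr => k _; rewrite !mxE.
have UA : U *m A = jblock F l *m U.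
  apply/matrixP=> i j; transitivity ((A ^+ i.+1) i0 j).
    by rewrite exprSr -mulmxE !mxE; apply: eq_bigr => k _; rewrite !mxE.
  rewrite mxE; have [lt|ge] := ltnP i.+1 l.
    rewrite (bigD1 (Ordinal lt)) //= big1 => [|k /eqP ne].
      by rewrite !mxE eqxx mul1r addr0.
    rewrite !mxE; case: eqP => [e|_]; rewrite ?mul0r //.
    by case: ne; apply/val_inj.
  rewrite AX0 // mxE big1 // => k _.
  rewrite !mxE; case: eqP => [e|_]; rewrite ?mul0r //.
  by move: (ltn_ord k); rewrite e ltnNge ge.
have AW : A *m W = W *m (jblock F l)^T.
  apply/matrixP=> i j; transitivity ((A ^+ j.+1) i j0).
    by rewrite exprS -mulmxE !mxE; apply: eq_bigr => k _; rewrite !mxE.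
  rewrite mxE; have [lt|ge] := ltnP j.+1 l.
    rewrite (bigD1 (Ordinal lt)) //= big1 => [|k /eqP ne].
      by rewrite !mxE eqxx mulr1 addr0.
    rewrite !mxE; case: eqP => [e|_]; rewrite ?mulr0 //.
    by case: ne; apply/val_inj.
  rewrite AX0 // mxE big1 // => k _.
  rewrite !mxE; case: eqP => [e|_]; rewrite ?mulr0 //.
  by move: (ltn_ord k); rewrite e ltnNge ge.
have fUW : row_free (U *m W).
  apply: inj_row_free => v; apply: contra_eq => nzv.
  have [c nzc] : exists c, v 0 c != 0.
    by move: nzv => /matrix0Pn[i [c]]; rewrite (ord1 i); exists c.
  (* pair [v] with the power that moves its first nonzero entry to [l - 1] *)
  case: (@arg_minnP _ c (fun c => v 0 c != 0) val nzc) => {nzc} c' nzc cmin.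
  have ltc : (l.-1 - c' < l)%N by rewrite (leq_ltn_trans (leq_subr _ _)) // prednK.
  apply/matrix0Pn; exists 0, (Ordinal ltc).
  rewrite mxE (bigD1 c') //= big1 => [|k ne].
    rewrite addr0 UWE /= subnKC; first by rewrite mulf_neq0.
    by rewrite -ltnS prednK.
  rewrite UWE /=; have [->|/cmin le] := eqVneq (v 0 k) 0; first by rewrite mul0r.
  have lt : (c' < k)%N by rewrite ltn_neqAle le andbT eq_sym.
  have ltc' : (c' < l)%N by [].
  by rewrite AX0 ?mxE ?mulr0 //; lia.
pose C := row_base (kermx W).
have CW : C *m W = 0.
  by apply/eqP; rewrite -sub_kermx eq_row_base.
have CA : (C *m A <= C)%MS.
  by rewrite eq_row_base sub_kermx -mulmxA AW mulmxA CW mul0mx.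
have rW : \rank W = l.
  apply/eqP; rewrite eqn_leq rank_leq_col /= -{1}(eqP fUW).
  exact: mxrankM_maxr.
exists l, (\rank (kermx W)), (C *m A *m pinvmx C); split=> //.
  by rewrite mxrank_ker rW subnKC // -rW rank_leq_row.
apply: (@mxsim_of_row_free _ _ _ _ (col_mx U C)).
- by rewrite mxrank_ker rW subnKC // -rW rank_leq_row.
- apply: inj_row_free => v; rewrite -[v]hsubmxK mul_row_col => e.
  have : (lsubmx v *m U + rsubmx v *m C) *m W = 0 by rewrite e mul0mx.
  rewrite mulmxDl -mulmxA -(mulmxA _ C) CW mulmx0 addr0 => z.
  have lv0 : lsubmx v = 0 by apply: (row_free_inj fUW); rewrite mul0mx.
  have rv0 : rsubmx v = 0.
    apply: (row_free_inj (row_base_free (kermx W))); rewrite mul0mx.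
    by move: e; rewrite lv0 mul0mx add0r.
  by rewrite lv0 rv0 row_mx0.
- by rewrite /mxdsum mul_col_mx mul_block_col !mul0mx addr0 add0r UA mulmxKpV.
Qed.

(** Splitting off one block at a time reduces every statement on nilpotent
    matrices that is invariant under similarity and additive to Jordan
    blocks. *)
Lemma nilp_ind q (P : forall m, 'M[F]_m -> Prop) :
  (forall m n (A : 'M[F]_m) (B : 'M[F]_n),
      A ^+ q = 0 -> B ^+ q = 0 -> mxsim A B -> P n B -> P m A) ->
  (forall l n (B : 'M[F]_n), (l <= q)%N -> B ^+ q = 0 ->
      P l (jblock F l) -> P n B -> P (l + n)%N (mxdsum (jblock F l) B)) ->
  (forall l, (l <= q)%N -> P l (jblock F l)) ->
  forall m (A : 'M[F]_m), A ^+ q = 0 -> P m A.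
Proof.
move=> Psim Psum PJ m A; have [n] := ubnP m; elim: n => // n IH in m A *.
case: m A => [|m] A.
  by move=> _ _; rewrite [A]thinmx0 -[X in P _ X](thinmx0 (jblock F 0)); apply: PJ.
rewrite ltnS => lt Aq; have [l [m' [A' [l0 em sim]]]] := nilp_split (ltn0Sn m) Aq.
have Bq := mxsim_eq0X sim Aq; have [Jq A'q] := mxdsum_eq0X Bq.
have lq := jblock_eq0X Jq.
apply: (Psim _ _ _ _ Aq Bq sim); apply: Psum => //; first exact: PJ.
by apply: IH => //; rewrite (leq_trans _ lt) // -em -addn1 addnC leq_add2r.
Qed.

End Jordan.

(** * Tensor sums *)

Section TensorSum.
Context (F : fieldType).

Lemma tensmxDl m n p r (A B : 'M[F]_(m, n)) (C : 'M[F]_(p, r)) :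
  (A + B) *t C = A *t C + B *t C.
Proof.
apply/matrixP=> i j; case: (mxtens_indexP i) => a b; case: (mxtens_indexP j) => c d.
by rewrite tensmxE [RHS]mxE !tensmxE mxE mulrDl.
Qed.

Lemma tensmx1 m n : (1%:M : 'M[F]_m) *t (1%:M : 'M[F]_n) = 1%:M.
Proof.
apply/matrixP=> i j; case: (mxtens_indexP i) => a b; case: (mxtens_indexP j) => c d.
rewrite tensmxE !mxE -natrM mulnb.
by rewrite (can_eq (@mxtens_indexK m n)) xpair_eqE.
Qed.

Lemma tensmxX m n (A : 'M[F]_m) (B : 'M[F]_n) l : (A *t B) ^+ l = A ^+ l *t B ^+ l.
Proof.
elim: l => [|l IH]; first by rewrite !expr0 tensmx1.
by rewrite !exprS IH -!mulmxE tensmx_mul.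
Qed.

Lemma rank_tensmx m n p r (A : 'M[F]_(m, n)) (B : 'M[F]_(p, r)) :
  \rank (A *t B) = (\rank A * \rank B)%N.
Proof.
have [[ca eca] [ra era]] := (row_fullP (col_base_full A), row_freeP (row_base_free A)).
have [[cb ecb] [rb erb]] := (row_fullP (col_base_full B), row_freeP (row_base_free B)).
rewrite -{1}(mulmx_base A) -{1}(mulmx_base B) -tensmx_mul.
rewrite -[X in _ *m X]mul1mx mulmxA.
rewrite (@rank_mul_linv_rinv _ _ _ _ _ (ca *t cb) _ _ _ (ra *t rb)) ?mxrank1 //.
  by rewrite tensmx_mul eca ecb tensmx1.
by rewrite tensmx_mul era erb tensmx1.
Qed.

(** If [A] and [B] are the actions of variables [x] and [y] on two modules, this
    is the action of [x + y] on their tensor product. *)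
Definition tsum m n (A : 'M[F]_m) (B : 'M[F]_n) : 'M[F]_(m * n) :=
  A *t 1%:M + 1%:M *t B.

Lemma tens1_comm m n (A : 'M[F]_m) (B : 'M[F]_n) :
  GRing.comm (A *t 1%:M) (1%:M *t B : 'M[F]_(m * n)).
Proof. by rewrite /GRing.comm -!mulmxE !tensmx_mul !mulmx1 !mul1mx. Qed.

Lemma mxsim_tsum m m' n n' (A : 'M[F]_m) (A' : 'M[F]_m') (B : 'M[F]_n) (B' : 'M[F]_n') :
  mxsim A A' -> mxsim B B' -> mxsim (tsum A B) (tsum A' B').
Proof.
move=> [P [Q [PQ QP eA]]] [R [S [RS SR eB]]].
apply: (@mxsim_intertwine _ _ _ _ _ (P *t R) (Q *t S)); rewrite ?tensmx_mul.
- by rewrite PQ RS tensmx1.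
- by rewrite QP SR tensmx1.
rewrite /tsum mulmxDl mulmxDr !tensmx_mul !mulmx1 !mul1mx eA eB.
by rewrite !mulmxA QP SR !mul1mx.
Qed.

Lemma mxsim_tsumC m n (A : 'M[F]_m) (B : 'M[F]_n) : mxsim (tsum A B) (tsum B A).
Proof.
(* the matrix of the exchange of the two tensor factors *)
pose K m n : 'M[F]_(m * n, n * m) := \matrix_(i, j)
  ((mxtens_unindex i == ((mxtens_unindex j).2, (mxtens_unindex j).1))%:R).
have KE m' n' a b c d : K m' n' (mxtens_index (a, b)) (mxtens_index (c, d)) = ((a == d) && (b == c))%:R.
  by rewrite mxE !mxtens_indexK.
have KM m1 n1 m2 n2 (X : 'M[F]_(m1, m2)) (Y : 'M[F]_(n1, n2)) :
    (Y *t X) *m K n2 m2 = K n1 m1 *m (X *t Y).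
  apply/matrixP=> i j; case: (mxtens_indexP i) => a b; case: (mxtens_indexP j) => c d.
  transitivity (X b c * Y a d).
    rewrite mxE (bigD1 (mxtens_index (d, c))) //= big1 => [|k].
      by rewrite KE !eqxx mulr1 addr0 tensmxE mulrC.
    case: (mxtens_indexP k) => k1 k2 ne; rewrite KE; case: andP; rewrite ?mulr0 //.
    by move=> [/eqP e1 /eqP e2]; move: ne; rewrite e1 e2 eqxx.
  rewrite mxE (bigD1 (mxtens_index (b, a))) //= big1 => [|k].
    by rewrite KE !eqxx mul1r addr0 tensmxE.
  case: (mxtens_indexP k) => k1 k2 ne; rewrite KE; case: andP; rewrite ?mul0r //.
  by move=> [/eqP e1 /eqP e2]; move: ne; rewrite e1 e2 eqxx.
have KK m' n' : K m' n' *m K n' m' = 1%:M.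
  apply/matrixP=> i j; case: (mxtens_indexP i) => a b; case: (mxtens_indexP j) => c d.
  rewrite mxE (bigD1 (mxtens_index (b, a))) //= big1 => [|k].
    rewrite !KE !eqxx mul1r addr0 mxE (can_eq (@mxtens_indexK _ _)) xpair_eqE.
    by rewrite andbC.
  case: (mxtens_indexP k) => k1 k2 ne; rewrite KE; case: andP; rewrite ?mul0r //.
  by move=> [/eqP e1 /eqP e2]; move: ne; rewrite e1 e2 eqxx.
apply: (@mxsim_intertwine _ _ _ _ _ (K m n) (K n m)); rewrite ?KK //.
by rewrite /tsum mulmxDl mulmxDr addrC !KM.
Qed.

Lemma mxsim_tsum_dsum m n p (A : 'M[F]_m) (B : 'M[F]_n) (C : 'M[F]_p) :
  mxsim (tsum (mxdsum A B) C) (mxdsum (tsum A C) (tsum B C)).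
Proof.
pose E1 : 'M[F]_(m, m + n) := row_mx 1%:M 0.
pose E2 : 'M[F]_(n, m + n) := row_mx 0 1%:M.
have c11 : E1 *m E1^T = 1%:M by rewrite tr_row_mx mul_row_col !trmx1 !trmx0 mulmx0 addr0 mulmx1.
have c12 : E1 *m E2^T = 0 by rewrite tr_row_mx mul_row_col !trmx1 !trmx0 mulmx0 add0r mul0mx.
have c21 : E2 *m E1^T = 0 by rewrite tr_row_mx mul_row_col !trmx1 !trmx0 mulmx0 addr0 mul0mx.
have c22 : E2 *m E2^T = 1%:M by rewrite tr_row_mx mul_row_col !trmx1 !trmx0 mulmx0 add0r mulmx1.
have cc : E1^T *m E1 + E2^T *m E2 = 1%:M.
  rewrite !tr_row_mx !mul_col_row !(trmx1, trmx0, mulmx1, mulmx0, mul0mx).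
  by rewrite add_block_mx !addr0 !add0r -scalar_mx_block.
have e1 : E1 *m mxdsum A B = A *m E1.
  by rewrite /mxdsum /E1 mul_row_block mul_mx_row !(mul1mx, mul0mx, mulmx1, mulmx0) !(addr0, add0r).
have e2 : E2 *m mxdsum A B = B *m E2.
  by rewrite /mxdsum /E2 mul_row_block mul_mx_row !(mul1mx, mul0mx, mulmx1, mulmx0) !(addr0, add0r).
apply: (@mxsim_intertwine _ _ _ _ _ (row_mx (E1^T *t 1%:M) (E2^T *t 1%:M))
   (col_mx (E1 *t 1%:M) (E2 *t 1%:M))).
- by rewrite mul_row_col !tensmx_mul !mulmx1 -tensmxDl cc tensmx1.
- rewrite mul_col_row !tensmx_mul c11 c12 c21 c22 mulmx1 !tens0mx !tensmx1.
  by rewrite -scalar_mx_block.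
rewrite mul_col_mx /mxdsum mul_block_col !mul0mx addr0 add0r.
by rewrite /tsum !mulmxDl !mulmxDr !tensmx_mul !mulmx1 !mul1mx -/(mxdsum A B) e1 e2.
Qed.

Lemma rank_tsum_dsumX m n p (A : 'M[F]_m) (B : 'M[F]_n) (C : 'M[F]_p) l :
  \rank (tsum (mxdsum A B) C ^+ l) =
  (\rank (tsum A C ^+ l) + \rank (tsum B C ^+ l))%N.
Proof. by rewrite (mxsim_rankX l (mxsim_tsum_dsum A B C)) rank_mxdsumX. Qed.

End TensorSum.

(** * Tensor sums of Jordan blocks in characteristic two *)

Section Char2.
Context (F : fieldType) (c2 : 2%N \in [pchar F]).

Lemma mx_addrr_char2 m n (A : 'M[F]_(m, n)) : A + A = 0.
Proof. by apply/matrixP=> i j; rewrite !mxE addrr_pchar2. Qed.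

Lemma comm_frob2 m (A B : 'M[F]_m) n :
  GRing.comm A B -> (A + B) ^+ (2 ^ n) = A ^+ (2 ^ n) + B ^+ (2 ^ n).
Proof.
move=> cAB; elim: n => [|n IH]; first by rewrite !expr1.
rewrite expnSr !exprM IH.
set X := A ^+ _; set Y := B ^+ _.
have cXY : GRing.comm X Y by apply: commrX; apply/commr_sym/commrX/commr_sym.
rewrite !expr2 mulrDl !mulrDr -cXY addrA -(addrA (X * X)) mx_addrr_char2.
by rewrite addr0.
Qed.

Lemma tsum_frob2 m n (A : 'M[F]_m) (B : 'M[F]_n) e :
  tsum A B ^+ (2 ^ e) = tsum (A ^+ (2 ^ e)) (B ^+ (2 ^ e)).
Proof. by rewrite comm_frob2 ?tensmxX ?expr1n //; apply: tens1_comm. Qed.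

Lemma tsum_nilp m n (A : 'M[F]_m) (B : 'M[F]_n) e :
  A ^+ (2 ^ e) = 0 -> B ^+ (2 ^ e) = 0 -> tsum A B ^+ (2 ^ e) = 0.
Proof. by move=> A0 B0; rewrite tsum_frob2 A0 B0 /tsum tens0mx tensmx0 addr0. Qed.

(** The ring [F[x, y]/(x^q, y^q)] with [q = 2^e] and its element [t = x + y]: by
    the Frobenius identity [t^q = 0], so [t] is as good a coordinate as [y]. *)
Section Square.
Context (e : nat).
Local Notation q := (2 ^ e)%N.
Local Notation x := (jblock F q *t 1%:M : 'M[F]_(q * q)).
Local Notation y := (1%:M *t jblock F q : 'M[F]_(q * q)).
Local Notation t := (tsum (jblock F q) (jblock F q)).

Let q_gt0 : (0 < q)%N. Proof. by rewrite expn_gt0. Qed.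
Let o : 'I_q := Ordinal q_gt0.
Let e0 : 'rV[F]_(q * q) := delta_mx 0 (mxtens_index (o, o)).

Let xy : GRing.comm x y. Proof. exact: tens1_comm. Qed.
Let xq l : (q <= l)%N -> x ^+ l = 0.
Proof. by move=> le; rewrite tensmxX jblock_nilp // tens0mx. Qed.
Let yq l : (q <= l)%N -> y ^+ l = 0.
Proof. by move=> le; rewrite tensmxX jblock_nilp // tensmx0. Qed.
Let tq l : (q <= l)%N -> t ^+ l = 0.
Proof.
by move=> le; rewrite -(subnK le) exprD tsum_nilp ?mulr0 // jblock_nilp.
Qed.
Let xt : GRing.comm x t. Proof. exact: commrD. Qed.
Let yt : GRing.comm y t. Proof. by apply: commrD => //; apply: commr_sym. Qed.

Let xXyX a b : x ^+ a *m y ^+ b = jblock F q ^+ a *t jblock F q ^+ b.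
Proof. by rewrite !tensmxX tensmx_mul !expr1n mul1mx mulmx1. Qed.

Let rank_xy a b : \rank (x ^+ a *m y ^+ b) = ((q - a) * (q - b))%N.
Proof. by rewrite xXyX rank_tensmx !rank_jblockX. Qed.

Let e0xy (a b : 'I_q) : e0 *m (x ^+ a *m y ^+ b) = delta_mx 0 (mxtens_index (a, b)).
Proof.
rewrite xXyX -rowE; apply/rowP => k; case: (mxtens_indexP k) => c d.
rewrite mxE tensmxE !jblockXE !mxE /= !add0n -natrM mulnb.
by rewrite (can_eq (@mxtens_indexK _ _)) xpair_eqE.
Qed.

(** The substitution that fixes [x] and sends [y] to [t]; it is an involution
    because [x + t = y] in characteristic two. *)
Let theta : 'M[F]_(q * q) := \matrix_(i < q * q)
  (e0 *m (x ^+ (mxtens_unindex i).1 *m t ^+ (mxtens_unindex i).2)).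

Let thetaE a b : e0 *m (x ^+ a *m y ^+ b) *m theta = e0 *m (x ^+ a *m t ^+ b).
Proof.
have [lta|/xq->] := ltnP a q; last by rewrite !(mul0mx, mulmx0).
have [ltb|geb] := ltnP b q; last by rewrite yq // tq // !(mul0mx, mulmx0).
have := e0xy (Ordinal lta) (Ordinal ltb); rewrite /= => ->.
by rewrite -rowE rowK mxtens_indexK.
Qed.

Let basis_ext p (A B : 'M[F]_(q * q, p)) :
  (forall a b, e0 *m (x ^+ a *m y ^+ b) *m A = e0 *m (x ^+ a *m y ^+ b) *m B) -> A = B.
Proof.
move=> h; apply/row_matrixP => k; case: (mxtens_indexP k) => a b.
by rewrite !rowE -e0xy h.
Qed.

Let xtheta : x *m theta = theta *m x.
Proof.
apply: basis_ext => a b.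
have -> : e0 *m (x ^+ a *m y ^+ b) *m (x *m theta) =
          e0 *m (x ^+ a.+1 *m y ^+ b) *m theta.
  rewrite mulmxA -(mulmxA e0); congr (_ *m _ *m _).
  by rewrite !mulmxE exprSr -!mulrA (commrX b xy).
rewrite thetaE [RHS]mulmxA thetaE -[RHS]mulmxA; congr (_ *m _).
by rewrite !mulmxE exprSr -!mulrA (commrX b xt).
Qed.

Let ytheta : y *m theta = theta *m t.
Proof.
apply: basis_ext => a b.
have -> : e0 *m (x ^+ a *m y ^+ b) *m (y *m theta) =
          e0 *m (x ^+ a *m y ^+ b.+1) *m theta.
  by rewrite mulmxA -(mulmxA e0) -(mulmxA (x ^+ a)) mulmxE -exprSr.
rewrite thetaE [RHS]mulmxA thetaE -[RHS]mulmxA -(mulmxA (x ^+ a)).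
by rewrite !mulmxE -exprSr.
Qed.

Let ttheta : t *m theta = theta *m y.
Proof.
have tE : t = x + y by [].
have yE : y = x + t by rewrite tE addrA mx_addrr_char2 add0r.
by rewrite {1}tE {2}yE mulmxDl mulmxDr xtheta ytheta.
Qed.

Let intertwineX (A B : 'M[F]_(q * q)) l :
  A *m theta = theta *m B -> A ^+ l *m theta = theta *m B ^+ l.
Proof.
move=> h; elim: l => [|l IH]; first by rewrite !expr0 mul1mx mulmx1.
by rewrite !exprS -!mulmxE -mulmxA IH !mulmxA h.
Qed.

Let theta_invol : theta *m theta = 1%:M.
Proof.
apply: basis_ext => a b; rewrite mulmxA thetaE mulmx1.
rewrite -!mulmxA (intertwineX _ ttheta) (mulmxA (x ^+ a)) (intertwineX _ xtheta).
have : e0 *m (x ^+ 0 *m y ^+ 0) *m theta = e0 *m (x ^+ 0 *m t ^+ 0) by exact: thetaE.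
by rewrite !expr0 !mulmx1 !mulmxA => ->.
Qed.

Let rank_xt a l : \rank (x ^+ a *m t ^+ l) = ((q - a) * (q - l))%N.
Proof.
rewrite -rank_xy; symmetry; apply: mxsim_rank.
apply: (mxsim_intertwine theta_invol theta_invol).
by rewrite -[RHS]mulmxA (intertwineX l ttheta) [RHS]mulmxA (intertwineX a xtheta) -mulmxA.
Qed.


(** The ranks say that [x^a S], with [S = F[x, y]/(x^q, y^q)], is free over
    [F[z]/(z^q)]; on a free module the kernel of [z^(q - j)] is the image of
    [z^j]. *)
Let ker_free (z : 'M[F]_(q * q)) a j : (j <= q)%N ->
    (forall l, \rank (x ^+ a *m z ^+ l) = ((q - a) * (q - l))%N) -> z ^+ q = 0 ->
    GRing.comm x z ->
  (x ^+ a :&: kermx (z ^+ (q - j)) :=: x ^+ a *m z ^+ j)%MS.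
Proof.
move=> jq rz zq0 xz; apply/eqmx_sym/eqmxP.
have sub : (x ^+ a *m z ^+ j <= x ^+ a :&: kermx (z ^+ (q - j)))%MS.
  rewrite sub_capmx sub_kermx -mulmxA !mulmxE -exprD subnKC // zq0 mulr0 eqxx andbT.
  rewrite (commrX j (commr_sym (commrX a (commr_sym xz)))) -mulmxE.
  exact: submxMl.
rewrite sub andTb -(mxrank_leqif_sup sub); apply/eqP.
have := mxrank_mul_ker (x ^+ a) (z ^+ (q - j)).
have := rz 0%N; rewrite expr0 mulmx1 !rz => ->; rewrite subn0 subKn //.
by move: (q - a)%N => c; nia.
Qed.

Let cap_rank (z B : 'M[F]_(q * q)) a j : (j <= q)%N ->
    (forall l, \rank (x ^+ a *m z ^+ l) = ((q - a) * (q - l))%N) -> z ^+ q = 0 ->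
    GRing.comm x z -> (B <= x ^+ a)%MS ->
  (\rank (B *m z ^+ (q - j)) + \rank (B :&: x ^+ a *m z ^+ j)%MS)%N = \rank B.
Proof.
move=> jq rz zq0 xz BM; rewrite -[RHS](mxrank_mul_ker B (z ^+ (q - j))).
congr (_ + _)%N.
rewrite -(cap_eqmx (eqmx_refl B) (ker_free jq rz zq0 xz)) capmxA.
by rewrite (cap_eqmx (capmx_idPl BM) (eqmx_refl _)).
Qed.

(** By [ker_free], both sides are the dimension of the intersection of
    [x^a y^j S] and [x^a t^l S], up to the ranks of the two intersected
    submodules. *)
Lemma rank_reflect a j l : (j <= q)%N -> (l <= q)%N ->
  (\rank (x ^+ a *m y ^+ (q - j) *m t ^+ l) + (q - a) * l =
   \rank (x ^+ a *m y ^+ j *m t ^+ (q - l)) + (q - a) * j)%N.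
Proof.
move=> jq lq.
have sub z c : GRing.comm x z -> (x ^+ a *m z ^+ c <= x ^+ a)%MS.
  move=> xz; rewrite mulmxE (commrX c (commr_sym (commrX a (commr_sym xz)))) -mulmxE.
  exact: submxMl.
have e1 := @cap_rank y (x ^+ a *m t ^+ l) a j jq (rank_xy a) (yq (leqnn q)) xy (sub _ _ xt).
have e2 := @cap_rank t (x ^+ a *m y ^+ j) a l lq (rank_xt a) (tq (leqnn q)) xt (sub _ _ xy).
rewrite rank_xt in e1; rewrite rank_xy in e2.
have ec : (x ^+ a *m y ^+ (q - j) *m t ^+ l) = (x ^+ a *m t ^+ l *m y ^+ (q - j)).
  rewrite -!mulmxA; congr (_ *m _); rewrite !mulmxE.
  by apply: commrX; apply/commr_sym/commrX/commr_sym.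
rewrite ec; move: e1 e2; rewrite (capmxC (x ^+ a *m y ^+ j)).
move: (\rank _) (\rank _) (\rank _) (q - a)%N => A B C d; nia.
Qed.

(** Since [t] kills [t^(q - 1)], the variables [x] and [y = x + t] act on it in
    the same way. *)
Lemma rank_top a b : \rank (x ^+ a *m y ^+ b *m t ^+ q.-1) = (q - (a + b))%N.
Proof.
have h c : y ^+ c * t ^+ q.-1 = x ^+ c * t ^+ q.-1.
  have h1 : y * t ^+ q.-1 = x * t ^+ q.-1.
    apply/eqP; rewrite -subr_eq0 -mulrBl.
    have -> : y - x = t.
      by rewrite -[t]/(x + y) addrC; congr (_ + _); apply/eqP; rewrite eq_sym -addr_eq0 mx_addrr_char2.
    by rewrite -exprS prednK // tq.
  elim: c => [|c IH]; first by rewrite !expr0.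
  rewrite [y ^+ _]exprS [x ^+ _]exprS -!mulrA IH mulrA (commrX c (commr_sym xy)).
  by rewrite -mulrA h1 !mulrA -exprSr -exprS.
rewrite -mulmxA !mulmxE h mulrA -exprD -mulmxE rank_xt.
by have -> : (q - q.-1 = 1)%N; [lia | rewrite muln1].
Qed.

(** [F[x]/(x^i)] and [F[y]/(y^j)] embed as the ideals generated by [x^(q - i)]
    and [y^(q - j)], so all tensor sums of blocks are seen inside
    [F[x, y]/(x^q, y^q)]. *)
Lemma rank_tsum_jblockX i j l : (i <= q)%N -> (j <= q)%N ->
  \rank (tsum (jblock F i) (jblock F j) ^+ l) =
  \rank (x ^+ (q - i) *m y ^+ (q - j) *m t ^+ l).
Proof.
move=> iq jq; have [U [V [UU VV eJ JV]]] := jblock_factor F iq.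
have [U' [V' [UU' VV' eJ' JV']]] := jblock_factor F jq.
have VT : V *t V' *m t = tsum (jblock F i) (jblock F j) *m (V *t V').
  by rewrite mulmxDl mulmxDr !tensmx_mul !mulmx1 !mul1mx JV JV'.
have VTX : V *t V' *m t ^+ l = tsum (jblock F i) (jblock F j) ^+ l *m (V *t V').
  elim: l => [|l IH]; first by rewrite !expr0 mul1mx mulmx1.
  by rewrite exprSr -mulmxE mulmxA IH -mulmxA VT mulmxA mulmxE -exprSr.
rewrite xXyX eJ eJ' -tensmx_mul -[in RHS]mulmxA VTX mulmxA; symmetry.
apply: (@rank_mul_linv_rinv _ _ _ _ _ (U^T *t U'^T) _ _ _ (V^T *t V'^T)).
  by rewrite tensmx_mul UU UU' tensmx1.
by rewrite tensmx_mul VV VV' tensmx1.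
Qed.

(** [F[x]/(x^(q - j))] is the syzygy of [F[x]/(x^j)] over the self-injective ring
    [F[x]/(x^q)]; replacing the one by the other exchanges kernels and
    cokernels, hence reflects the exponent [l]. *)
Lemma rank_tsum_reflect i j l : (i <= q)%N -> (j <= q)%N -> (l <= q)%N ->
  (\rank (tsum (jblock F i) (jblock F j) ^+ l) + i * l =
   \rank (tsum (jblock F i) (jblock F (q - j)) ^+ (q - l)) + i * j)%N.
Proof.
move=> iq jq lq; rewrite !rank_tsum_jblockX ?leq_subr // (subKn jq).
by have := rank_reflect (q - i) jq lq; rewrite subKn.
Qed.

Lemma rank_tsum_top i j : (i <= q)%N -> (j <= q)%N ->
  \rank (tsum (jblock F i) (jblock F j) ^+ q.-1) = (i + j - q)%N.
Proof. by move=> iq jq; rewrite rank_tsum_jblockX // rank_top; lia. Qed.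

Lemma rank_tsum1 i j : (i <= q)%N -> (j <= q)%N ->
  \rank (tsum (jblock F i) (jblock F j)) = (i * j - minn i j)%N.
Proof.
move=> iq jq; have := rank_tsum_reflect iq jq q_gt0.
rewrite expr1 subn1 rank_tsum_top ?leq_subr //.
by move: (\rank _) => r; case: (leqP i j) => h; [have : (i * j >= i * 1)%N by rewrite leq_mul2l; lia | ]; nia.
Qed.

End Square.
End Char2.

(** * Rank drops and their alternating sums *)

(** Each binary digit [c_b] of [l] satisfies [2 c_b = 1 - (-1)^c_b], and
    [l %/ 2 ^ b] has the parity of [c_b]. *)
Lemma sign_expansion n l : (l < 2 ^ n)%N ->
  2 * ((2 ^ n)%N%:Z - l%:Z) - 1 =
  (2 ^ n)%N%:Z + \sum_(b < n) (2 ^ b)%N%:Z * (-1) ^+ (l %/ 2 ^ b) :> int.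
Proof.
elim: n l => [|n IH] l lt.
  by rewrite big_ord0; case: l lt.
rewrite big_ord_recl /= divn1 mul1r.
under eq_bigr => b _ do rewrite /bump /= add1n expnS divnMA divn2 PoszM -mulrA.
rewrite -mulr_sumr.
have lt2 : (l./2 < 2 ^ n)%N by rewrite -divn2 ltn_divLR // mulnC -expnS.
have := IH _ lt2; move: (\sum_(_ < _) _) => s.
rewrite -signr_odd -{2}(odd_double_half l) expnS.
by move: (l./2) (2 ^ n)%N => c Q; case: (odd l) => /=; rewrite ?expr0 ?expr1; lia.
Qed.

Section RankDrops.
Context (F : fieldType).

(** The number of Jordan blocks of size larger than [l], if [A] is nilpotent. *)
Definition rkdrop m (A : 'M[F]_m) l : int :=
  (\rank (A ^+ l))%:Z - (\rank (A ^+ l.+1))%:Z.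

(** The number of Jordan blocks of odd size of [A], if [A^Q = 0]. *)
Definition altsum (Q : nat) m (A : 'M[F]_m) : int :=
  \sum_(l < Q) (-1) ^+ l * rkdrop A l.

Lemma rkdrop_sim m n (A : 'M[F]_m) (B : 'M[F]_n) l : mxsim A B -> rkdrop A l = rkdrop B l.
Proof. by move=> s; rewrite /rkdrop !(mxsim_rankX _ s). Qed.

Lemma rkdrop_dsum m n (A : 'M[F]_m) (B : 'M[F]_n) l :
  rkdrop (mxdsum A B) l = rkdrop A l + rkdrop B l.
Proof. by rewrite /rkdrop !rank_mxdsumX !PoszD; ring. Qed.

Lemma rkdrop_jblock i l : rkdrop (jblock F i) l = (l < i)%:R.
Proof. by rewrite /rkdrop !rank_jblockX; case: ltnP => h /=; lia. Qed.

Lemma altsum_sim Q m n (A : 'M[F]_m) (B : 'M[F]_n) : mxsim A B -> altsum Q A = altsum Q B.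
Proof. by move=> s; apply: eq_bigr => l _; rewrite (rkdrop_sim _ s). Qed.

Lemma altsum_dsum Q m n (A : 'M[F]_m) (B : 'M[F]_n) :
  altsum Q (mxdsum A B) = altsum Q A + altsum Q B.
Proof. by rewrite -big_split; apply: eq_bigr => l _; rewrite rkdrop_dsum mulrDr. Qed.

Lemma sum_itv_ind Q a b : (b <= Q)%N ->
  \sum_(l < Q) ((a <= l) && (l < b))%N%:R = (b - a)%N%:Z.
Proof.
move=> bQ; rewrite -(big_mkord xpredT (fun l => ((a <= l) && (l < b))%N%:R)).
suff -> : \sum_(0 <= l < Q) ((a <= l) && (l < b))%N%:R = (minn b Q - a)%N%:Z.
  by rewrite (minn_idPl bQ).
elim: Q {bQ} => [|Q IH]; first by rewrite big_geq // minn0.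
by rewrite big_nat_recr //= IH; case: (boolP (_ && _)) => h /=; lia.
Qed.

Lemma altsum_jblock Q i : (i <= Q)%N -> altsum Q (jblock F i) = (odd i)%:R.
Proof.
move=> iQ; rewrite /altsum.
under eq_bigr do rewrite rkdrop_jblock.
rewrite -(big_mkord xpredT (fun l => (-1) ^+ l * (l < i)%:R)).
have z : \sum_(i <= l < Q) (-1) ^+ l * (l < i)%N%:R = 0 :> int.
  by rewrite big_nat big1 // => l /andP[h _]; rewrite ltnNge h mulr0.
rewrite (big_cat_nat (n := i)) //= z.
rewrite addr0; elim: i {iQ z} => [|i IH]; first by rewrite big_geq.
rewrite big_nat_recr //= ltnSn mulr1 big_nat.
under eq_bigr => l /andP[_ h] do rewrite (ltn_trans h (ltnSn i)) -(h : (l < i)%N = true).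
by rewrite -big_nat IH -signr_odd; case: (odd i).
Qed.

(** Identities between functions of two nilpotent matrices that are additive in
    each of them need only be checked on pairs of Jordan blocks. *)
Lemma nilp_biadditive_eq0 Q (Phi : forall m n, 'M[F]_m -> 'M[F]_n -> int) :
  (forall m m' n n' (A : 'M_m) (A' : 'M_m') (B : 'M_n) (B' : 'M_n'),
     mxsim A A' -> mxsim B B' -> Phi m n A B = Phi m' n' A' B') ->
  (forall m m' n (A : 'M_m) (A' : 'M_m') (B : 'M_n),
     Phi _ _ (mxdsum A A') B = Phi _ _ A B + Phi _ _ A' B) ->
  (forall m n n' (A : 'M_m) (B : 'M_n) (B' : 'M_n'),
     Phi _ _ A (mxdsum B B') = Phi _ _ A B + Phi _ _ A B') ->
  (forall i j, (i <= Q)%N -> (j <= Q)%N -> Phi _ _ (jblock F i) (jblock F j) = 0) ->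
  forall m n (A : 'M_m) (B : 'M_n), A ^+ Q = 0 -> B ^+ Q = 0 -> Phi _ _ A B = 0.
Proof.
move=> sim addl addr PJ m n A B AQ; move: n B.
apply: (nilp_ind (P := fun n (B : 'M_n) => Phi _ _ A B = 0)).
- by move=> n n' B B' _ _ s; rewrite (sim _ _ _ _ _ _ _ _ (mxsim_refl A) s).
- by move=> l n B _ _ e1 e2; rewrite addr e1 e2.
move=> j jQ; move: m A AQ.
apply: (nilp_ind (P := fun m (A : 'M_m) => Phi _ _ A (jblock F j) = 0)).
- by move=> n n' B B' _ _ s; rewrite (sim _ _ _ _ _ _ _ _ s (mxsim_refl _)).
- by move=> l n B _ _ e1 e2; rewrite addl e1 e2.
by move=> i iQ; apply: PJ.
Qed.

Lemma rank_tsumCX m n (A : 'M[F]_m) (B : 'M[F]_n) l :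
  \rank (tsum A B ^+ l) = \rank (tsum B A ^+ l).
Proof. exact/mxsim_rankX/mxsim_tsumC. Qed.

Lemma rank_tsum_dsumrX m n p (A : 'M[F]_m) (B : 'M[F]_n) (C : 'M[F]_p) l :
  \rank (tsum C (mxdsum A B) ^+ l) =
  (\rank (tsum C A ^+ l) + \rank (tsum C B ^+ l))%N.
Proof. by rewrite rank_tsumCX rank_tsum_dsumX !(rank_tsumCX C). Qed.

(** The sign is constant on each run of [2 ^ b] consecutive exponents, along
    which the rank drops of [A] telescope to one rank drop of [A^(2^b)]. *)
Lemma altsum_frob n b m (A : 'M[F]_m) : (b <= n)%N ->
  \sum_(l < 2 ^ n) (-1) ^+ (l %/ 2 ^ b) * rkdrop A l =
  altsum (2 ^ (n - b)) (A ^+ (2 ^ b)).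
Proof.
move=> bn; have -> : (2 ^ n = 2 ^ (n - b) * 2 ^ b)%N by rewrite -expnD subnK.
rewrite /altsum; move: (2 ^ (n - b))%N => Q'; set r := (2 ^ b)%N.
have r0 : (0 < r)%N by rewrite expn_gt0.
rewrite -(big_mkord xpredT (fun l => (-1) ^+ l * rkdrop (A ^+ r) l)).
rewrite -(big_mkord xpredT (fun l => (-1) ^+ (l %/ r) * rkdrop A l)).
elim: Q' => [|Q' IH]; first by rewrite mul0n !big_geq.
rewrite big_nat_recr //= -IH mulSn addnC (big_cat_nat (n := Q' * r)) ?leq_addr //=.
congr (_ + _); rewrite big_nat.
under eq_bigr => l /andP[h1 h2].
  have -> : (l %/ r = Q')%N.
    apply/eqP; rewrite eqn_leq -ltnS ltn_divLR // leq_divRL // h1 andbT.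
    by rewrite mulSn addnC.
  over.
rewrite -big_nat -mulr_sumr; congr (_ * _).
rewrite /rkdrop -!exprM mulnS.
rewrite (@telescope_sumr_eq _ _ _ (fun l => - (\rank (A ^+ l))%:Z)) ?leq_addr //.
  by rewrite opprK addrC (mulnC r) addnC [(r + _)%N]addnC.
by move=> l _; rewrite opprK addrC.
Qed.

Context (c2 : 2%N \in [pchar F]).

(** Reflection of a block size [b] to [Q - b] reverses the order of the
    exponents and so preserves the alternating sum and, [Q] being even, the
    parity of [b]. Both sizes can thus be brought below [Q / 2], where the
    claim is the one for the exponent [e - 1]. *)
Lemma altsum_tsum_jblock e i j : (i <= 2 ^ e)%N -> (j <= 2 ^ e)%N ->
  altsum (2 ^ e) (tsum (jblock F i) (jblock F j)) = (odd i && odd j)%:R.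
Proof.
elim: e i j => [|e IH] i j iQ jQ.
  rewrite /altsum expn0 big_ord_recl big_ord0 addr0 expr0 mul1r /rkdrop.
  have -> : tsum (jblock F i) (jblock F j) ^+ 1 = 0.
    by apply: (tsum_nilp c2 (e := 0)); rewrite expr1 -(expr1 (jblock _ _)) jblock_nilp.
  rewrite expr0 mxrank1 mxrank0 subr0.
  by case: i iQ => [|[]] //; case: j jQ => [|[]].
set Q := (2 ^ e.+1)%N; have Q2 : Q = (2 * 2 ^ e)%N by rewrite /Q expnS.
have oQ : odd Q = false by rewrite Q2 oddM.
have refl a b : (a <= Q)%N -> (b <= Q)%N ->
    altsum Q (tsum (jblock F a) (jblock F b)) =
    altsum Q (tsum (jblock F a) (jblock F (Q - b))).
  move=> aQ bQ; rewrite /altsum.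
  pose h l := rkdrop (tsum (jblock F a) (jblock F (Q - b))) l.
  transitivity (\sum_(l < Q) (-1) ^+ l * (a%:Z - h (Q - l.+1)%N)).
    apply: eq_bigr => l _; congr (_ * _); rewrite /h /rkdrop.
    have lQ := ltn_ord l.
    have e1 := rank_tsum_reflect c2 aQ bQ (ltnW lQ).
    have e2 := rank_tsum_reflect c2 aQ bQ lQ.
    rewrite -subSn // subSS; rewrite -/Q in e1 e2; nia.
  under eq_bigr do rewrite mulrBr.
  rewrite sumrB -mulr_suml.
  have -> : \sum_(l < Q) (-1) ^+ l = 0 :> int.
    rewrite Q2; move: (2 ^ e)%N => r; rewrite -(big_mkord xpredT (fun l => (-1) ^+ l)).
    elim: r => [|r IHr]; first by rewrite big_geq.
    by rewrite mulnS add2n !big_nat_recr //= IHr add0r exprS mulN1r addrN.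
  rewrite mul0r sub0r (reindex_inj rev_ord_inj) -sumrN /=.
  apply: eq_bigr => l _; rewrite -mulNr /h; congr (_ * _); last by rewrite -subSn ?subSS ?subKn // ltnW.
  rewrite -signr_odd oddB // oQ /= -(signr_odd _ l).
  by case: (odd l).
have symm a b : altsum Q (tsum (jblock F a) (jblock F b)) =
                altsum Q (tsum (jblock F b) (jblock F a)).
  exact/altsum_sim/mxsim_tsumC.
have red b : (b <= Q)%N -> exists b', [/\ (b' <= 2 ^ e)%N, odd b' = odd b &
   forall a, (a <= Q)%N -> altsum Q (tsum (jblock F a) (jblock F b)) =
                altsum Q (tsum (jblock F a) (jblock F b'))].
  move=> bQ; have [le|gt] := leqP b (2 ^ e); first by exists b.
  exists (Q - b)%N; split; [lia | by rewrite oddB // oQ | by move=> a aQ; apply: refl].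
have [i' [i'Q <- ei]] := red _ iQ; have [j' [j'Q <- ej]] := red _ jQ.
have leQ k : (k <= 2 ^ e)%N -> (k <= Q)%N by rewrite Q2; lia.
rewrite ej // symm ei 1?leQ // symm -IH //.
rewrite /altsum -!(big_mkord xpredT (fun l => (-1) ^+ l * rkdrop _ l)).
rewrite (big_cat_nat (n := 2 ^ e)) //= ?leQ // [X in _ + X](_ : _ = 0) ?addr0 //.
rewrite big_nat big1 // => l /andP[le _]; rewrite /rkdrop.
have z k : (2 ^ e <= k)%N -> tsum (jblock F i') (jblock F j') ^+ k = 0.
  by move=> le'; rewrite -(subnK le') exprD tsum_nilp ?mulr0 // jblock_nilp.
by rewrite !z ?mxrank0 ?subrr ?mulr0 // leqW.
Qed.

Section Nilpotent.
Context (e m n : nat) (A : 'M[F]_m) (B : 'M[F]_n).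
Hypotheses (A0 : A ^+ (2 ^ e) = 0) (B0 : B ^+ (2 ^ e) = 0).

(** By additivity it suffices to treat two blocks, whose tensor sum has a single
    block of odd size if both sizes are odd, and none otherwise. *)
Lemma altsum_tsum :
  altsum (2 ^ e) (tsum A B) = altsum (2 ^ e) A * altsum (2 ^ e) B.
Proof.
apply/eqP; rewrite -subr_eq0; apply/eqP.
apply: (nilp_biadditive_eq0 (Phi := fun m n (A : 'M_m) (B : 'M_n) =>
  altsum (2 ^ e) (tsum A B) - altsum (2 ^ e) A * altsum (2 ^ e) B) _ _ _ _ A0 B0).
- by move=> m1 m2 n1 n2 X X' Y Y' sX sY; rewrite (altsum_sim _ sX) (altsum_sim _ sY) (altsum_sim _ (mxsim_tsum sX sY)).
- move=> m1 m2 n1 X X' Y; rewrite (altsum_sim _ (mxsim_tsum_dsum X X' Y)) !altsum_dsum.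
  by ring.
- move=> m1 n1 n2 X Y Y'; rewrite (altsum_sim _ (mxsim_tsumC _ _)).
  rewrite (altsum_sim _ (mxsim_tsum_dsum _ _ _)) !altsum_dsum.
  by rewrite !(altsum_sim _ (mxsim_tsumC _ X)); ring.
by move=> i j iQ jQ; rewrite altsum_tsum_jblock // !altsum_jblock // -natrM mulnb subrr.
Qed.

(** For two blocks of sizes [i] and [j] the cokernel of [x + y] on
    [F[x, y]/(x^i, y^j)] is [F[x]/(x^(minn i j))]. *)
Lemma corank_tsum :
  (m * n)%N%:Z - (\rank (tsum A B))%:Z = \sum_(l < 2 ^ e) rkdrop A l * rkdrop B l.
Proof.
apply/eqP; rewrite -subr_eq0 -(expr1 (tsum A B)); apply/eqP.
apply: (nilp_biadditive_eq0 (Phi := fun m n (A : 'M_m) (B : 'M_n) =>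
  (m * n)%N%:Z - (\rank (tsum A B ^+ 1))%:Z - \sum_(l < 2 ^ e) rkdrop A l * rkdrop B l) _ _ _ _ A0 B0).
- move=> m1 m2 n1 n2 X X' Y Y' sX sY; rewrite (mxsim_rankX 1 (mxsim_tsum sX sY)).
  have /eqP := mxsim_rankX 0 (mxsim_tsum sX sY); rewrite !expr0 !mxrank1 => /eqP ->.
  by congr (_ - _); apply: eq_bigr => l _; rewrite (rkdrop_sim _ sX) (rkdrop_sim _ sY).
- move=> m1 m2 n1 X X' Y; rewrite rank_tsum_dsumX.
  under eq_bigr do rewrite rkdrop_dsum mulrDl.
  by rewrite big_split /= mulnDl !PoszD; ring.
- move=> m1 n1 n2 X Y Y'; rewrite rank_tsum_dsumrX.
  under eq_bigr do rewrite rkdrop_dsum mulrDr.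
  by rewrite big_split /= mulnDr !PoszD; ring.
move=> i j iQ jQ; rewrite expr1 (rank_tsum1 c2 iQ jQ).
have le : (minn i j <= 2 ^ e)%N by rewrite geq_min iQ.
under eq_bigr => l do rewrite !rkdrop_jblock -natrM mulnb -leq_min -[(_ <= _)%N]andTb -(leq0n l).
by rewrite sum_itv_ind // subn0; have := leq_mul2l i 1 j; nia.
Qed.

(** For two blocks, [(x + y)^(q - 1)] maps onto a space of dimension
    [i + j - q], the number of [l] with [q - 1 - l < i] and [l < j]. *)
Lemma rank_tsum_pred :
  (\rank (tsum A B ^+ (2 ^ e).-1))%:Z =
  \sum_(l < 2 ^ e) rkdrop A ((2 ^ e).-1 - l)%N * rkdrop B l.
Proof.
apply/eqP; rewrite -subr_eq0; apply/eqP.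
apply: (nilp_biadditive_eq0 (Phi := fun m n (A : 'M_m) (B : 'M_n) =>
  (\rank (tsum A B ^+ (2 ^ e).-1))%:Z -
  \sum_(l < 2 ^ e) rkdrop A ((2 ^ e).-1 - l)%N * rkdrop B l) _ _ _ _ A0 B0).
- move=> m1 m2 n1 n2 X X' Y Y' sX sY; rewrite (mxsim_rankX _ (mxsim_tsum sX sY)).
  by congr (_ - _); apply: eq_bigr => l _; rewrite (rkdrop_sim _ sX) (rkdrop_sim _ sY).
- move=> m1 m2 n1 X X' Y; rewrite rank_tsum_dsumX.
  under eq_bigr do rewrite rkdrop_dsum mulrDl.
  by rewrite big_split /= !PoszD; ring.
- move=> m1 n1 n2 X Y Y'; rewrite rank_tsum_dsumrX.
  under eq_bigr do rewrite rkdrop_dsum mulrDr.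
  by rewrite big_split /= !PoszD; ring.
move=> i j iQ jQ; rewrite (rank_tsum_top c2 iQ jQ).
rewrite (eq_bigr (fun l : 'I_(2 ^ e) => ((2 ^ e - i <= l) && (l < j))%N%:R)).
  by rewrite sum_itv_ind //; lia.
move=> l _; rewrite !rkdrop_jblock -natrM mulnb; congr ((_ && _)%:R).
by have := ltn_ord l; lia.
Qed.

End Nilpotent.

End RankDrops.

(** * Formal power series *)

Section SeriesBasics.
Context (n : nat) (A : comNzRingType).
Local Notation S := (mpseries n A).
Implicit Types (f g h : S) (a c m : 'X_{1..n}).

Lemma mpsDE f g m : (f + g) m = f m + g m. Proof. by []. Qed.
Lemma mpsNE f m : (- f) m = - f m. Proof. by []. Qed.
Lemma mpsZE (x : A) f m : (x *: f) m = x * f m. Proof. by []. Qed.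
Lemma mps0E m : (0 : S) m = 0. Proof. by []. Qed.
Lemma mps1E m : (1 : S) m = (m == 0%MM)%:R.
Proof. by []. Qed.
Lemma mps_sumE (I : Type) (r : seq I) (P : pred I) (F : I -> S) m :
  (\sum_(i <- r | P i) F i) m = \sum_(i <- r | P i) F i m.
Proof. by apply: (big_morph (fun f : S => f m)). Qed.

Lemma mpsME f g m :
  (f * g) m = \sum_(a : 'X_{1..n < (mdeg m).+1} | (a <= m)%MM) f a * g (m - a)%MM.
Proof. by []. Qed.

Lemma mpsM_trunc b f g m : (mdeg m < b)%N ->
  (f * g) m = (mps_trunc b f * mps_trunc b g)@_m.
Proof. exact: mps_mulE. Qed.

(** The summation range of a product coefficient may be any finite list of
    divisors of the monomial that covers the support of the first factor. *)
Lemma mpsM_seq (L : seq 'X_{1..n}) f g m :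
    uniq L -> (forall a, a \in L -> (a <= m)%MM) ->
    (forall a, (a <= m)%MM -> f a != 0 -> a \in L) ->
  (f * g) m = \sum_(a <- L) f a * g (m - a)%MM.
Proof.
move=> uL Lm mL; rewrite mpsME.
rewrite -(big_map (@bmnm _ _) (fun a => a <= m)%MM (fun a => f a * g (m - a)%MM)).
rewrite (bigID (fun a => a \in L)) /= [X in _ + X]big1 ?addr0 => [|a /andP[am aL]]; last first.
  have [->|nz] := eqVneq (f a) 0; first by rewrite mul0r.
  by move: aL; rewrite mL.
rewrite -big_filter; apply: perm_big; apply: uniq_perm => //.
  by rewrite filter_uniq // map_inj_uniq ?index_enum_uniq //; apply: val_inj.
move=> a; rewrite mem_filter; have [aL|] := boolP (a \in L); last by rewrite andbF.
have am := Lm a aL; rewrite am /=; apply/mapP.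
have lt : (mdeg a < (mdeg m).+1)%N.
  by rewrite ltnS !mdegE; apply: leq_sum => i _; move/mnm_lepP: am; apply.
by exists (BMultinom lt); rewrite ?mem_index_enum.
Qed.

Definition mps_of_poly (p : {mpoly A[n]}) : S := fun m => p@_m.

Lemma trunc_of_poly b p m : (mdeg m < b)%N -> (mps_trunc b (mps_of_poly p))@_m = p@_m.
Proof. by move=> lt; rewrite mcoeff_trunc. Qed.

Lemma mps_of_poly_zmod : zmod_morphism mps_of_poly.
Proof. by move=> p q; apply/mps_eqP => m; rewrite /mps_of_poly mcoeffB. Qed.

Lemma mps_of_poly_monoid : monoid_morphism mps_of_poly.
Proof.
split=> [|p q]; first by apply/mps_eqP => m; rewrite /mps_of_poly mcoeff1 mps1E.
apply/mps_eqP => m; rewrite (mpsM_trunc _ _ (ltnSn _)) /mps_of_poly.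
by apply: (mcoeffM_eq (ltnSn _)) => a la; rewrite mcoeff_trunc.
Qed.

HB.instance Definition _ := GRing.isZmodMorphism.Build _ _ mps_of_poly mps_of_poly_zmod.
HB.instance Definition _ := GRing.isMonoidMorphism.Build _ _ mps_of_poly mps_of_poly_monoid.

Lemma mpsM_low b f g f' g' :
  (forall m, (mdeg m < b)%N -> f m = f' m) ->
  (forall m, (mdeg m < b)%N -> g m = g' m) ->
  forall m, (mdeg m < b)%N -> (f * g) m = (f' * g') m.
Proof.
move=> ff gg m lt; rewrite !(mpsM_trunc _ _ lt).
by apply: (mcoeffM_eq lt) => a la; rewrite !mcoeff_trunc // ?ff ?gg.
Qed.

Definition mpsX a : S := fun m => (m == a)%:R.

Lemma mpsXE a m : mpsX a m = (m == a)%:R. Proof. by []. Qed.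

Lemma mps_of_polyX a : mps_of_poly 'X_[a] = mpsX a.
Proof. by apply/mps_eqP => m; rewrite /mps_of_poly mcoeffX mpsXE eq_sym. Qed.

Lemma mps_varE i : mps_var A i = mpsX U_(i). Proof. by []. Qed.

Lemma mpsX0 : mpsX 0%MM = 1. Proof. by []. Qed.

Lemma mpsXD a (b : 'X_{1..n}) : mpsX (a + b)%MM = mpsX a * mpsX b.
Proof. by rewrite -!mps_of_polyX mpolyXD rmorphM. Qed.

Lemma mpsXn a l : mpsX a ^+ l = mpsX (a *+ l)%MM.
Proof. by rewrite -!mps_of_polyX -rmorphXn /= mpolyXn. Qed.

Lemma mpsXM a f m : (mpsX a * f) m = if (a <= m)%MM then f (m - a)%MM else 0.
Proof.
rewrite mpsME; case: ifPn => [le|nle].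
  have lt : (mdeg a < (mdeg m).+1)%N.
    by rewrite ltnS !mdegE; apply: leq_sum => i _; move/mnm_lepP: le; apply.
  rewrite (bigD1 (BMultinom lt)) //= mpsXE eqxx mul1r big1 ?addr0 //.
  move=> b /andP[_ ne]; rewrite mpsXE; case: eqP => [e|_]; last by rewrite mul0r.
  by case/eqP: ne; apply/val_inj.
apply: big1 => b le; rewrite mpsXE; case: eqP => [e|_]; last by rewrite mul0r.
by rewrite -e le in nle.
Qed.

Lemma mpsXMD a f m : (mpsX a * f) (a + m)%MM = f m.
Proof. by rewrite mpsXM lem_addr addmC addmK. Qed.

(** Each monomial is assigned to one of the summands [x_i^q g_i], the first [i]
    for which [x_i^q] divides it. *)
Lemma mps_split_pow q f :
    (forall m, (forall i, (m i < q)%N) -> f m = 0) ->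
  exists g : 'I_n -> S, f = \sum_i mps_var A i ^+ q * g i.
Proof.
move=> f0; pose fst (m : 'X_{1..n}) (i : 'I_n) := (q <= m i)%N && [forall j : 'I_n, (j < i)%N ==> (m j < q)%N].
exists (fun i m => if fst (m + U_(i) *+ q)%MM i then f (m + U_(i) *+ q)%MM else 0).
apply/mps_eqP => m; rewrite mps_sumE.
have E i : (mps_var A i ^+ q * (fun m => if fst (m + U_(i) *+ q)%MM i then f (m + U_(i) *+ q)%MM else 0)) m = if fst m i then f m else 0.
  rewrite mps_varE mpsXn mpsXM; have -> : (U_(i) *+ q <= m)%MM = (q <= m i)%N.
    apply/mnm_lepP/idP => [/(_ i)|le j]; rewrite mulmnE mnm1E ?eqxx ?mul1n //.
    by case: eqP => [<-|_]; rewrite ?mul1n ?mul0n.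
  case: ifPn => [le|nle]; last by rewrite /fst (negPf nle).
  rewrite submK //; apply/mnm_lepP => j; rewrite mulmnE mnm1E.
  by case: eqP => [<-|_]; rewrite ?mul1n ?mul0n.
under eq_bigr do rewrite E.
have [/existsP[i0 le0]|/existsPn none] := boolP [exists i, (q <= m i)%N]; last first.
  rewrite f0 => [|i]; last by rewrite ltnNge none.
  by rewrite big1 // => i _; rewrite if_same.
case: (@arg_minnP _ i0 (fun i => (q <= m i)%N) val le0) => i lei imin.
rewrite (bigD1 i) //= [fst m i](_ : _ = true) ?big1 ?addr0 // => [j ne|].
  rewrite /fst; case: ifP => // /andP[lej /forallP/(_ i)].
  have -> /= : (i < j)%N by rewrite ltn_neqAle imin // andbT eq_sym.
  by rewrite ltnNge lei.
rewrite /fst lei; apply/forallP => j; apply/implyP => lt.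
by rewrite ltnNge; apply: contraL lt => /imin; rewrite -leqNgt.
Qed.

(** The preimage of [f] under [id - L] is the sum of the [L^i f]; since [L]
    raises the order of vanishing for the degree [o], that sum is finite in each
    coefficient. *)
Lemma mps_contraction (o : 'X_{1..n} -> nat) (L : S -> S) :
    {morph L : f g / f + g} ->
    (forall d f, (forall m, (o m < d)%N -> f m = 0) ->
                 forall m, (o m < d.+1)%N -> L f m = 0) ->
  forall f, exists g, g - L g = f.
Proof.
move=> LD Lo f.
have L0 : L 0 = 0 by apply: (addrI (L 0)); rewrite -LD !addr0.
have LN g : L (- g) = - L g by apply: (addrI (L g)); rewrite -LD !subrr.
have itero i m : (o m < i)%N -> iter i L f m = 0.
  by elim: i m => [|i IH] m //=; apply: Lo.
pose s N : S := \sum_(i < N) iter i L f.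
pose g : S := fun m => s (o m).+1 m.
have gs N m : (o m < N)%N -> g m = s N m.
  move=> lt; rewrite /g /s !mps_sumE -!(big_mkord xpredT (fun i => iter i L f m)).
  rewrite [RHS](big_cat_nat (n := (o m).+1)) //= [X in _ = _ + X](_ : _ = 0) ?addr0 //.
  by rewrite big_nat big1 // => i /andP[h _]; apply: itero.
have Ls N : s N - L (s N) = f - iter N L f.
  elim: N => [|N IH]; first by rewrite /s big_ord0 L0 !subrr.
  have -> : s N.+1 = s N + iter N L f by rewrite /s big_ord_recr.
  by rewrite LD -iterS opprD addrACA IH addrA addrNK.
exists g; apply/mps_eqP => m; set N := (o m).+1.
have dlt m' : (o m' < N)%N -> (g - s N) m' = 0.
  by move=> lt; rewrite mpsDE mpsNE (gs N) ?subrr.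
have e : L g m = L (s N) m.
  apply/eqP; rewrite -subr_eq0; apply/eqP.
  have -> : L g m - L (s N) m = L (g - s N) m by rewrite LD LN.
  by apply: (Lo _ _ dlt); rewrite leqW.
have := congr1 (fun h : S => h m) (Ls N).
rewrite !mpsDE !mpsNE (itero N) ?ltnS // subr0 => <-.
by rewrite e (gs N) ?ltnS.
Qed.

End SeriesBasics.

Section SeriesDomain.
Context (n : nat) (A : idomainType).
Local Notation S := (mpseries n A).

Lemma mps_least (f : S) : f != 0 ->
  exists2 a : 'X_{1..n}, f a != 0 & forall b : 'X_{1..n}, (b < a)%O -> f b = 0.
Proof.
move=> nz; apply: contrapT => no.
case/eqP: nz; apply/mps_eqP => m; elim/(ltmwf (n := n)): m => m IH.
by apply/eqP; apply: contrapT => /negP fm; case: no; exists m.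
Qed.

(** The product of the least monomials of [f] and [g] in a monomial order has a
    nonzero coefficient in [f * g]. *)
Lemma mps_mulf_eq0 (f g : S) : f * g = 0 -> f = 0 \/ g = 0.
Proof.
move=> fg; case: (eqVneq f 0) => [->|nf]; first by left.
case: (eqVneq g 0) => [->|ng]; first by right.
have [a fa la] := mps_least nf; have [b gb lb] := mps_least ng.
have /mps_eqP/(_ (a + b)%MM) := fg; rewrite mpsME.
have lt : (mdeg a < (mdeg (a + b)).+1)%N by rewrite mdegD ltnS leq_addr.
rewrite (bigD1 (BMultinom lt)) ?lem_addr //= big1 => [|c /andP[le ne]].
  rewrite addr0 addmC addmK => /eqP; rewrite mulf_eq0.
  by rewrite (negPf fa) (negPf gb).
have [ca|ac|e] := ltgtP (c : 'X_{1..n}) a; first by rewrite la ?mul0r.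
  rewrite lb ?mulr0 // -(ltmc_add2r c).
  by rewrite addmC submK // ltmc_add2l.
by case/eqP: ne; apply/val_inj.
Qed.

End SeriesDomain.

Section SeriesField.
Context (n : nat) (K : fieldType).
Local Notation S := (mpseries n K).

(** Up to a scalar [f = 1 - w] with [w] without constant term, and
    multiplication by [w] raises the degree. *)
Lemma mps_inv (f : S) : f 0%MM != 0 -> exists g, g * f = 1.
Proof.
move=> nz; pose w : S := 1 - (f 0%MM)^-1 *: f.
have w0 : w 0%MM = 0 by rewrite /w mpsDE mpsNE mpsZE mps1E eqxx mulVf ?subrr.
have [|d g gd m lt|g eg] := @mps_contraction n K (@mdeg n) (fun g => w * g) _ _ 1.
- by move=> g h; rewrite mulrDr.
- rewrite mpsME big1 // => a le; have [->|na] := eqVneq (a : 'X_{1..n}) 0%MM.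
    by rewrite w0 mul0r.
  have e : mdeg m = (mdeg (m - a) + mdeg a)%N by rewrite -mdegD submK.
  rewrite gd ?mulr0 //; move: na lt e; rewrite -mdeg_eq0.
  by move: (mdeg m) (mdeg (m - a)) (mdeg a) => p r s; lia.
exists ((f 0%MM)^-1 *: g); rewrite -eg -{2}[g]mul1r -mulrBl /w opprB addrC addrNK.
by rewrite -!scalerAl mulrC.
Qed.

End SeriesField.

(** * Renaming variables along an injection *)

Section PushForward.
Context (n N : nat) (sg : 'I_n -> 'I_N).
Hypothesis sg_inj : injective sg.
Implicit Types c : 'X_{1..n}.

Definition mnm_push c : 'X_{1..N} := (\sum_(j < n) U_(sg j) *+ c j)%MM.

Lemma mnm_pushE c j : mnm_push c (sg j) = c j.
Proof.
rewrite /mnm_push mnm_sumE (bigD1 j) //= big1 => [|l ne].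
  by rewrite mulmnE mnm1E eqxx mul1n addn0.
by rewrite mulmnE mnm1E (inj_eq sg_inj) (negPf ne).
Qed.

Lemma mnm_push_out c i : i \notin codom sg -> mnm_push c i = 0%N.
Proof.
move=> no; rewrite /mnm_push mnm_sumE big1 // => j _.
by rewrite mulmnE mnm1E; case: eqP => // h; rewrite -h codom_f in no.
Qed.

Lemma mnm_pushP (m : 'X_{1..N}) :
  (forall i, i \notin codom sg -> m i = 0%N) -> m = mnm_push [multinom m (sg j) | j < n].
Proof.
move=> m0; apply/mnmP => i; have [/codomP[j ->]|no] := boolP (i \in codom sg).
  by rewrite mnm_pushE mnmE.
by rewrite mnm_push_out // m0.
Qed.

Lemma mnm_push_le c c' : (mnm_push c <= mnm_push c')%MM = (c <= c')%MM.
Proof.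
apply/mnm_lepP/mnm_lepP => h i; first by rewrite -!mnm_pushE.
have [/codomP[j ->]|nb] := boolP (i \in codom sg); first by rewrite !mnm_pushE.
by rewrite !mnm_push_out.
Qed.

Lemma mnm_pushB c c' : (mnm_push c - mnm_push c' = mnm_push (c - c'))%MM.
Proof.
apply/mnmP => i; rewrite mnmBE.
have [/codomP[j ->]|nb] := boolP (i \in codom sg); first by rewrite !mnm_pushE mnmBE.
by rewrite !mnm_push_out.
Qed.

Lemma mnm_push_inj : injective mnm_push.
Proof. by move=> c c' h; apply/mnmP => j; rewrite -!mnm_pushE h. Qed.

Lemma mdeg_push c : mdeg (mnm_push c) = mdeg c.
Proof.
by rewrite mdeg_sum mdegE; apply: eq_bigr => j _; rewrite mdegMn mdeg1 mul1n.
Qed.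

Context (A : comNzRingType).
Local Notation S := (mpseries N A).

Lemma mmap1_push c : mmap1 (fun j => mps_var A (sg j) : S) c = mpsX A (mnm_push c).
Proof.
rewrite /mmap1 /mnm_push; elim/big_ind2: _ => [||j _] //.
  by move=> x a y b -> ->; rewrite mpsXD.
by rewrite mps_varE mpsXn.
Qed.

Definition poly_push (p : {mpoly A[n]}) : S :=
  mmap (GRing.in_alg S) (fun j => mps_var A (sg j)) p.

Lemma poly_pushE p : poly_push p = \sum_(c <- msupp p) p@_c *: mpsX A (mnm_push c).
Proof. by apply: eq_bigr => c _; rewrite mmap1_push mulr_algl. Qed.

Lemma mcoeff_poly_push p c : poly_push p (mnm_push c) = p@_c.
Proof.
transitivity ((\sum_(c' <- msupp p) p@_c' *: 'X_[c'])@_c); last by rewrite -mpolyE.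
rewrite poly_pushE mps_sumE raddf_sum /=; apply: eq_bigr => c' _.
by rewrite mpsZE mpsXE mcoeffZ mcoeffX (inj_eq mnm_push_inj) eq_sym.
Qed.

Lemma poly_push_supp p m i : poly_push p m != 0 -> i \notin codom sg -> m i = 0%N.
Proof.
rewrite poly_pushE mps_sumE => nz nb.
apply/eqP; apply: contraT => mi; case/eqP: nz; apply: big1 => c _.
rewrite mpsZE mpsXE; case: eqP => [em|_]; last exact: mulr0.
by move: mi; rewrite em mnm_push_out.
Qed.

End PushForward.

(** * Frobenius powers and lengths *)

Section FrobeniusIdeal.
Context (n : nat) (A : comNzRingType).
Local Notation S := (mpseries n A).

(** The ideal generated by the powers [x_i ^ q]; a coefficient condition is
    easier to handle than generators. *)
Definition box_ideal (q : nat) : set S :=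
  [set f : S | forall m : 'X_{1..n}, (forall i, (m i < q)%N) -> f m = 0].

Lemma box_ideal_ideal q : is_ideal (box_ideal q).
Proof.
split=> [m _|f g f0 g0 m lt|g f f0 m lt]; rewrite ?mps0E //.
  by rewrite mpsDE f0 ?g0 ?addr0.
rewrite mpsME big1 // => a _; rewrite f0 ?mulr0 // => i.
by rewrite mnmBE; apply: leq_ltn_trans (leq_subr _ _) (lt i).
Qed.

Lemma box_ideal1 (f : S) : box_ideal 1 f <-> f 0%MM = 0.
Proof.
split=> [h|f0 m lt]; first by apply: h => i; rewrite mnm0E.
suff -> : m = 0%MM by [].
by apply/mnmP => i; rewrite mnm0E; case: (m i) (lt i).
Qed.

Lemma box_ideal_gen q (J : set S) :
  is_ideal J -> (forall i, J (mps_var A i ^+ q)) -> box_ideal q `<=` J.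
Proof.
move=> [J0 JD JM] Jx f /mps_split_pow[g ->].
by elim/big_ind: _ => // i _; rewrite mulrC; apply: JM.
Qed.

Lemma mps_truncX b (f : S) l m : (mdeg m < b)%N -> (f ^+ l : S) m = (mps_trunc b f ^+ l)@_m.
Proof.
elim: l m => [|l IH] m lt; first by rewrite !expr0 mcoeff1 mps1E.
rewrite !exprS (mpsM_trunc _ _ lt); apply: (mcoeffM_eq lt) => // a la.
by rewrite mcoeff_trunc // IH.
Qed.

Context (c2 : 2%N \in [pchar A]) (e : nat).
Local Notation q := (2 ^ e)%N.

(** In characteristic two the [q]-th power only sees one truncation at a time,
    where it is the Frobenius map of polynomials. *)
Lemma mps_frobE (f : S) m :
  (f ^+ q : S) m = \sum_(a : 'X_{1..n < (mdeg m).+1}) f a ^+ q * ((a *+ q)%MM == m)%:R.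
Proof.
rewrite (mps_truncX _ _ (ltnSn _)) /mps_trunc.
have cP : 2%N \in [pchar {mpoly A[n]}] by apply: (rmorph_pchar (mpolyC n (R := A))).
have frobD (x y : {mpoly A[n]}) : (x + y) ^+ q = x ^+ q + y ^+ q.
  by apply: exprDn_pchar; rewrite pnatX (pnatE _ (pcharf_prime cP)) cP.
rewrite (big_morph (fun x => x ^+ q) frobD (expr0n _ _)) ?expn_eq0 //.
have [q0|q0] := eqVneq q 0%N; first by move/eqP: q0; rewrite expn_eq0.
rewrite raddf_sum; apply: eq_bigr => a _.
by rewrite exprZn mpolyXn /= mcoeffZ mcoeffX.
Qed.

Lemma mps_frob_mul (f : S) a : (f ^+ q : S) (a *+ q)%MM = f a ^+ q.
Proof.
have q0 : (0 < q)%N by rewrite expn_gt0.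
have lt : (mdeg a < (mdeg (a *+ q)).+1)%N by rewrite ltnS mdegMn leq_pmulr.
rewrite mps_frobE (bigD1 (BMultinom lt)) //= eqxx mulr1 big1 ?addr0 // => b ne.
case: eqP => [/mnmP h|_]; last by rewrite mulr0.
case/eqP: ne; apply/val_inj/mnmP => i /=; move: (h i).
by rewrite !mulmnE => /eqP; rewrite eqn_pmul2r // => /eqP.
Qed.

Lemma mps_frob_neq0 (f : S) m : (f ^+ q : S) m != 0 -> exists2 a, m = (a *+ q)%MM & f a != 0.
Proof.
rewrite mps_frobE => nz; apply: contrapT => no; case/eqP: nz.
apply: big1 => a _; case: eqP => [e1|_]; last by rewrite mulr0.
rewrite mulr1; have [->|nz] := eqVneq (f a) 0; first by rewrite expr0n expn_eq0.
by case: no; exists a.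
Qed.

Lemma box_ideal_frob (f : S) : f 0%MM = 0 -> box_ideal q (f ^+ q).
Proof.
move=> f0 m lt; apply/eqP; apply: contrapT => /negP /mps_frob_neq0[a em fa].
case/eqP: fa; rewrite -[RHS]f0; congr (f _).
apply/mnmP => i; rewrite mnm0E; move: (lt i); rewrite em mulmnE.
by case: (a i) => // l; rewrite mulSn ltnNge leq_addr.
Qed.

End FrobeniusIdeal.

Section Length.
Context (n D : nat) (k : fieldType).
Local Notation S := (mpseries n k).
Context (phi : {linear S -> 'rV[k]_D}).
Hypothesis phi_surj : forall v, exists s, phi s = v.
Hypothesis phi_nilp : exists c, forall m, (c <= mdeg m)%N -> phi (mpsX k m) = 0.

(** Submodules of [S] that contain the kernel of [phi], described by row
    spaces. *)
Definition row_pre (B : 'M[k]_D) : set S := [set s | (phi s <= B)%MS].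

Lemma ideal_scale (J : set S) c f : is_ideal J -> J f -> J (c *: f).
Proof. by move=> [_ _ JM] Jf; rewrite -mulr_algl; apply: JM. Qed.

Lemma row_pre_strict B B' : (B <= B')%MS -> (\rank B < \rank B')%N ->
  row_pre B `<` row_pre B'.
Proof.
move=> BB lt; split=> [s|e]; first by rewrite /row_pre /=; move/submx_trans; apply.
move: lt; rewrite ltnNge => /negP; apply; apply: mxrankS.
apply/row_subP => i; have [s es] := phi_surj (row i B').
have : row_pre B' s by rewrite /row_pre /= es row_sub.
by move/e; rewrite /row_pre /= es.
Qed.

(** Each strict inclusion contributes a vector outside the row space reached so
    far, so the rank grows by at least one per step. *)
Lemma row_pre_chain_le (B : 'M[k]_D) l (J : nat -> set S) :
    (forall i, (i <= l)%N -> is_ideal (J i) /\ row_pre B `<=` J i) ->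
    (forall i, (i < l)%N -> J i `<` J i.+1) ->
  (l <= D - \rank B)%N.
Proof.
move=> Ji Jlt.
suff [C _ leC] : exists2 C : 'M[k]_D, row_pre C `<=` J l & (\rank B + l <= \rank C)%N.
  by have := rank_leq_col C; lia.
elim: l Ji Jlt => [|l IH] Ji Jlt.
  by exists B; rewrite ?addn0 //; case: (Ji 0%N).
have [i le|i lt|C CJ leC] := IH.
- by apply: Ji; apply: leqW.
- by apply: Jlt; apply: ltnW.
have /properW sub := Jlt l (ltnSn l).
have [s Js nJs] : exists2 s, J l.+1 s & ~ J l s.
  apply: contrapT => no; have [_] := Jlt l (ltnSn l); apply=> s Js.
  by apply: contrapT => nJ; case: no; exists s.
have [Jid _] := Ji l.+1 (leqnn _).
exists (C + phi s)%MS.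
  move=> s'; rewrite /row_pre /= => /sub_addsmxP[[u v] /= e].
  have [c ec] : exists c, v *m phi s = c *: phi s.
    by exists (v 0 0); rewrite [v]mx11_scalar mul_scalar_mx mxE.
  have -> : s' = (s' - c *: s) + c *: s by rewrite addrNK.
  case: (Jid) => _ JD _; apply: JD; last exact: ideal_scale.
  apply: sub; apply: CJ; rewrite /row_pre /= linearB linearZ /= e ec addrK.
  exact: submxMl.
rewrite addnS; apply: leq_ltn_trans leC _.
rewrite (ltn_leqif (mxrank_leqif_sup (addsmxSl _ _))).
apply/negP => h; apply: nJs; apply: CJ.
exact: submx_trans (addsmxSr _ _) h.
Qed.

(** A monomial of maximal degree outside an ideal spans, modulo that ideal, a
    submodule killed by all variables, hence of dimension one. *)
Lemma row_pre_socle B : is_ideal (row_pre B) -> (\rank B < D)%N ->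
  exists B', [/\ is_ideal (row_pre B'), (B <= B')%MS & \rank B' = (\rank B).+1].
Proof.
move=> Bid ltB; have [c nilc] := phi_nilp.
pose P d := `[< exists m, mdeg m = d /\ ~ row_pre B (mpsX k m) >].
have exP : exists d, P d.
  exists 0%N; apply/asboolP; exists 0%MM; split; first exact: mdeg0.
  rewrite mpsX0 => B1; move: ltB; rewrite ltnNge => /negP; apply.
  rewrite -[D in (D <= _)%N](mxrank1 k) mxrankS //; apply/row_subP => i.
  have [s <-] := phi_surj (row i 1%:M).
  by case: Bid => _ _ /(_ s 1 B1); rewrite mulr1.
have bP d : P d -> (d <= c)%N.
  move=> /asboolP[m [<- nB]]; rewrite leqNgt; apply/negP => lt; apply: nB.
  by rewrite /row_pre /= nilc ?sub0mx // ltnW.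
case: (ex_maxnP exP bP) => d /asboolP[m [dm nB]] dmax.
set s := mpsX k m in nB.
have Bx i : row_pre B (mps_var k i * s).
  rewrite mps_varE /s -mpsXD; apply: contrapT => nB'.
  have : P d.+1 by apply/asboolP; exists (U_(i) + m)%MM; rewrite mdegD mdeg1 dm add1n.
  by move/dmax; rewrite ltnn.
exists (B + phi s)%MS; split; last 1 first.
- have h : (\rank B < \rank (B + phi s)%MS)%N.
    rewrite (ltn_leqif (mxrank_leqif_sup (addsmxSl _ _))).
    by apply/negP => /(submx_trans (addsmxSr _ _)).
  apply/eqP; rewrite eqn_leq h andbT; apply: leq_trans (mxrank_adds_leqif _ _) _.
  by have := rank_leq_row (phi s); move: (\rank _) (\rank _) => x y; lia.
- case: (Bid) => B0 BD BM; split.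
  + by rewrite /row_pre /= linear0 sub0mx.
  + by move=> f g; rewrite /row_pre /= linearD => hf hg; rewrite addmx_sub.
  + move=> a f; rewrite /row_pre /= => /sub_addsmxP[[u v] /= ef].
    have [x ex] : exists x, v *m phi s = x *: phi s.
      by exists (v 0 0); rewrite [v]mx11_scalar mul_scalar_mx mxE.
    pose f' := f - x *: s.
    have Bf' : row_pre B f'.
      by rewrite /row_pre /= linearB linearZ /= ef ex addrK submxMl.
    pose a' := a - a 0%MM *: 1.
    have Ba' : row_pre B (a' * s).
      have /mps_split_pow[g ->] : forall l : 'X_{1..n}, (forall i, (l i < 1)%N) -> a' l = 0.
        apply/(box_ideal1 a'); rewrite /a' mpsDE mpsNE mpsZE mps1E eqxx mulr1.
        exact: subrr.
      rewrite mulr_suml; elim/big_ind: _ => // i _.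
      by rewrite expr1 mulrAC mulrC; apply: BM.
    have -> : a * f = a * f' + x *: (a' * s) + (x * a 0%MM) *: s.
      rewrite /f' /a' -scalerA.
      have [[X eX] [Y eY]] : (exists X, forall y : S, x *: y = X * y) /\
          (exists Y, forall y : S, a 0%MM *: y = Y * y).
        by split; [exists x%:A | exists (a 0%MM)%:A] => y; rewrite mulr_algl.
      by rewrite !eY !eX; ring.
    rewrite linearD linearZ /= addmx_sub //; last by rewrite scalemx_sub // addsmxSr.
    apply: submx_trans _ (addsmxSl _ _); apply: (BD); first exact: BM.
    exact: ideal_scale.
- exact: addsmxSl.
Qed.

(** Iterating [row_pre_socle] exhausts [S]. *)
Lemma row_pre_chain (B : 'M[k]_D) : is_ideal (row_pre B) ->
  exists Bs : nat -> 'M[k]_D,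
    [/\ Bs 0%N = B,
       forall i, (i <= D - \rank B)%N -> is_ideal (row_pre (Bs i)) /\ (B <= Bs i)%MS &
       forall i, (i < D - \rank B)%N -> row_pre (Bs i) `<` row_pre (Bs i.+1)].
Proof.
move: {-2}(D - _)%N (erefl (D - \rank B)%N) => d.
elim: d B => [|d IH] B ed Bid.
  by exists (fun _ => B); split=> // i; rewrite leqn0 => _.
have [|B' [Bid' BB' rB']] := row_pre_socle Bid; first lia.
have [|Bs [h0 h1 h2]] := IH B' _ Bid'; first lia.
exists (fun i => if i is i'.+1 then Bs i' else B); split=> //.
  case=> [|i] // /h1[idi leB]; split=> //; exact: submx_trans leB.
case=> [|i] lt; last exact: h2.
by rewrite h0; apply: row_pre_strict => //; rewrite rB'.
Qed.

End Length.

Lemma ideal_preim (R R' : comNzRingType) (f : {rmorphism R -> R'}) (J : set R') :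
  is_ideal J -> is_ideal (f @^-1` J).
Proof.
move=> [J0 JD JM]; split=> [|x y|a x]; rewrite /preimage /= ?rmorph0 ?rmorphD ?rmorphM //.
  exact: JD.
exact: JM.
Qed.

Section QuotientLength.
Context (n D : nat) (k : fieldType) (R : comNzRingType).
Local Notation S := (mpseries n k).
Context (pi : {rmorphism S -> R}) (phi : {linear S -> 'rV[k]_D}).
Hypothesis pi_surj : forall x, exists s, pi s = x.
Hypothesis phi_surj : forall v, exists s, phi s = v.
Hypothesis phi_nilp : exists c, forall m, (c <= mdeg m)%N -> phi (mpsX k m) = 0.

(** The length of [R / I] is the dimension of [S] modulo the preimage of [I]:
    [row_pre_chain] gives a chain of that length, and no chain is longer by
    [row_pre_chain_le]. *)
Lemma is_length_row_pre (I : set R) (B : 'M[k]_D) : is_ideal (row_pre phi B) ->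
  (forall s, I (pi s) <-> row_pre phi B s) -> is_length I (D - \rank B).
Proof.
move=> Bid IB.
have kerB s : pi s = 0 -> row_pre phi B s.
  by move=> s0; apply/IB; rewrite s0 -(rmorph0 pi); apply/IB; case: Bid.
split.
  have [Bs [_ h1 h2]] := row_pre_chain phi_surj phi_nilp Bid.
  have preK i s : (i <= D - \rank B)%N ->
      (pi @` row_pre phi (Bs i)) (pi s) -> row_pre phi (Bs i) s.
    move=> /h1[Jid BJ] [s' Js' e]; rewrite -(subrK s' s); case: (Jid) => _ JD _.
    apply: JD => //; apply: submx_trans BJ; apply: kerB.
    by rewrite rmorphB e subrr.
  exists (fun i => pi @` row_pre phi (Bs i)); split.
    move=> i le; have [[J0 JD JM] BJ] := h1 i le; split.
      split=> [|x y|a x].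
      - by exists 0; rewrite ?rmorph0.
      - by move=> [s Js <-] [s' Js' <-]; exists (s + s'); rewrite ?rmorphD //; apply: JD.
      - move=> [s Js <-]; have [s' <-] := pi_surj a.
        by exists (s' * s); rewrite ?rmorphM //; apply: JM.
    move=> x Ix; have [s es] := pi_surj x; exists s => //.
    by apply: submx_trans BJ; apply/IB; rewrite es.
  move=> i lt; have [sub nsub] := h2 i lt; split.
    by move=> x [s Js <-]; exists s => //; apply: sub.
  move=> sub'; apply: nsub => s Js; apply: preK; first exact: ltnW.
  by apply: sub'; exists s.
move=> l J [Jid Jlt].
apply: (@row_pre_chain_le _ _ _ phi B l (fun i => pi @^-1` J i)) => i le.
  by have [h IJ] := Jid i le; split; [apply: ideal_preim | move=> s /IB /IJ].
have [sub nsub] := Jlt i le; split=> [s|sub']; first exact: sub.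
by apply: nsub => x; have [s <-] := pi_surj x; apply: sub'.
Qed.

End QuotientLength.

(** * Multiplication matrices of truncated power series rings *)

Section CoefficientMatrix.
Context (n : nat) (K : fieldType).
Local Notation S := (mpseries n K).

Definition coefrow D (b : 'I_D -> 'X_{1..n}) (s : S) : 'rV[K]_D := \row_d s (b d).

(** Multiplication by [P] on the span of the monomials [b], acting on row
    vectors of coefficients, with all other monomials set to zero. *)
Definition coefmx D (b : 'I_D -> 'X_{1..n}) (P : S) : 'M[K]_D :=
  \matrix_(i, j) if (b i <= b j)%MM then P (b j - b i)%MM else 0.

(** The monomials with all exponents below [q], a basis of
    [S / (x_1^q, ..., x_n^q)]; the enumeration [b] is left free, so that products
    of boxes can be indexed by products. *)
Definition box_basis (q D : nat) (b : 'I_D -> 'X_{1..n}) : Prop :=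
  injective b /\ forall m : 'X_{1..n}, (forall i, (m i < q)%N) <-> exists d, b d = m.

Lemma coefrow_linear D (b : 'I_D -> 'X_{1..n}) : linear (coefrow b).
Proof. by move=> c s s'; apply/rowP => d; rewrite !mxE. Qed.

HB.instance Definition _ D b :=
  GRing.isLinear.Build K S 'rV[K]_D _ (@coefrow D b) (@coefrow_linear D b).

Lemma coefmxD D (b : 'I_D -> 'X_{1..n}) P Q :
  coefmx b (P + Q) = coefmx b P + coefmx b Q.
Proof.
by apply/matrixP => i j; rewrite !mxE mpsDE; case: ifP; rewrite ?addr0.
Qed.

Section Box.
Context (q D : nat) (b : 'I_D -> 'X_{1..n}).
Hypothesis bb : box_basis q b.

Lemma coefrow_surj v : exists s, coefrow b s = v.
Proof.
exists (\sum_d v 0 d *: mpsX K (b d)); apply/rowP => d.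
rewrite mxE mps_sumE (bigD1 d) //= big1 => [|d' ne].
  by rewrite addr0 mpsZE mpsXE eqxx mulr1.
by rewrite mpsZE mpsXE (inj_eq (proj1 bb)) eq_sym (negPf ne) mulr0.
Qed.

Lemma coefrow_eq0 s : coefrow b s = 0 <-> box_ideal q s.
Proof.
split=> [/rowP e m /(proj2 bb)[d <-]|h].
  by have := e d; rewrite !mxE.
by apply/rowP => d; rewrite !mxE; apply: h; apply/(proj2 bb); exists d.
Qed.

Lemma coefrow_nilp : exists c, forall m, (c <= mdeg m)%N -> coefrow b (mpsX K m) = 0.
Proof.
exists (n * q).+1 => m lt; apply/coefrow_eq0 => a la; rewrite mpsXE.
case: eqP => // e; move: lt; rewrite -e ltnNge mdegE => /negP; case.
have -> : (n * q = \sum_(i < n) q)%N by rewrite sum_nat_const card_ord.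
by apply: leq_sum => i _; apply: ltnW.
Qed.

Lemma coefrowM P s : coefrow b (P * s) = coefrow b s *m coefmx b P.
Proof.
apply/rowP => j; rewrite mulrC mxE [RHS]mxE.
under [RHS]eq_bigr do rewrite !mxE.
rewrite [RHS](bigID (fun i => (b i <= b j)%MM)) /= [X in _ + X]big1 => [|i /negPf->]; last exact: mulr0.
rewrite addr0; under [RHS]eq_bigr => i -> do [].
rewrite -[RHS](big_map b (fun a => a <= b j)%MM (fun a => s a * P (b j - a)%MM)) -big_filter.
apply: mpsM_seq => [|a|a le _].
- by rewrite filter_uniq // map_inj_uniq ?index_enum_uniq //; apply: (proj1 bb).
- by rewrite mem_filter => /andP[].
rewrite mem_filter le /=; have /(proj2 bb)[d <-] : forall i, (a i < q)%N.
  move=> i; move/mnm_lepP/(_ i)/leq_ltn_trans: le; apply; move: i.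
  by apply/(proj2 bb); exists j.
by rewrite map_f ?mem_index_enum.
Qed.

Lemma row_coefmx P i : row i (coefmx b P) = coefrow b (P * mpsX K (b i)).
Proof. by apply/rowP => j; rewrite !mxE mulrC mpsXM. Qed.

Lemma coefmxM P Q : coefmx b (P * Q) = coefmx b P *m coefmx b Q.
Proof.
apply/row_matrixP => i; rewrite row_mul !row_coefmx -coefrowM.
by rewrite mulrA (mulrC Q).
Qed.

Lemma coefmx1 : coefmx b 1 = 1%:M.
Proof.
apply/row_matrixP => i; rewrite row_coefmx mul1r; apply/rowP => j.
by rewrite !mxE mpsXE (inj_eq (proj1 bb)) eq_sym.
Qed.

Lemma coefmxX P l : coefmx b (P ^+ l) = coefmx b P ^+ l.
Proof.
elim: l => [|l IH]; first by rewrite !expr0 coefmx1.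
by rewrite !exprS coefmxM IH mulmxE.
Qed.

Lemma coefmx_eq0 P : box_ideal q P -> coefmx b P = 0.
Proof.
move=> KP; apply/row_matrixP => i; rewrite row_coefmx row0.
apply/coefrow_eq0; have [_ _ KM] := box_ideal_ideal n K q.
by rewrite mulrC; apply: KM.
Qed.

Lemma coefmx_nilp e P : q = (2 ^ e)%N -> 2%N \in [pchar K] -> P 0%MM = 0 ->
  coefmx b P ^+ q = 0.
Proof.
move=> qe c2 P0; rewrite -coefmxX; apply: coefmx_eq0.
by rewrite qe; apply: box_ideal_frob.
Qed.

End Box.

(** Two enumerations of the same monomials differ by a permutation matrix. *)
Lemma coefmx_sim q D D' (b : 'I_D -> 'X_{1..n}) (b' : 'I_D' -> 'X_{1..n}) P :
  box_basis q b -> box_basis q b' -> mxsim (coefmx b P) (coefmx b' P).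
Proof.
move=> bb bb'.
pose T d d' (u : 'I_d -> 'X_{1..n}) (u' : 'I_d' -> 'X_{1..n}) : 'M[K]_(d, d') :=
  \matrix_(i, j) (u i == u' j)%:R.
have TE d d' (u : 'I_d -> 'X_{1..n}) (u' : 'I_d' -> 'X_{1..n}) p (X : 'M_(d', p)) i j k :
    injective u' -> u i = u' k -> (T _ _ u u' *m X) i j = X k j.
  move=> inj e; rewrite mxE (bigD1 k) //= big1 => [|l ne].
    by rewrite mxE e eqxx mul1r addr0.
  by rewrite mxE e (inj_eq inj) eq_sym (negPf ne) mul0r.
have ex d d' (u : 'I_d -> 'X_{1..n}) (u' : 'I_d' -> 'X_{1..n}) i :
    box_basis q u -> box_basis q u' -> exists k, u i = u' k.
  move=> bu bu'; have /(proj2 bu')[k <-] : forall l, (u i l < q)%N.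
    by apply/(proj2 bu); exists i.
  by exists k.
have TT d d' (u : 'I_d -> 'X_{1..n}) (u' : 'I_d' -> 'X_{1..n}) :
    box_basis q u -> box_basis q u' -> T _ _ u u' *m T _ _ u' u = 1%:M.
  move=> bu bu'; apply/matrixP => i j; have [k ek] := ex _ _ _ _ i bu bu'.
  rewrite (TE _ _ _ _ _ _ _ _ k (proj1 bu') ek) !mxE -ek.
  by rewrite (inj_eq (proj1 bu)).
apply: (@mxsim_intertwine _ _ _ _ _ (T _ _ b b') (T _ _ b' b)); rewrite ?TT //.
apply/matrixP => i j; have [k ek] := ex _ _ _ _ i bb' bb.
rewrite (TE _ _ _ _ _ _ _ _ k (proj1 bb) ek).
rewrite [RHS]mxE; have [l el] := ex _ _ _ _ j bb bb'.
rewrite (bigD1 l) //= big1 => [|l' ne].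
  by rewrite !mxE ek -el eqxx mulr1 addr0.
by rewrite !mxE el (inj_eq (proj1 bb')) (negPf ne) mulr0.
Qed.

Definition full_box q (d : 'I_#|{ffun 'I_n -> 'I_q}|) : 'X_{1..n} :=
  [multinom (enum_val d i : nat) | i < n].

Lemma full_box_basis q : box_basis q (@full_box q).
Proof.
split=> [d d' /mnmP e|m].
  apply: enum_val_inj; apply/ffunP => i; apply/val_inj.
  by have := e i; rewrite !mnmE.
split=> [lt|[d <-] i]; last by rewrite mnmE ltn_ord.
exists (enum_rank [ffun i => Ordinal (lt i)]); apply/mnmP => i.
by rewrite mnmE enum_rankK ffunE.
Qed.

Lemma card_box q D (b : 'I_D -> 'X_{1..n}) : box_basis q b -> D = (q ^ n)%N.
Proof.
move=> bb; have /(mxsim_rankX 0) := coefmx_sim 0 bb (full_box_basis q).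
by rewrite !expr0 !mxrank1 card_ffun !card_ord.
Qed.

Definition box_prod D1 D2 (b1 : 'I_D1 -> 'X_{1..n}) (b2 : 'I_D2 -> 'X_{1..n})
  (d : 'I_(D1 * D2)) : 'X_{1..n} :=
  (b1 (mxtens_unindex d).1 + b2 (mxtens_unindex d).2)%MM.

Definition msupp_in (I : pred 'I_n) (m : 'X_{1..n}) := forall i, ~~ I i -> m i = 0%N.

Definition supp_in (I : pred 'I_n) (P : S) := forall m, P m != 0 -> msupp_in I m.

(** A product box carries a tensor product of truncated rings; a series in the
    variables of one factor acts on that factor alone. *)
Lemma coefmx_prodl (I J : pred 'I_n) D1 D2 (b1 : 'I_D1 -> 'X_{1..n}) (b2 : 'I_D2 -> 'X_{1..n}) P :
    (forall i, I i -> ~~ J i) -> injective b2 ->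
    (forall d, msupp_in I (b1 d)) -> (forall d, msupp_in J (b2 d)) -> supp_in I P ->
  coefmx (box_prod b1 b2) P = coefmx b1 P *t 1%:M.
Proof.
move=> IJ inj2 s1 s2 sP; apply/matrixP => i j.
case: (mxtens_indexP i) => a c; case: (mxtens_indexP j) => a' c'.
rewrite tensmxE mxE /box_prod !mxtens_indexK /= !mxE.
have [<-|ne] := eqVneq c c'.
  rewrite mulr1.
  have -> : (b1 a + b2 c <= b1 a' + b2 c)%MM = (b1 a <= b1 a')%MM.
    apply/mnm_lepP/mnm_lepP => h l; have := h l; rewrite !mnmDE ?leq_add2r //.
  by case: ifP => // _; congr (P _); apply/mnmP => l; rewrite !mnmBE !mnmDE subnDr.
rewrite mulr0; case: ifP => // /mnm_lepP le; apply/eqP; apply: contra_neqT ne => nz.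
apply: inj2; apply/mnmP => l; have := sP _ nz l; have := s2 c l; have := s2 c' l; have := le l.
have := s1 a l; have := s1 a' l.
rewrite mnmBE !mnmDE; case Il: (I l).
  by move: (IJ _ Il) => nJ _ _ _ /(_ nJ) -> /(_ nJ) ->.
by move=> /(_ isT) -> /(_ isT) -> h _ _ /(_ isT); lia.
Qed.

Lemma coefmx_prodr (I J : pred 'I_n) D1 D2 (b1 : 'I_D1 -> 'X_{1..n}) (b2 : 'I_D2 -> 'X_{1..n}) P :
    (forall i, I i -> ~~ J i) -> injective b1 ->
    (forall d, msupp_in I (b1 d)) -> (forall d, msupp_in J (b2 d)) -> supp_in J P ->
  coefmx (box_prod b1 b2) P = 1%:M *t coefmx b2 P.
Proof.
move=> IJ inj1 s1 s2 sP; apply/matrixP => i j.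
case: (mxtens_indexP i) => a c; case: (mxtens_indexP j) => a' c'.
rewrite tensmxE mxE /box_prod !mxtens_indexK /= !mxE.
have [<-|ne] := eqVneq a a'.
  rewrite mul1r.
  have -> : (b1 a + b2 c <= b1 a + b2 c')%MM = (b2 c <= b2 c')%MM.
    apply/mnm_lepP/mnm_lepP => h l; have := h l; rewrite !mnmDE ?leq_add2l //.
  by case: ifP => // _; congr (P _); apply/mnmP => l; rewrite !mnmBE !mnmDE subnDl.
rewrite mul0r; case: ifP => // /mnm_lepP le; apply/eqP; apply: contra_neqT ne => nz.
apply: inj1; apply/mnmP => l; have := sP _ nz l; have := s1 a l; have := s1 a' l; have := le l.
have := s2 c l; have := s2 c' l.
rewrite mnmBE !mnmDE; case Il: (I l); last by move=> _ _ _ /(_ isT) -> /(_ isT) ->.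
by move: (IJ _ Il) => nJ /(_ nJ) -> /(_ nJ) -> h _ _ /(_ nJ); lia.
Qed.

(** The ring is free over its subring of squares, with basis the monomials with
    exponents 0 and 1, and [P ^+ 2] acts on each copy of that subring as the
    Frobenius twist of [P]. *)
Lemma rank_coefmx_sqr q (P : S) D D' (b : 'I_D -> 'X_{1..n}) (b' : 'I_D' -> 'X_{1..n}) :
    2%N \in [pchar K] -> box_basis q b -> box_basis (2 * q) b' ->
  \rank (coefmx b' (P ^+ 2)) = (\rank (coefmx b P) * 2 ^ n)%N.
Proof.
move=> c2 bb bb'; pose u := @full_box 2; have bu := full_box_basis 2.
pose w := box_prod (fun d => b d *+ 2)%MM u.
have u2 d i : (u d i < 2)%N by move: i; apply/(proj2 bu); exists d.
(* each box monomial is uniquely a square times one with exponents 0 and 1 *)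
have wE a c : w (mxtens_index (a, c)) = (b a *+ 2 + u c)%MM.
  by rewrite /w /box_prod mxtens_indexK.
have inj2 (x y : 'X_{1..n}) c c' : (x *+ 2 + u c = y *+ 2 + u c')%MM -> x = y /\ c = c'.
  move=> /mnmP e; split; [|apply: (proj1 bu)]; apply/mnmP => i; move: (e i) (u2 c i) (u2 c' i);
    rewrite !mnmDE /u; lia.
have bw : box_basis (2 * q) w.
  split=> [d d'|m].
    case: (mxtens_indexP d) => a c; case: (mxtens_indexP d') => a' c'.
    by rewrite !wE => /inj2[/(proj1 bb) -> ->].
  split=> [lt|[d <-] i]; last first.
    case: (mxtens_indexP d) => a c; rewrite wE mnmDE ?mulmnE.
    have : (b a i < q)%N by move: i; apply/(proj2 bb); exists a.
    by have := u2 c i; lia.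
  have /(proj2 bb)[a ea] : forall i, ([multinom ((m i)./2) | i < n]%MM i < q)%N.
    by move=> i; rewrite mnmE; have := lt i; lia.
  have /(proj2 bu)[c ec] : forall i, ([multinom (odd (m i) : nat) | i < n]%MM i < 2)%N.
    by move=> i; rewrite mnmE; case: odd.
  exists (mxtens_index (a, c)); rewrite wE /u ea ec; apply/mnmP => i.
  by rewrite !mnmDE !mnmE -[RHS]odd_double_half addnC addnn.
rewrite (mxsim_rank (coefmx_sim _ bb' bw)).
suff -> : coefmx w (P ^+ 2) = map_mx (pFrobenius_aut c2) (coefmx b P) *t 1%:M.
  rewrite rank_tensmx mxrank_map mxrank1; congr (_ * _)%N.
  by rewrite card_ffun !card_ord.
apply/matrixP => i j; case: (mxtens_indexP i) => a c; case: (mxtens_indexP j) => a' c'.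
rewrite tensmxE mxE !wE !mxE.
have [<-|ne] := eqVneq c c'; last first.
  rewrite mulr0; case: ifP => // /mnm_lepP le; apply/eqP; apply: contra_neqT ne => nz.
  have [x /mnmP ex _] := mps_frob_neq0 (e := 1) c2 nz.
  apply: (proj1 bu); apply/mnmP => l.
  have := ex l; have := le l; have := u2 c l; have := u2 c' l.
  by rewrite mnmBE !mnmDE ?mulmnE /u; lia.
rewrite mulr1.
have -> : (b a *+ 2 + u c <= b a' *+ 2 + u c)%MM = (b a <= b a')%MM.
  apply/mnm_lepP/mnm_lepP => h l; have := h l; rewrite !mnmDE ?mulmnE; lia.
case: ifP => [_|_]; last by rewrite rmorph0.
have -> : (b a' *+ 2 + u c - (b a *+ 2 + u c) = (b a' - b a) *+ 2)%MM.
  by apply/mnmP => l; rewrite !(mnmBE, mnmDE, mulmnE) subnDr mulnBl.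
by rewrite (mps_frob_mul c2 1) pFrobenius_autE.
Qed.

End CoefficientMatrix.

(** * The colengths of the truncated hypersurfaces as coranks *)

Section QuotientDimension.
Context (k : fieldType) (V : lmodType k) (D : nat).
Context (phi : {linear V -> 'rV[k]_D}) (B : 'M[k]_D) (W : set V).
Hypothesis phi_surj : forall v, exists s, phi s = v.
Hypothesis WB : forall v, W v <-> (phi v <= B)%MS.

Let phi_sum d (e : 'I_d -> V) (c : {ffun 'I_d -> k}) :
  phi (\sum_i c i *: e i) = (\row_i c i) *m (\matrix_i phi (e i)).
Proof.
rewrite linear_sum mulmx_sum_row; apply: eq_bigr => i _.
by rewrite linearZ /= mxE rowK.
Qed.

Lemma basis_mod_dim d (e : 'I_d -> V) : basis_mod setT W e -> d = (D - \rank B)%N.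
Proof.
move=> [_ span]; pose E := \matrix_i phi (e i).
have free (u : 'rV_d) : (u *m E <= B)%MS -> u = 0.
  move=> uB; have [c [_ uniq]] := span 0 I.
  have [e1 e2] : c = [ffun i => - u 0 i] /\ c = [ffun=> 0].
    split; apply: uniq; apply/WB; rewrite linearB linear0 sub0r phi_sum.
      have -> : (\row_i [ffun i0 => - u 0 i0] i) = - u by apply/rowP => i; rewrite mxE ffunE mxE.
      by rewrite mulNmx opprK.
    have -> : (\row_i [ffun=> 0] i) = 0 :> 'rV[k]_d by apply/rowP => i; rewrite mxE ffunE mxE.
    by rewrite mul0mx oppr0 sub0mx.
  apply/rowP => i; have := congr1 (fun f : {ffun _} => f i) (etrans (esym e1) e2).
  by rewrite !ffunE mxE => /eqP; rewrite oppr_eq0 => /eqP.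
have rE : \rank E = d.
  by apply/eqP/inj_row_free => u uE; apply: free; rewrite uE sub0mx.
have full : \rank (E + B)%MS = D.
  apply/eqP; rewrite -[_ == D]/(row_full _) -sub1mx; apply/row_subP => i.
  have [v ev] := phi_surj (row i 1%:M); have [c [/WB h _]] := span v I.
  rewrite -ev -(subrK (phi (\sum_i c i *: e i)) (phi v)) addmx_sub //.
    by rewrite -linearB; apply: submx_trans h (addsmxSr _ _).
  by rewrite phi_sum; apply: submx_trans (submxMl _ _) (addsmxSl _ _).
have cap : \rank (E :&: B)%MS = 0%N.
  apply/eqP; rewrite mxrank_eq0; apply/eqP/row_matrixP => i; rewrite row0.
  have : (row i (E :&: B) <= E :&: B)%MS by apply: row_sub.
  rewrite sub_capmx => /andP[/submxP[u eu] hB].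
  by rewrite eu in hB *; rewrite (free _ hB) mul0mx.
by have := mxrank_sum_cap E B; rewrite full cap rE; have := rank_leq_col B; lia.
Qed.

Lemma qdim_row_pre : qdim setT W = (D - \rank B)%N.
Proof.
rewrite /qdim; apply: xget_unique => [|d [e /basis_mod_dim //]].
rewrite -mxrank_compl; pose C := row_base B^C%MS.
have lift i : exists v, phi v = row i C by apply: phi_surj.
pose e i := xget 0 [set v | phi v = row i C].
have ee i : phi (e i) = row i C.
  by rewrite /e; case: xgetP => // h; have [v ev] := lift i; case: (h v).
have eE : \matrix_i phi (e i) = C by apply/row_matrixP => i; rewrite rowK ee.
exists e; split=> // v _.
have : (phi v <= C + B)%MS.
  rewrite (adds_eqmx (eq_row_base _) (eqmx_refl B)) addsmxC.
  by rewrite submx_full // addsmx_compl_full.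
move=> /sub_addsmxP[[u w] /= ev].
exists [ffun i => u 0 i]; split=> [|c' /WB].
  apply/WB; rewrite linearB phi_sum eE ev.
  have -> : (\row_i [ffun i0 => u 0 i0] i) = u by apply/rowP => i; rewrite mxE ffunE.
  by rewrite addrC addKr submxMl.
rewrite linearB phi_sum eE ev => h.
have h2 : ((u - \row_i c' i) *m C <= B)%MS.
  rewrite mulmxBl -[X in (X <= _)%MS](addrK (w *m B)).
  rewrite [_ + w *m B](_ : _ = u *m C + w *m B - (\row_i c' i) *m C); last by rewrite addrAC.
  by rewrite addmx_sub // eqmx_opp submxMl.
have /eqP : (u - \row_i c' i) *m C = 0.
  apply/eqP; rewrite -submx0 -(capmx_compl B) sub_capmx h2 andTb.
  by apply: submx_trans (submxMl _ _) _; rewrite eq_row_base.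
rewrite -(mul0mx _ C) (inj_eq (row_free_inj (row_base_free _))) subr_eq0 => /eqP eu.
by apply/ffunP => i; rewrite ffunE eu mxE.
Qed.

End QuotientDimension.

Section PolyDimension.
Context (k : fieldType) (d q D : nat) (b : 'I_D -> 'X_{1..d}).
Hypothesis bb : box_basis q b.

Definition polyrow (p : {mpoly k[d]}) : 'rV[k]_D := coefrow b (mps_of_poly p).

Lemma polyrow_linear : linear polyrow.
Proof. by move=> c p r; apply/rowP => i; rewrite !mxE /mps_of_poly mcoeffD mcoeffZ. Qed.

HB.instance Definition _ :=
  GRing.isLinear.Build k {mpoly k[d]} 'rV[k]_D _ polyrow polyrow_linear.

Lemma polyrow_surj v : exists p, polyrow p = v.
Proof.
exists (\sum_i v 0 i *: 'X_[b i]); apply/rowP => j.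
rewrite mxE /mps_of_poly raddf_sum (bigD1 j) //= big1 => [|i ne].
  by rewrite addr0 mcoeffZ mcoeffX eqxx mulr1.
by rewrite mcoeffZ mcoeffX (inj_eq (proj1 bb)) (negPf ne) mulr0.
Qed.

Lemma ideal_genP (R : comNzRingType) (X J : set R) :
  is_ideal J -> X `<=` J -> ideal_gen X `<=` J.
Proof. by move=> Jid XJ x; apply. Qed.

Lemma ideal_gen_ideal (R : comNzRingType) (X : set R) : is_ideal (ideal_gen X).
Proof.
split=> [J [[] //]|x y Xx Xy J JX|a x Xx J JX].
  by case: (JX) => -[_ JD _] _; apply: JD; [apply: Xx | apply: Xy].
by case: (JX) => -[_ _ JM] _; apply: JM; apply: Xx.
Qed.

Lemma sub_ideal_gen (R : comNzRingType) (X : set R) : X `<=` ideal_gen X.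
Proof. by move=> x Xx J [_]; apply. Qed.

Lemma trunc_ideal_rows (f p : {mpoly k[d]}) :
  ideal_gen ([set 'X_i ^+ q | i in [set: 'I_d]] `|` [set f]) p <->
  (polyrow p <= coefmx b (mps_of_poly f))%MS.
Proof.
set X := _ `|` _; have [G0 GD GM] := ideal_gen_ideal X.
split.
  apply: (@ideal_genP _ X [set p | (polyrow p <= coefmx b (mps_of_poly f))%MS]).
    split=> [|p1 p2|a p1]; rewrite /= ?linear0 ?sub0mx ?linearD //.
      by move=> h1 h2; rewrite addmx_sub.
    move=> /submxP[u eu]; rewrite /polyrow rmorphM (coefrowM bb) /=.
    rewrite -[coefrow b _]/(polyrow p1) eu -mulmxA -(coefmxM bb) mulrC (coefmxM bb) mulmxA.
    exact: submxMl.
  move=> x [[i _ <-]|->] /=.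
    rewrite /polyrow (_ : coefrow b _ = 0) ?sub0mx //; apply/(coefrow_eq0 bb) => m lt.
    rewrite /mps_of_poly mpolyXn mcoeffX; case: eqP => // e.
    by have := lt i; rewrite -e mulmnE mnm1E eqxx mul1n ltnn.
  rewrite /polyrow -{1}[mps_of_poly f]mul1r mulrC (coefrowM bb); exact: submxMl.
move=> /submxP[u eu]; have [r er] := polyrow_surj u.
have -> : p = (p - r * f) + r * f by rewrite subrK.
apply: (GD); last by apply: (GM); apply: sub_ideal_gen; right.
have : polyrow (p - r * f) = 0.
  by rewrite linearB /= [polyrow (r * f)]/polyrow rmorphM mulrC (coefrowM bb) -[coefrow b _]/(polyrow r) er eu subrr.
move=> /(coefrow_eq0 bb) K; rewrite [p - r * f]mpolyE.
apply: (big_ind (ideal_gen X)) => [|x y hx hy|m _]; [exact: G0 | exact: GD |].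
have [/existsP[i le]|/existsPn none] := boolP [exists i, (q <= m i)%N]; last first.
  rewrite [X in X *: _](_ : _ = 0) ?scale0r //.
  by apply: (K m) => i; rewrite ltnNge none.
rewrite -mul_mpolyC; apply: (GM).
have le' : (U_(i) *+ q <= m)%MM.
  apply/mnm_lepP => j; rewrite mulmnE mnm1E.
  by case: eqP => [<-|_]; rewrite ?mul1n ?mul0n.
rewrite -(submK le') mpolyXD; apply: (GM); apply: sub_ideal_gen; left.
by exists i => //; rewrite mpolyXn.
Qed.

End PolyDimension.

(** The number [e_n f] is the corank of multiplication by [f] on the ring
    truncated at exponent [2 ^ n]. *)
Lemma e_nE (k : closedFieldType) d n D (b : 'I_D -> 'X_{1..d}) (f : {mpoly k[d]}) :
  box_basis (2 ^ n) b -> e_n n f = (D - \rank (coefmx b (mps_of_poly f)))%N.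
Proof.
move=> bb; apply: (@qdim_row_pre _ _ _ (polyrow b)) => [v|p].
  exact: polyrow_surj bb v.
exact: trunc_ideal_rows.
Qed.

(** * The sums of the Brenner-Monsky brackets *)

Section BracketSum.
Context (k : closedFieldType) (iota : {rmorphism 'F_2 -> k}) (alpha : k).
Local Notation m := (degF2 iota alpha).
Hypothesis m_gt1 : (1 < m)%N.

(** For [n > 0] the element [f_elt n j] is [A_n + c C], [B_n + c C] or [c C]:
    a state records the letter and the exponent [c]. *)
Inductive letter := LA | LB | LO.

Definition step (s : bool) (n : nat) (st : letter * nat) : letter * nat :=
  match st with
  | (LA, c) => (if hit iota alpha s n.+1 then LB else LA, c)
  | (LB, c) => if hit iota alpha s n then (LO, c) else (LA, c.+1)
  | (LO, c) => (LO, c)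
  end.

Fixpoint state (n j : nat) : letter * nat :=
  if n is n'.+1 then step (odd j) n (state n' j./2)
  else (if odd j then LO else LA, 2%N).

Definition embed (n : nat) (st : letter * nat) : Gamma :=
  match st.1 with LA => gen (GA n) | LB => gen (GB n) | LO => 0 end + gen GC *+ st.2.

(** The total weight [2 ^ c] carried by the letter [A], respectively [B]; a
    [bracket] is three times the first plus five times the second. *)
Definition wA (st : letter * nat) : nat := if st.1 is LA then (2 ^ st.2)%N else 0%N.
Definition wB (st : letter * nat) : nat := if st.1 is LB then (2 ^ st.2)%N else 0%N.

Lemma sigma_gen_lift s x : sigma iota alpha s (gen x) = sigma_gen iota alpha s x.
Proof. by rewrite /sigma /gen liftU scale1r. Qed.

Let sigmaB s x y : sigma iota alpha s (x - y) = sigma iota alpha s x - sigma iota alpha s y.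
Proof. exact: lift_is_additive. Qed.

Lemma sigma0 s : sigma iota alpha s 0 = 0.
Proof. by have := sigmaB s 0 0; rewrite !subrr. Qed.

Lemma sigmaD s x y : sigma iota alpha s (x + y) = sigma iota alpha s x + sigma iota alpha s y.
Proof. by have := sigmaB s x (- y); have := sigmaB s 0 y; rewrite sigma0 sub0r sub0r => ->; rewrite !opprK. Qed.

Lemma sigmaMn s x c : sigma iota alpha s (x *+ c) = sigma iota alpha s x *+ c.
Proof. by elim: c => [|c IH]; rewrite ?sigma0 // !mulrS sigmaD IH. Qed.

Lemma f_eltE n j : (j < 2 ^ n.+1)%N -> f_elt iota alpha n.+1 j = embed n.+1 (state n j).
Proof.
elim: n j => [|n IH] j lt.
  case: j lt => [|[|//]] _; rewrite /f_elt /= sigmaD sigmaMn !sigma_gen_lift /embed /=.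
    by rewrite addrC.
  by rewrite addr0 add0r.
have lt2 : (j./2 < 2 ^ n.+1)%N by rewrite -divn2 ltn_divLR // mulnC -expnS.
rewrite [LHS]/= -/(f_elt iota alpha n.+1 j./2) IH // [state n.+1 j]/=.
case: (state n j./2) => [[] c]; rewrite /embed /= sigmaD sigmaMn ?sigma0 !sigma_gen_lift //=.
  by case: hit.
by case: hit => //=; rewrite -addrA mulrS.
Qed.

Lemma bracket_stateE n j : (j < 2 ^ n.+1)%N ->
  bracket iota alpha n.+1 j = (3 * wA (state n j) + 5 * wB (state n j))%N%:R.
Proof.
move=> lt; rewrite /bracket f_eltE // /embed.
have neq x y : (x == y :> gsym) = (gsym_code x == gsym_code y) by [].
case: (state n j) => [[] c]; rewrite /wA /wB /gen /= ?(coeffD, coeffMn, coeffU, coeff0) ?neq /= ?eqxx /=.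
all: rewrite !(mul1r, mulr0, mul0rn, addr0, add0r, mulr1, muln0, addn0, add0n) ?mul0r //.
  by rewrite [X in 2 ^ X](_ : _ = c%:Z) ?natz // -exprnP natrM natrX.
by rewrite [X in 2 ^ X](_ : _ = c%:Z) ?natz // -exprnP natrM natrX.
Qed.

Lemma sum_pairs (f : nat -> nat) N :
  (\sum_(0 <= j < 2 * N) f j = \sum_(0 <= j < N) (f j.*2 + f j.*2.+1))%N.
Proof.
elim: N => [|N IH]; first by rewrite !big_geq.
by rewrite mulnS add2n !big_nat_recr //= IH mul2n addnA.
Qed.

(** Each state at level [n] has the two successors given by the two values of
    the last binary digit. *)
Lemma state_sum (w : letter * nat -> nat) n :
  (\sum_(0 <= j < 2 ^ n.+2) w (state n.+1 j) =
   \sum_(0 <= j < 2 ^ n.+1) (w (step false n.+1 (state n j)) + w (step true n.+1 (state n j))))%N.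
Proof.
rewrite expnS sum_pairs; apply: eq_bigr => j _ /=.
by rewrite odd_double /= doubleK uphalf_double.
Qed.

(** The parities [P] and [Q] are opposite, so exactly one of the two maps
    branches off at a multiple of [m]. *)
Lemma hit_true l : hit iota alpha true l = (m %| l)%N && ~~ hit iota alpha false l.
Proof. by rewrite /hit /parity; case: (m %| l)%N; case: odd; case: (degF2 _ (artin_schreier_root _) == m). Qed.

Lemma hit_ndvd s l : ~~ (m %| l)%N -> hit iota alpha s l = false.
Proof. by rewrite /hit => /negPf ->. Qed.

(** Away from multiples of [m] each [A] has two successors [A]. On reaching a
    multiple of [m], one of the two successors of each [A] is a [B]; at the next
    step one copy of each [B] dies and the other one returns to [A] with doubled
    weight, which makes up for the loss. *)
Lemma weights n :
  (\sum_(0 <= j < 2 ^ n.+1) wA (state n j) = if m %| n.+1 then 2 ^ n.+1 else 2 ^ n.+2)%N /\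
  (\sum_(0 <= j < 2 ^ n.+1) wB (state n j) = if m %| n.+1 then 2 ^ n.+1 else 0)%N.
Proof.
elim: n => [|n [IHA IHB]].
  rewrite dvdn1; have -> : (m == 1)%N = false by apply/negbTE; rewrite neq_ltn m_gt1 orbT.
  by rewrite expn1 !big_nat_recr //= !big_geq.
rewrite !state_sum.
have [d1|nd1] := boolP (m %| n.+1)%N.
  have nd2 : ~~ (m %| n.+2)%N.
    by apply/negP => d2; move: (dvdn_sub d2 d1); rewrite subSnn dvdn1 => /eqP e; move: m_gt1; rewrite e.
  rewrite d1 in IHA IHB; rewrite (negPf nd2); split.
    transitivity (\sum_(0 <= j < 2 ^ n.+1) (2 * wA (state n j) + 2 * wB (state n j)))%N.
      apply: eq_bigr => j _; case: (state n j) => [[] c] //=.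
        by rewrite !(hit_ndvd _ nd2) /wA /wB /=; lia.
      rewrite hit_true d1 /=; case: hit; rewrite /wA /wB /= expnS; lia.
    by rewrite big_split -!big_distrr /= IHA IHB !expnS; lia.
  rewrite big1 // => j _; case: (state n j) => [[] c] //=.
    by rewrite !(hit_ndvd _ nd2).
  by case: hit; case: hit.
rewrite (negPf nd1) in IHA IHB.
have {}IHB : forall j, (0 <= j < 2 ^ n.+1)%N -> wB (state n j) = 0%N.
  move=> j lt; move/eqP: IHB; rewrite sum_nat_seq_eq0 => /allP/(_ j).
  by rewrite mem_index_iota => /(_ lt)/eqP.
have [d2|nd2] := boolP (m %| n.+2)%N.
  split.
    transitivity (\sum_(0 <= j < 2 ^ n.+1) wA (state n j))%N; last by rewrite IHA.
    rewrite !big_nat; apply: eq_bigr => j /IHB; case: (state n j) => [[] c] //=.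
      by move=> _; rewrite hit_true d2 /=; case: hit; rewrite /wA /=; lia.
    by rewrite /wB /= => /eqP; rewrite expn_eq0.
  transitivity (\sum_(0 <= j < 2 ^ n.+1) wA (state n j))%N; last by rewrite IHA.
  rewrite !big_nat; apply: eq_bigr => j /IHB; case: (state n j) => [[] c] //=.
    by move=> _; rewrite hit_true d2 /=; case: hit; rewrite /wA /wB /=; lia.
  by rewrite {1}/wB /= => /eqP; rewrite expn_eq0.
split.
  transitivity (\sum_(0 <= j < 2 ^ n.+1) 2 * wA (state n j))%N; last first.
    by rewrite -big_distrr /= IHA -expnS.
  rewrite !big_nat; apply: eq_bigr => j /IHB; case: (state n j) => [[] c] //=.
    by move=> _; rewrite !(hit_ndvd _ nd2) /wA /=; lia.
  by rewrite /wB /= => /eqP; rewrite expn_eq0.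
rewrite big_nat big1 // => j /IHB; case: (state n j) => [[] c] //=.
  by rewrite !(hit_ndvd _ nd2).
by rewrite {1}/wB /= => /eqP; rewrite expn_eq0.
Qed.

(** Summing three times the [A]-weights and five times the [B]-weights of
    [weights]. *)
Lemma bracket_sum n : (0 < n)%N ->
  \sum_(j < 2 ^ n) bracket iota alpha n j = (2 ^ n.+1 * (3 + (m %| n)))%N%:R.
Proof.
case: n => // n _; have [hA hB] := weights n.
transitivity ((\sum_(0 <= j < 2 ^ n.+1) (3 * wA (state n j) + 5 * wB (state n j)))%N%:R : rat).
  by rewrite big_mkord natr_sum; apply: eq_bigr => j _; rewrite bracket_stateE.
congr (_%:R); rewrite big_split -!big_distrr /= hA hB.
by case: (m %| n.+1)%N; rewrite !expnS; lia.
Qed.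

End BracketSum.

(** * Odd Jordan blocks of the quartics *)

Section QuarticAltsum.
Context (k : closedFieldType) (iota : {rmorphism 'F_2 -> k}) (alpha : k).
Local Notation m := (degF2 iota alpha).
Local Notation g := (quartic_poly alpha).

Lemma rank_coefmx_frob n (P : mpseries n k) q D (b : 'I_D -> 'X_{1..n})
    D' (b' : 'I_D' -> 'X_{1..n}) e :
    box_basis q b -> box_basis (2 ^ e * q) b' ->
  \rank (coefmx b' (P ^+ (2 ^ e))) = (\rank (coefmx b P) * 2 ^ (n * e))%N.
Proof.
move=> bb; elim: e D' b' => [|e IH] D' b' bb'.
  rewrite expn0 mul1n in bb'; rewrite expr1 muln0 muln1.
  exact/mxsim_rank/(coefmx_sim _ bb' bb).
have bm := @full_box_basis n (2 ^ e * q).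
rewrite expnS -mulnA in bb'; rewrite expnSr exprM.
rewrite (rank_coefmx_sqr _ (char2 iota) bm bb') (IH _ _ bm).
by rewrite mulnS addnC expnD mulnA.
Qed.

Lemma quartic_box2 : box_ideal 2 (mps_of_poly g).
Proof.
have [I0 ID IM] := box_ideal_ideal 3 k 2.
have sq i : box_ideal 2 (mps_of_poly ('X_i ^+ 2 : {mpoly k[3]})).
  move=> l lt; rewrite /mps_of_poly mpolyXn mcoeffX; case: eqP => // e.
  by have := lt i; rewrite -e mulmnE mnm1E eqxx.
have M p i : box_ideal 2 (mps_of_poly (p * 'X_i ^+ 2 : {mpoly k[3]})).
  by rewrite rmorphM; apply: (IM); apply: sq.
rewrite /quartic_poly /quartic.
set x := 'X_(inord 0); set y := 'X_(inord 1); set z := 'X_(inord 2).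
have -> : alpha *: (x ^+ 2 * y ^+ 2) + z ^+ 4 + x * y * z ^+ 2 + (x ^+ 3 + y ^+ 3) * z =
  (alpha *: x ^+ 2) * y ^+ 2 + z ^+ 2 * z ^+ 2 + x * y * z ^+ 2 + ((x * z) * x ^+ 2 + (y * z) * y ^+ 2).
  by rewrite -scalerAl; congr (_ + _ + _ + _); ring.
rewrite !(rmorphD (@mps_of_poly 3 k)); apply: (ID); last by apply: (ID); apply: M.
by apply: (ID); last exact: M; apply: (ID); apply: M.
Qed.

(** Half the number of Jordan blocks of odd size of the quartic truncated at
    exponent [2 ^ s.+1]. *)
Definition bracket_weight (s : nat) : nat :=
  if s == 0%N then 4 else (2 ^ s.+1 * (3 + (m %| s)))%N.

Hypothesis m_gt1 : (1 < m)%N.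
Hypothesis bracketE : forall n j : nat, (1 <= n)%N -> (j < 2 ^ n)%N ->
       bracket iota alpha n j =
         (e_n n.+1 (g ^+ (2 * j).+1))%:R
         - 1 / 2 * ((e_n n.+1 (g ^+ (2 * j)))%:R + (e_n n.+1 (g ^+ (2 * j).+2))%:R).

(** The bracket compares consecutive rank drops: it is half the difference of
    the drops at [2 j] and [2 j + 1]. Summed over [j] this is half the
    alternating sum. *)
Lemma altsum_quartic0 s D (b : 'I_D -> 'X_{1..3}) : box_basis (2 ^ s.+1) b ->
  altsum (2 ^ s.+1) (coefmx b (mps_of_poly g)) = (2 * bracket_weight s)%N%:Z.
Proof.
move=> bb; set A := coefmx b _.
have eE i : e_n s.+1 (g ^+ i) = (D - \rank (A ^+ i))%N.
  by rewrite (e_nE _ bb) rmorphXn (coefmxX bb).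
have -> : altsum (2 ^ s.+1) A =
    \sum_(j < 2 ^ s) (rkdrop A (2 * j) - rkdrop A (2 * j).+1).
  rewrite /altsum -(big_mkord xpredT (fun l => (-1) ^+ l * rkdrop A l)).
  rewrite -(big_mkord xpredT (fun j => rkdrop A (2 * j) - rkdrop A (2 * j).+1)).
  rewrite expnS; elim: (2 ^ s)%N => [|N IH]; first by rewrite !big_geq.
  rewrite mulnS add2n !big_nat_recr //= IH -addrA; congr (_ + _).
  by rewrite exprS -signr_odd mul2n odd_double expr0 mul1r !mulN1r.
have [s0|s0] := eqVneq s 0%N.
  rewrite /bracket_weight s0 eqxx expn0 big_ord_recl big_ord0 addr0 /=.
  (* every monomial of the quartic is divisible by the square of a variable *)
  have A0 : A = 0 by apply: (coefmx_eq0 bb); rewrite s0; apply: quartic_box2.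
  by rewrite /rkdrop A0 expr0 expr1 mxrank1 (card_box k bb) s0 !expr0n /= !mxrank0.
rewrite /bracket_weight (negPf s0); apply: (@intr_inj rat).
have := bracket_sum m_gt1 (n := s); rewrite lt0n s0 => /(_ isT) eS.
rewrite PoszM intrM -[(2 ^ _ * _)%N%:~R]/(((2 ^ s.+1 * (3 + (m %| s)))%N)%:R) -eS.
rewrite rmorph_sum mulr_sumr; apply: eq_bigr => j _; rewrite bracketE ?lt0n // !eE.
have le i : (\rank (A ^+ i) <= D)%N by apply: rank_leq_col.
rewrite !natrB ?le // /rkdrop !rmorphB /=.
by field.
Qed.

(** Raising [g] to the power [2 ^ r] multiplies all ranks by [8 ^ r] and rescales
    the truncation, by [rank_coefmx_frob]. *)
Lemma altsum_quartic n r D (b : 'I_D -> 'X_{1..3}) : box_basis (2 ^ n) b -> (r < n)%N ->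
  altsum (2 ^ (n - r)) (coefmx b (mps_of_poly g) ^+ (2 ^ r)) =
  (8 ^ r * (2 * bracket_weight (n - r).-1))%N%:Z.
Proof.
move=> bb rn; have e1 : (n - r = (n - r).-1.+1)%N by rewrite prednK // subn_gt0.
have [D' [b' bm]] : exists D' (b' : 'I_D' -> 'X_{1..3}), box_basis (2 ^ (n - r)) b'.
  by exists _, (@full_box 3 (2 ^ (n - r))); apply: full_box_basis.
have bm' : box_basis (2 ^ (n - r).-1.+1) b' by rewrite -e1.
rewrite PoszM -(altsum_quartic0 bm') -e1 mulr_sumr.
apply: eq_bigr => l _; rewrite mulrCA; congr (_ * _).
have h i : (\rank ((coefmx b (mps_of_poly g) ^+ (2 ^ r)) ^+ i) =
    8 ^ r * \rank (coefmx b' (mps_of_poly g) ^+ i))%N.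
  rewrite -exprM mulnC exprM -(coefmxX bb) -(coefmxX bb) -(coefmxX bm).
  have bb2 : box_basis (2 ^ r * 2 ^ (n - r)) b by rewrite -expnD subnKC // ltnW.
  by rewrite (rank_coefmx_frob _ bm bb2) expnM mulnC.
by rewrite /rkdrop !h !PoszM mulrBr.
Qed.

End QuarticAltsum.

(** * The hypersurface as an iterated tensor sum *)

Section BoxIn.
Context (n : nat) (q : nat).

(** As [box_basis], for the monomials in the variables of [I] only. *)
Definition box_in (I : pred 'I_n) D (b : 'I_D -> 'X_{1..n}) : Prop :=
  injective b /\
  forall m : 'X_{1..n}, (msupp_in I m /\ forall i, (m i < q)%N) <-> exists d, b d = m.

Lemma box_in_supp I D (b : 'I_D -> 'X_{1..n}) d : box_in I b -> msupp_in I (b d).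
Proof. by move=> [_ h]; have [|] := (proj2 (h (b d))); first by exists d. Qed.

Lemma box_in_lt I D (b : 'I_D -> 'X_{1..n}) d i : box_in I b -> (b d i < q)%N.
Proof. by move=> [_ h]; have [|_] := (proj2 (h (b d))); first by exists d. Qed.

Lemma box_in_full D (b : 'I_D -> 'X_{1..n}) (I : pred 'I_n) :
  (forall i, I i) -> box_in I b -> box_basis q b.
Proof.
move=> IT [inj h]; split=> // m; rewrite -h; split=> [lt|[]//].
by split=> // i; rewrite IT.
Qed.

Lemma box_in_prod (I J L : pred 'I_n) D1 D2 (b1 : 'I_D1 -> 'X_{1..n}) (b2 : 'I_D2 -> 'X_{1..n}) :
    (forall i, I i -> ~~ J i) -> (forall i, L i = I i || J i) ->
  box_in I b1 -> box_in J b2 -> box_in L (box_prod b1 b2).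
Proof.
move=> IJ LE B1 B2; have [[i1 h1] [i2 h2]] := (B1, B2).
have bE a c : box_prod b1 b2 (mxtens_index (a, c)) = (b1 a + b2 c)%MM.
  by rewrite /box_prod mxtens_indexK.
split.
  move=> d d'; case: (mxtens_indexP d) => a c; case: (mxtens_indexP d') => a' c'.
  rewrite !bE => /mnmP e; suff [-> ->] : a = a' /\ c = c' by [].
  split; [apply: i1 | apply: i2]; apply/mnmP => i; have := e i; rewrite !mnmDE;
    have := @box_in_supp _ _ _ a B1 i; have := @box_in_supp _ _ _ a' B1 i;
    have := @box_in_supp _ _ _ c B2 i; have := @box_in_supp _ _ _ c' B2 i;
    case Ii: (I i).
  - by rewrite (IJ _ Ii) => /(_ isT) -> /(_ isT) -> _ _; rewrite !addn0.
  - by move=> _ _ /(_ isT) -> /(_ isT) ->.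
  - by rewrite (IJ _ Ii) => /(_ isT) -> /(_ isT) ->.
  - by move=> _ _ /(_ isT) -> /(_ isT) ->.
move=> m; split=> [[sm lt]|[d <-]].
  have [a ea] : exists a, b1 a = [multinom (if I i then m i else 0%N) | i < n].
    apply/h1; split=> i; rewrite mnmE; first by move/negPf->.
    by case: ifP => // _; apply: leq_ltn_trans (lt i).
  have [c ec] : exists c, b2 c = [multinom (if J i then m i else 0%N) | i < n].
    apply/h2; split=> i; rewrite mnmE; first by move/negPf->.
    by case: ifP => // _; apply: leq_ltn_trans (lt i).
  exists (mxtens_index (a, c)); rewrite bE ea ec; apply/mnmP => i; rewrite mnmDE !mnmE.
  have := sm i; rewrite LE; case Ii: (I i); first by rewrite (negPf (IJ _ Ii)) addn0.
  by case: (J i) => //= -> .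
case: (mxtens_indexP d) => a c; rewrite bE; split=> i.
  rewrite LE negb_or mnmDE => /andP[nI nJ].
  by rewrite (box_in_supp a B1 nI) (box_in_supp c B2 nJ).
rewrite mnmDE; case Ii: (I i).
  by rewrite (box_in_supp c B2 (IJ _ Ii)) addn0; apply: box_in_lt B1.
by rewrite (box_in_supp a B1 (negbT Ii)); apply: box_in_lt B2.
Qed.

End BoxIn.

Section Tower.
Context (k : closedFieldType).
Context (t : nat) (alpha : 'I_t -> k) (e : nat).
Local Notation N := (3 * t).+2.
Local Notation S := (mpseries N k).
Local Notation q := (2 ^ e)%N.
Local Notation var j := (mps_var k (inord j : 'I_N)).

(** The coefficients are extended by zero to all natural indices, so that the
    blocks can be added one at a time. *)
Definition alphaN (r : nat) : k := if insub r is Some i then alpha i else 0.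

Definition block_var (r : nat) (j : 'I_3) : 'I_N := inord (3 * r + j).

Definition block_emb (r : nat) : 'X_{1..3} -> 'X_{1..N} := mnm_push (block_var r).

Definition block_quartic (r : nat) : S :=
  quartic (alphaN r) (var (3 * r)%N) (var (3 * r).+1) (var (3 * r).+2).

Definition in_block (r : nat) (i : 'I_N) : bool := (3 * r <= i < 3 * r + 3)%N.

Section Block.
Context (r : nat) (rt : (r < t)%N).

Lemma val_block_var j : block_var r j = (3 * r + j)%N :> nat.
Proof. by rewrite inordK //; have := ltn_ord j; lia. Qed.

Lemma in_blockP i : reflect (exists j, i = block_var r j) (in_block r i).
Proof.
apply: (iffP andP) => [[h1 h2]|[j ->]]; last by rewrite val_block_var; have := ltn_ord j; lia.
have lt : (i - 3 * r < 3)%N by lia.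
by exists (Ordinal lt); apply/ord_inj; rewrite val_block_var /= subnKC.
Qed.

Lemma block_var_inj : injective (block_var r).
Proof.
by move=> j l /(congr1 (@nat_of_ord _)); rewrite !val_block_var => /addnI/ord_inj.
Qed.

Lemma codom_block_var i : (i \in codom (block_var r)) = in_block r i.
Proof. by apply/codomP/in_blockP. Qed.

Lemma block_emb_supp c : msupp_in (in_block r) (block_emb r c).
Proof. by move=> i; rewrite -codom_block_var => /mnm_push_out ->. Qed.

Lemma block_emb_box D (b : 'I_D -> 'X_{1..3}) : box_basis q b ->
  box_in q (in_block r) (fun d => block_emb r (b d)).
Proof.
move=> [inj h]; split=> [d d' /(mnm_push_inj block_var_inj)/inj //|m].
split=> [[sm lt]|[d <-]].
  have [d ed] : exists d, b d = [multinom m (block_var r j) | j < 3].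
    by apply/h => j; rewrite mnmE.
  exists d; rewrite ed; symmetry; apply: (mnm_pushP block_var_inj) => i.
  by rewrite codom_block_var => /sm.
split=> [|i]; first exact: block_emb_supp.
have [/in_blockP[j ->]|nb] := boolP (in_block r i).
  by rewrite /block_emb mnm_pushE; [move: j; apply/h; exists d | exact: block_var_inj].
by rewrite block_emb_supp // expn_gt0.
Qed.

Definition block_map (p : {mpoly k[3]}) : S := poly_push (block_var r) p.

Lemma block_map_supp p : supp_in (in_block r) (block_map p).
Proof. by move=> m nz i; rewrite -codom_block_var; apply: poly_push_supp nz. Qed.

Lemma block_quarticE : block_quartic r = block_map (quartic_poly (alphaN r)).
Proof.
have v j : (j < 3)%N -> block_map 'X_(inord j) = var (3 * r + j)%N.
  by move=> lt; rewrite /block_map /poly_push mmapX mmap1U /block_var inordK.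
rewrite /quartic_poly /quartic /block_quartic /quartic.
rewrite -[block_map]/(mmap (GRing.in_alg S) (fun j => mps_var k (block_var r j))) in v *.
rewrite mmapD mmapD mmapD mmapZ !(rmorphD, rmorphXn, rmorphM) /= mulr_algl.
by rewrite !v // addn0 addn1 addn2.
Qed.

End Block.
End Tower.

Section Tower.
Context (k : closedFieldType) (iota : {rmorphism 'F_2 -> k}).
Context (t : nat) (alpha : 'I_t -> k) (e : nat).
Local Notation N := (3 * t).+2.
Local Notation S := (mpseries N k).
Local Notation q := (2 ^ e)%N.
Local Notation var j := (mps_var k (inord j : 'I_N)).
Local Notation c2 := (char2 iota).
Local Notation D3 := #|{ffun 'I_3 -> 'I_(2 ^ e)}|.
Local Notation b3 := (@full_box 3 (2 ^ e)).
Local Notation c3 := (fun d => block_emb t _ (b3 d)).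

Lemma coefmx_block r D (b : 'I_D -> 'X_{1..3}) : (r < t)%N ->
  coefmx (fun d => block_emb t r (b d)) (block_quartic alpha r) =
  coefmx b (mps_of_poly (quartic_poly (alphaN alpha r))).
Proof.
move=> rt; have inj := block_var_inj rt.
apply/matrixP => i j; rewrite !mxE /block_emb mnm_push_le //.
by case: ifP => // _; rewrite mnm_pushB // block_quarticE // /block_map mcoeff_poly_push.
Qed.

Lemma block_quartic0 r : block_quartic alpha r 0%MM = 0.
Proof.
have v0 j : var j 0%MM = 0 by rewrite /mps_var eq_sym mnm1_eq0.
rewrite /block_quartic /quartic !mpsDE mpsZE !(mps_mul0E, exprS) !v0.
by rewrite !mulr0 !mul0r mulr0 !addr0.
Qed.

Fixpoint tower_dim (r : nat) : nat := if r is r'.+1 then (tower_dim r' * D3)%N else 1%N.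

Fixpoint tower_box (r : nat) : 'I_(tower_dim r) -> 'X_{1..N} :=
  match r with
  | 0 => fun _ => 0%MM
  | r'.+1 => box_prod (@tower_box r') (fun d => block_emb t r' (b3 d))
  end.

Definition tower_sum (r : nat) : S := \sum_(0 <= i < r) block_quartic alpha i.

Definition below (r : nat) (i : 'I_N) : bool := (i < 3 * r)%N.

Lemma tower_box_in r : (r <= t)%N -> box_in q (below r) (@tower_box r).
Proof.
elim: r => [|r IH] rt.
  split=> [d d' _|m]; first by rewrite !ord1.
  split=> [[sm _]|[d <-]]; last by split=> i; rewrite mnm0E // expn_gt0.
  by exists 0; apply/mnmP => i; rewrite mnm0E sm // /below muln0.
apply: (box_in_prod (I := below r) (J := @in_block t r)).
- by move=> i; rewrite /below /in_block; lia.
- by move=> i; rewrite /below /in_block; lia.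
- by apply: IH; apply: ltnW.
- exact: (block_emb_box rt (full_box_basis 3 q)).
Qed.

Lemma tower_dimE r : tower_dim r = (2 ^ (e * (3 * r)))%N.
Proof.
elim: r => [|r IH] /=; first by rewrite !muln0.
by rewrite IH card_ffun !card_ord -expnM -expnD mulnS; congr (2 ^ _)%N; lia.
Qed.

Lemma tower_sum_supp r : (r <= t)%N -> supp_in (below r) (tower_sum r).
Proof.
move=> rt m; rewrite /tower_sum mps_sumE => nz i nb.
apply/eqP; apply: contraT => mi; case/eqP: nz; rewrite big_nat big1 // => l lr.
have lt : (l < t)%N by apply: leq_trans rt; case/andP: lr.
apply/eqP; apply: contraT => nz; case/eqP: mi.
rewrite block_quarticE // in nz; apply: (block_map_supp lt nz).
by move: nb; rewrite /below /in_block; move: lr; lia.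
Qed.

(** Adding a quartic in three new variables is forming a tensor sum. *)
Lemma coefmx_tower r : (r < t)%N ->
  coefmx (@tower_box r.+1) (tower_sum r.+1) =
  tsum (coefmx (@tower_box r) (tower_sum r))
       (coefmx b3 (mps_of_poly (quartic_poly (alphaN alpha r)))).
Proof.
move=> rt; have rt' := ltnW rt.
have IJ (i : 'I_N) : below r i -> ~~ in_block r i by rewrite /below /in_block; lia.
have B1 := tower_box_in rt'.
have B2 := block_emb_box rt (full_box_basis 3 q).
rewrite /tower_sum big_nat_recr //= coefmxD /tsum -(coefmx_block _ rt); congr (_ + _).
  apply: (coefmx_prodl IJ (proj1 B2)) => [d|d|].
  - exact: box_in_supp B1.
  - exact: box_in_supp B2.
  - exact: tower_sum_supp rt'.
apply: (coefmx_prodr IJ (proj1 B1)) => [d|d|].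
- exact: box_in_supp B1.
- exact: box_in_supp B2.
- by rewrite block_quarticE //; apply: block_map_supp.
Qed.

Lemma coefmx_block_nilp r : (r < t)%N ->
  coefmx b3 (mps_of_poly (quartic_poly (alphaN alpha r))) ^+ q = 0.
Proof.
move=> rt; apply: (coefmx_nilp (full_box_basis 3 q) (e := e)); rewrite ?c2 //.
rewrite -(block_quartic0 r) block_quarticE //.
have -> : 0%MM = mnm_push (@block_var t r) 0%MM by rewrite /mnm_push big1 // => i _; rewrite mnm0E.
by rewrite /block_map mcoeff_poly_push //; apply: block_var_inj.
Qed.

Lemma coefmx_tower_nilp r : (r <= t)%N -> coefmx (@tower_box r) (tower_sum r) ^+ q = 0.
Proof.
elim: r => [|r IH] rt.
  have -> : coefmx (@tower_box 0) (tower_sum 0) = 0.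
    by apply/matrixP => i j; rewrite !mxE /tower_sum big_geq // mps0E if_same.
  by rewrite expr0n expn_eq0.
by rewrite coefmx_tower // tsum_nilp ?c2 ?coefmx_block_nilp ?IH // ltnW.
Qed.

(** The [2 ^ b]-th power of a tensor sum is the tensor sum of the powers, and
    alternating sums are multiplicative on tensor sums. *)
Lemma altsum_tower r b : (r <= t)%N -> (b < e)%N ->
  altsum (2 ^ (e - b)) (coefmx (@tower_box r) (tower_sum r) ^+ (2 ^ b)) =
  \prod_(0 <= i < r)
    altsum (2 ^ (e - b)) (coefmx b3 (mps_of_poly (quartic_poly (alphaN alpha i))) ^+ (2 ^ b)).
Proof.
move=> + be; have eb : (2 ^ b * 2 ^ (e - b) = q)%N by rewrite -expnD subnKC // ltnW.
elim: r => [|r IH] rt.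
  have -> : coefmx (@tower_box 0) (tower_sum 0) = 0.
    by apply/matrixP => i j; rewrite !mxE /tower_sum big_geq // mps0E if_same.
  rewrite big_geq // expr0n expn_eq0 /=.
  transitivity (altsum (2 ^ (e - b)) (jblock k 1)); last by rewrite altsum_jblock // expn_gt0.
  by congr (altsum _ _); apply/matrixP => i j; rewrite !mxE !ord1.
rewrite big_nat_recr //= -IH ?(ltnW rt) // coefmx_tower // tsum_frob2 ?c2 //.
rewrite altsum_tsum ?c2 // -exprM eb; first by apply: coefmx_tower_nilp; apply: ltnW.
exact: coefmx_block_nilp.
Qed.

Local Notation u := (inord (3 * t) : 'I_N).
Local Notation v := (inord (3 * t).+1 : 'I_N).

Definition uv_box : 'I_(q * q) -> 'X_{1..N} :=
  box_prod (fun a : 'I_q => U_(u) *+ a)%MM (fun a : 'I_q => U_(v) *+ a)%MM.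

Let valu : u = (3 * t)%N :> nat. Proof. by rewrite inordK. Qed.
Let valv : v = (3 * t).+1 :> nat. Proof. by rewrite inordK. Qed.

Lemma box_in_var (i : 'I_N) : box_in q (pred1 i) (fun a : 'I_q => U_(i) *+ a)%MM.
Proof.
split=> [a a' /mnmP/(_ i)|m].
  by rewrite !mulmnE !mnm1E eqxx !mul1n => /ord_inj.
split=> [[sm lt]|[a <-]].
  exists (Ordinal (lt i)); apply/mnmP => j; rewrite mulmnE mnm1E /=.
  by case: eqP => [->|/eqP ne]; rewrite ?mul1n // mul0n sm //= eq_sym.
split=> j /=; rewrite mulmnE mnm1E; first by rewrite eq_sym => /negPf ->.
by case: eqP => _; rewrite ?mul1n // ?mul0n ?expn_gt0.
Qed.

Lemma uv_box_in : box_in q (pred2 u v) uv_box.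
Proof.
apply: box_in_prod (box_in_var _) (box_in_var _) => //= i /eqP ->.
by apply/eqP => /(congr1 (@nat_of_ord _)); rewrite valu valv; lia.
Qed.

Definition hyp_box : 'I_(q * q * tower_dim t) -> 'X_{1..N} := box_prod uv_box (@tower_box t).

Let uvE i : pred2 u v i = (3 * t <= i)%N.
Proof.
rewrite /= -!(inj_eq (@ord_inj _)) valu valv; have := ltn_ord i; lia.
Qed.

Lemma hyp_box_basis : box_basis q hyp_box.
Proof.
apply: (@box_in_full _ _ _ _ predT) => //.
apply: box_in_prod uv_box_in (tower_box_in (leqnn t)) => i; rewrite uvE /below; first by rewrite ltnNge => ->.
by rewrite ltnNge orbN.
Qed.

(** On [k[u, v]/(u^q, v^q)] the product [u v] acts as a Kronecker product of two
    Jordan blocks of size [q]. *)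
Lemma coefmx_uv : coefmx uv_box (var (3 * t)%N * var (3 * t).+1) = jblock k q *t jblock k q.
Proof.
apply/matrixP => i j; case: (mxtens_indexP i) => a c; case: (mxtens_indexP j) => a' c'.
rewrite tensmxE !mxE -mpsXD mpsXE /uv_box /box_prod !mxtens_indexK /= -natrM mulnb.
have nuv : (u == v) = false by rewrite -(inj_eq (@ord_inj _)) valu valv; lia.
have nvu : (v == u) = false by rewrite eq_sym.
have [/andP[/eqP ea /eqP ec]|ne] := boolP ((a' == a.+1 :> nat) && (c' == c.+1 :> nat)).
  rewrite ea ec; set x := (_ + _)%MM; set y := (_ + _)%MM.
  have -> : y = (U_(u) + U_(v) + x)%MM.
    by apply/mnmP => l; rewrite /x /y !mnmDE !mulmnE !mulnS; lia.
  by rewrite lem_addl addmK eqxx.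
case: ifP => // /submK le; case: eqP => // eq; case/negP: ne; rewrite eq in le.
move: le => /mnmP le; have := le u; have := le v.
rewrite !mnmDE !mulmnE !mnm1E !eqxx nuv nvu; lia.
Qed.

Lemma hyp_eqE : hyp_eq alpha = var (3 * t)%N * var (3 * t).+1 + tower_sum t.
Proof.
rewrite /hyp_eq /tower_sum big_mkord; congr (_ + _); apply: eq_bigr => i _.
by rewrite /block_quartic /alphaN valK.
Qed.

Lemma coefmx_hyp :
  coefmx hyp_box (hyp_eq alpha) =
  tsum (jblock k q *t jblock k q) (coefmx (@tower_box t) (tower_sum t)).
Proof.
rewrite hyp_eqE coefmxD /tsum -coefmx_uv.
have IJ i : pred2 u v i -> ~~ below t i by rewrite uvE /below; lia.
have B1 := uv_box_in; have B2 := tower_box_in (leqnn t).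
congr (_ + _).
  apply: (coefmx_prodl IJ (proj1 B2)) => [d|d|m].
  - exact: box_in_supp B1.
  - exact: box_in_supp B2.
  rewrite -mpsXD mpsXE; case: (m =P _) => [-> _|_]; last by rewrite eqxx.
  move=> i; rewrite /= negb_or mnmDE !mnm1E => /andP[h1 h2].
  by rewrite eq_sym (negPf h1) eq_sym (negPf h2).
apply: (coefmx_prodr IJ (proj1 B1)) => [d|d|].
- exact: box_in_supp B1.
- exact: box_in_supp B2.
- exact: tower_sum_supp.
Qed.

(** The ranks are the squares [(q - l)^2]. *)
Lemma rkdrop_uv l : (l < q)%N ->
  rkdrop (jblock k q *t jblock k q) l = 2 * (q%:Z - l%:Z) - 1.
Proof.
move=> lq; rewrite /rkdrop !tensmxX !rank_tensmx !rank_jblockX.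
have -> : (q - l = (q - l.+1).+1)%N by lia.
have -> : q%:Z - l%:Z = ((q - l.+1).+1)%:Z by lia.
by rewrite !PoszM; lia.
Qed.

Lemma uv_nilp : (jblock k q *t jblock k q) ^+ q = 0.
Proof. by rewrite tensmxX jblock_nilp // tens0mx. Qed.

(** The deviation of both colengths from [q ^ (3 t + 1)]. *)
Definition correction : int := \sum_(b < e) (2 ^ b)%N%:Z *
   \prod_(0 <= i < t)
    altsum (2 ^ (e - b)) (coefmx b3 (mps_of_poly (quartic_poly (alphaN alpha i))) ^+ (2 ^ b)).

Local Notation Gam := (coefmx (@tower_box t) (tower_sum t)).

Lemma sum_rkdrop : \sum_(l < q) rkdrop Gam l = (tower_dim t)%:Z.
Proof.
rewrite -(big_mkord xpredT (rkdrop Gam)).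
rewrite (telescope_sumr_eq (fun l => - (\rank (Gam ^+ l))%:Z)) //.
  by rewrite coefmx_tower_nilp // mxrank0 expr0 mxrank1 opprK oppr0 add0r.
by move=> l _; rewrite opprK addrC.
Qed.

(** The binary expansion of the odd weights [2 (q - l) - 1] turns the sum into
    alternating sums of the powers [2 ^ b]. *)
Lemma sum_weighted :
  \sum_(l < q) (2 * (q%:Z - l%:Z) - 1) * rkdrop Gam l = q%:Z * (tower_dim t)%:Z + correction.
Proof.
under eq_bigr => l _ do rewrite (sign_expansion (ltn_ord l)) mulrDl mulr_suml.
rewrite big_split /= -mulr_sumr sum_rkdrop exchange_big /=; congr (_ + _).
apply: eq_bigr => b _; rewrite -altsum_tower // -altsum_frob ?(ltnW (ltn_ord b)) //.
by rewrite mulr_sumr; apply: eq_bigr => l _; rewrite mulrA.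
Qed.

Lemma corank_hyp :
  (q * q * tower_dim t)%N%:Z - (\rank (coefmx hyp_box (hyp_eq alpha)))%:Z =
  q%:Z * (tower_dim t)%:Z + correction.
Proof.
rewrite coefmx_hyp (corank_tsum c2 uv_nilp (coefmx_tower_nilp (leqnn t))) -sum_weighted.
by apply: eq_bigr => l _; rewrite rkdrop_uv.
Qed.

Lemma rank_hyp_pred :
  (\rank (coefmx hyp_box (hyp_eq alpha) ^+ q.-1))%:Z =
  q%:Z * (tower_dim t)%:Z - correction.
Proof.
rewrite coefmx_hyp (rank_tsum_pred c2 uv_nilp (coefmx_tower_nilp (leqnn t))).
have q0 : (0 < q)%N by rewrite expn_gt0.
transitivity (\sum_(l < q) (2 * q%:Z * rkdrop Gam l - (2 * (q%:Z - l%:Z) - 1) * rkdrop Gam l)).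
  apply: eq_bigr => l _; rewrite rkdrop_uv; last by have := ltn_ord l; lia.
  rewrite -mulrBl; congr (_ * _); have := ltn_ord l; lia.
by rewrite sumrB -mulr_sumr sum_rkdrop sum_weighted; ring.
Qed.

End Tower.

(** * Local structure of a hypersurface ring *)

Section Hypersurface.
Context (n : nat) (k : closedFieldType) (R : comNzRingType).
Local Notation S := (mpseries n k).
Context (F : S) (pi : {rmorphism S -> R}).
Hypothesis F0 : F 0%MM = 0.
Hypothesis pi_surj : forall x, exists s, pi s = x.
Hypothesis pi_ker : forall s, pi s = 0 <-> exists h, s = h * F.

Definition max_ideal : set R := pi @` [set s : S | s 0%MM = 0].

Lemma pi_eq s s' : pi s = pi s' -> exists h, s = s' + h * F.
Proof.
move=> e; have /pi_ker[h eh] : pi (s - s') = 0 by rewrite rmorphB e subrr.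
by exists h; rewrite -eh addrC subrK.
Qed.

Lemma pi_eq0E s s' : pi s = pi s' -> s 0%MM = s' 0%MM.
Proof. by move=> /pi_eq[h ->]; rewrite mpsDE mps_mul0E F0 mulr0 addr0. Qed.

Lemma max_ideal_ideal : is_ideal max_ideal.
Proof.
split=> [|x y [s s0 <-] [s' s0' <-]|a x [s s0 <-]].
- by exists 0; rewrite ?rmorph0.
- by exists (s + s'); rewrite ?rmorphD //= mpsDE s0 s0' addr0.
- have [a' <-] := pi_surj a; exists (a' * s); rewrite ?rmorphM //=.
  by rewrite mps_mul0E s0 mulr0.
Qed.

Lemma ideal_setT (J : set R) x : is_ideal J -> J x -> ~ max_ideal x -> J = setT.
Proof.
move=> [J0 JD JM] Jx nx; have [s es] := pi_surj x.
have s0 : s 0%MM != 0 by apply/negP => /eqP s0; apply: nx; exists s.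
have [g gs] := mps_inv s0.
have J1 : J 1 by rewrite -(rmorph1 pi) -gs rmorphM es; apply: JM.
by apply/seteqP; split=> // y _; rewrite -(mulr1 y); apply: JM.
Qed.

(** Series with nonzero constant term are invertible, and [F] has none. *)
Lemma hypersurface_local : is_local_ring max_ideal.
Proof.
have n1 : ~ max_ideal 1.
  move=> [s s0]; rewrite -(rmorph1 pi) => /pi_eq0E; rewrite s0 mps1E eqxx => /eqP.
  by rewrite eq_sym oner_eq0.
split.
  split=> // [|J Jid mJ]; first exact: max_ideal_ideal.
  have [sub|nsub] := pselect (J `<=` max_ideal); first by left; apply/seteqP.
  right; have [x Jx nx] : exists2 x, J x & ~ max_ideal x.
    apply: contrapT => no; apply: nsub => x Jx.
    by apply: contrapT => nx; apply: no; exists x.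
  exact: ideal_setT Jid Jx nx.
move=> m' [m'id m'1 m'max].
have sub : m' `<=` max_ideal.
  move=> x m'x; apply: contrapT => nx; apply: m'1.
  by rewrite (ideal_setT m'id m'x nx).
have [->|eT] := m'max _ max_ideal_ideal sub; first by [].
by case: n1; rewrite eT.
Qed.

Context (c2 : 2%N \in [pchar k]) (e : nat).
Local Notation q := (2 ^ e)%N.
Context (D : nat) (b : 'I_D -> 'X_{1..n}).
Hypothesis bb : box_basis q b.

Lemma row_pre_coefmx_ideal : is_ideal (row_pre (@coefrow n k _ b) (coefmx b F)).
Proof.
split=> [|s s'|a s]; rewrite /row_pre /= ?linear0 ?sub0mx //.
  by rewrite linearD => h h'; rewrite addmx_sub.
move=> /submxP[u eu]; rewrite (coefrowM bb) eu -mulmxA -(coefmxM bb) mulrC.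
by rewrite (coefmxM bb) mulmxA submxMl.
Qed.

Lemma row_pre_mulF h : row_pre (@coefrow n k _ b) (coefmx b F) (h * F).
Proof. by rewrite /row_pre /= mulrC (coefrowM bb) submxMl. Qed.

Lemma box_ideal_row_pre (B : 'M_D) s : box_ideal q s -> row_pre (@coefrow n k _ b) B s.
Proof. by move=> /(coefrow_eq0 bb) e0; rewrite /row_pre /= e0 sub0mx. Qed.

Lemma frob_power_row_pre s :
  frob_power max_ideal q (pi s) <-> row_pre (@coefrow n k _ b) (coefmx b F) s.
Proof.
have [P0 PD PM] := row_pre_coefmx_ideal.
have liftP s1 s2 : pi s1 = pi s2 -> row_pre (@coefrow n k _ b) (coefmx b F) s1 ->
    row_pre (@coefrow n k _ b) (coefmx b F) s2.
  by move=> /esym/pi_eq[h ->] h1; apply: (PD) => //; apply: row_pre_mulF.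
split.
  pose J : set R := pi @` row_pre (@coefrow n k _ b) (coefmx b F).
  have JP s' : J (pi s') -> row_pre (@coefrow n k _ b) (coefmx b F) s'.
    by move=> [s1 h1 e1]; apply: liftP e1 h1.
  move=> h; apply: JP; move: (pi s) h; apply: ideal_genP.
    split=> [|_ _ [s1 h1 <-] [s2 h2 <-]|a _ [s1 h1 <-]].
    - by exists 0; rewrite ?rmorph0.
    - by exists (s1 + s2); rewrite ?rmorphD //; apply: (PD).
    - by have [a' <-] := pi_surj a; exists (a' * s1); rewrite ?rmorphM //; apply: (PM).
  move=> _ [_ [s1 s10 <-] <-]; exists (s1 ^+ q); last exact: rmorphXn.
  exact/box_ideal_row_pre/box_ideal_frob.
move=> /submxP[u eu]; have [r er] := coefrow_surj bb u.
have K : box_ideal q (s - r * F).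
  by apply/(coefrow_eq0 bb); rewrite linearB /= mulrC (coefrowM bb) er eu subrr.
have -> : pi s = pi (s - r * F).
  have /pi_ker z : exists h, r * F = h * F by exists r.
  by rewrite rmorphB z subr0.
have Gid := ideal_gen_ideal [set x ^+ q | x in max_ideal].
apply: (@box_ideal_gen _ _ q (pi @^-1` frob_power max_ideal q)) K; first exact: (ideal_preim pi Gid).
move=> i; rewrite /preimage /= rmorphXn; apply: sub_ideal_gen.
exists (pi (mps_var k i)) => //; exists (mps_var k i) => //=.
by rewrite /mps_var eq_sym mnm1_eq0.
Qed.

(** Modulo the [q]-th powers of the variables the ideal [(F)] becomes the row
    space of the matrix of [F]. *)
Lemma hypersurface_HK_length :
  is_length (frob_power max_ideal q) (D - \rank (coefmx b F)).
Proof.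
apply: (is_length_row_pre pi_surj (coefrow_surj bb) (coefrow_nilp k bb)).
  exact: row_pre_coefmx_ideal.
exact: frob_power_row_pre.
Qed.

(** The colon ideal of [(x_1^q, ..., x_n^q)] by [F ^ (q - 1)]. *)
Lemma row_pre_colon r :
  row_pre (@coefrow n k _ b) (kermx (coefmx b F ^+ q.-1)) r <-> box_ideal q (F ^+ q.-1 * r).
Proof.
rewrite -(coefrow_eq0 bb) (coefrowM bb) (coefmxX bb) /row_pre /= sub_kermx.
by split=> /eqP.
Qed.

Lemma colon_ideal : is_ideal (row_pre (@coefrow n k _ b) (kermx (coefmx b F ^+ q.-1))).
Proof.
have [K0 KD KM] := box_ideal_ideal n k q.
split=> [|s s'|a s]; rewrite !row_pre_colon ?mulr0 ?mulrDr //.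
  exact: KD.
by rewrite mulrCA; apply: KM.
Qed.

End Hypersurface.

(** * Coordinates over the ring of [q]-th powers *)

Section FrobeniusRoot.
Context (n : nat) (k : closedFieldType) (c2 : 2%N \in [pchar k]) (e : nat).
Local Notation S := (mpseries n k).
Local Notation q := (2 ^ e)%N.

Let q_gt0 : (0 < q)%N. Proof. by rewrite expn_gt0. Qed.

Lemma frob_root_ex (x : k) : exists y, y ^+ q = x.
Proof.
have [y ey] := @solve_monicpoly k q (fun i => if i == 0%N then x else 0) q_gt0.
exists y; rewrite ey -(prednK q_gt0) big_ord_recl big1 ?addr0 ?mulr1 // => i _.
exact: mul0r.
Qed.

Definition qroot (x : k) : k := sval (cid (frob_root_ex x)).

Lemma qrootK x : qroot x ^+ q = x.
Proof. exact: svalP (cid (frob_root_ex x)). Qed.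

Lemma frobD (A : comNzRingType) (cA : 2%N \in [pchar A]) (x y : A) :
  (x + y) ^+ q = x ^+ q + y ^+ q.
Proof. by apply: exprDn_pchar; rewrite pnatX (pnatE _ (pcharf_prime cA)) cA. Qed.

Lemma frob_inj (x y : k) : x ^+ q = y ^+ q -> x = y.
Proof.
move=> exy; have : (x - y) ^+ q = 0.
  by rewrite oppr_pchar2 // frobD // exy addrr_pchar2.
by move/eqP; rewrite expf_eq0 => /andP[_ /eqP/subr0_eq].
Qed.

Lemma qrootX x : qroot (x ^+ q) = x.
Proof. by apply: frob_inj; rewrite qrootK. Qed.

Lemma qrootD x y : qroot (x + y) = qroot x + qroot y.
Proof. by apply: frob_inj; rewrite frobD // !qrootK. Qed.

Lemma qrootM x y : qroot (x * y) = qroot x * qroot y.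
Proof. by apply: frob_inj; rewrite exprMn !qrootK. Qed.

Lemma qroot0 : qroot 0 = 0.
Proof. by apply: frob_inj; rewrite qrootK expr0n gtn_eqF. Qed.

Lemma qroot_sum (I : Type) (r : seq I) (P : pred I) (G : I -> k) :
  qroot (\sum_(i <- r | P i) G i) = \sum_(i <- r | P i) qroot (G i).
Proof. exact: (big_morph qroot qrootD qroot0). Qed.

(** The [q]-th roots of the coordinates of [s] in the basis of monomials with exponents [< q] over
    the subring of [q]-th powers. *)
Definition qcomp (a : 'X_{1..n}) (s : S) : S := fun m => qroot (s (m *+ q + a)%MM).

Lemma qcompD a s s' : qcomp a (s + s') = qcomp a s + qcomp a s'.
Proof. by apply/mps_eqP => m; rewrite mpsDE /qcomp mpsDE qrootD. Qed.

Lemma qcomp0 a : qcomp a 0 = 0.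
Proof. by apply/mps_eqP => m; rewrite /qcomp !mps0E qroot0. Qed.

Lemma qcomp_sum a (I : finType) (G : I -> S) :
  qcomp a (\sum_i G i) = \sum_i qcomp a (G i).
Proof. exact: (big_morph _ (qcompD a) (qcomp0 a)). Qed.

Lemma mnm_mul_addB (c m a : 'X_{1..n}) :
  ((m *+ q + a) - c *+ q = (m - c) *+ q + a)%MM \/ ~~ (c <= m)%MM.
Proof.
have [/mnm_lepP le|] := boolP (c <= m)%MM; [left|by right].
apply/mnmP => i; rewrite mnmBE !mnmDE !mulmnE mnmBE mulnBl.
by have := le i; rewrite -(leq_pmul2r q_gt0); lia.
Qed.

Lemma mnm_mul_le (c m a : 'X_{1..n}) : (forall i, (a i < q)%N) ->
  (c *+ q <= m *+ q + a)%MM = (c <= m)%MM.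
Proof.
move=> la; apply/mnm_lepP/mnm_lepP => h i; have := h i; rewrite mnmDE !mulmnE.
  move=> le; rewrite leqNgt; apply/negP => lt; move: le; rewrite leqNgt => /negP; apply.
  have : (m i * q + q <= c i * q)%N by rewrite addnC -mulSn leq_pmul2r.
  by have := la i; lia.
by move=> le; rewrite (leq_trans _ (leq_addr _ _)) // leq_pmul2r.
Qed.

Lemma qcompM (a : 'X_{1..n}) w s : (forall i, (a i < q)%N) -> qcomp a (w ^+ q * s) = w * qcomp a s.
Proof.
move=> la; apply/mps_eqP => m; rewrite /qcomp.
pose L := [seq (bmnm c) | c <- index_enum 'X_{1..n < (mdeg m).+1} & (bmnm c <= m)%MM].
have uL : uniq L.
  by rewrite map_inj_uniq ?filter_uniq ?index_enum_uniq //; apply: val_inj.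
have LE c : (c \in L) = (c <= m)%MM.
  apply/mapP/idP => [[d]|le]; first by rewrite mem_filter => /andP[+ _] ->.
  have lt : (mdeg c < (mdeg m).+1)%N.
    by rewrite ltnS !mdegE; apply: leq_sum => i _; move/mnm_lepP: le; apply.
  by exists (BMultinom lt); rewrite ?mem_filter ?mem_index_enum ?andbT.
rewrite (@mpsM_seq _ _ L w) // => [|c|c le _]; rewrite ?LE //.
rewrite (@mpsM_seq _ _ [seq (c *+ q)%MM | c <- L]).
- rewrite big_map qroot_sum !big_seq; apply: eq_bigr => c; rewrite LE => le.
  rewrite qrootM mps_frob_mul // qrootX; congr (_ * qroot (s _)).
  by case: (mnm_mul_addB c m a) => //; rewrite le.
- rewrite map_inj_uniq // => c d /mnmP h; apply/mnmP => i.
  by have /eqP := h i; rewrite !mulmnE eqn_pmul2r // => /eqP.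
- by move=> c /mapP[d]; rewrite LE => le ->; rewrite mnm_mul_le.
- move=> c le /(mps_frob_neq0 c2)[d ed _]; rewrite ed in le *.
  by apply: (map_f (fun c => (c *+ q)%MM)); rewrite LE -(mnm_mul_le _ _ la).
Qed.

Lemma qcomp_expand D (b : 'I_D -> 'X_{1..n}) (bb : box_basis q b) s :
  s = \sum_d mpsX k (b d) * qcomp (b d) s ^+ q.
Proof.
apply/mps_eqP => m; rewrite mps_sumE.
pose r := [multinom (m i %% q)%N | i < n]; pose c := [multinom (m i %/ q)%N | i < n].
have em : m = (c *+ q + r)%MM by apply/mnmP => i; rewrite mnmDE mulmnE !mnmE -divn_eq.
have rlt i : (r i < q)%N by rewrite mnmE ltn_mod.
have /(proj2 bb)[d ed] := rlt.
rewrite (bigD1 d) //= big1 ?addr0 => [|d' ne].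
  by rewrite ed {2}em addmC mpsXMD mps_frob_mul // /qcomp qrootK -em.
rewrite mpsXM; case: ifP => // le; apply/eqP; apply: contraTT ne => nz.
have [c' ec _] := mps_frob_neq0 c2 nz; rewrite negbK; apply/eqP/(proj1 bb).
have blt i : (b d' i < q)%N by move: i; apply/(proj2 bb); exists d'.
apply/mnmP => i; rewrite ed -(modn_small (blt i)).
have em' : m = (c' *+ q + b d')%MM by rewrite -ec submK.
by rewrite mnmE {1}em' mnmDE mulmnE modnMDl.
Qed.

Lemma qcomp_eq0 (a : 'X_{1..n}) s : (forall i, (a i < q)%N) -> box_ideal q s -> qcomp a s 0%MM = 0.
Proof.
move=> la K; rewrite /qcomp.
have -> : (0 *+ q + a)%MM = a by apply/mnmP => i; rewrite mnmDE mulmnE mnm0E mul0n.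
by rewrite K // qroot0.
Qed.

End FrobeniusRoot.

(** * The splitting criterion of Fedder *)

Section Fedder.
Context (n : nat) (k : closedFieldType) (R : comNzRingType).
Local Notation S := (mpseries n k).
Context (F : S) (pi : {rmorphism S -> R}).
Hypothesis F0 : F 0%MM = 0.
Hypothesis F_neq0 : F != 0.
Hypothesis pi_surj : forall x, exists s, pi s = x.
Hypothesis pi_ker : forall s, pi s = 0 <-> exists h, s = h * F.
Context (c2 : 2%N \in [pchar k]) (chR : 2%N \in [pchar R]) (e : nat).
Local Notation q := (2 ^ e)%N.
Context (D : nat) (b : 'I_D -> 'X_{1..n}).
Hypothesis bb : box_basis q b.
Local Notation comp := (qcomp (k := k) e).
Local Notation Q := (frob_root chR e).

Let q_gt0 : (0 < q)%N. Proof. by rewrite expn_gt0. Qed.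
Let b_lt d i : (b d i < q)%N. Proof. by move: i; apply/(proj2 bb); exists d. Qed.

Lemma mps_mulIf (f g : S) : f * F = g * F -> f = g.
Proof.
move=> fg; apply/subr0_eq; have : (f - g) * F = 0 by rewrite mulrBl fg subrr.
by case/mps_mulf_eq0 => // z; move: F_neq0; rewrite z eqxx.
Qed.

Let lift (x : R) : S := sval (cid (pi_surj x)).
Let liftK x : pi (lift x) = x. Proof. exact: svalP (cid (pi_surj x)). Qed.

Lemma Fqpred : F ^+ q.-1 * F = F ^+ q.
Proof. by rewrite -exprSr prednK. Qed.

(** A coefficient of [F^(q-1) r] at a monomial [b_d] with exponents below [q]
    is nonzero, so [T s], the [b_d]-coordinate of [F^(q-1) s], is a unit at
    [s = r]. It is linear over the [q]-th powers and maps [(F)] into itself,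
    hence after scaling it descends to a splitting. *)
Lemma splits_of_notin r : ~ box_ideal q (F ^+ q.-1 * r) -> root_map_splits chR e (pi r).
Proof.
move=> nK; have [d nz] : exists d, (F ^+ q.-1 * r : S) (b d) != 0.
  apply: contrapT => no; apply: nK => m /(proj2 bb)[d <-].
  by apply/eqP; apply: contrapT => /negP nz; apply: no; exists d.
pose T s := comp (b d) (F ^+ q.-1 * s).
have [w wT] : exists w, w * T r = 1.
  apply: mps_inv; rewrite /T /qcomp.
  have -> : (0 *+ q + b d)%MM = b d by apply/mnmP => i; rewrite mnmDE mulmnE mnm0E mul0n.
  apply/eqP => z; case/eqP: nz; rewrite -[LHS](qrootK e) z expr0n.
  by rewrite gtn_eqF.
have TD s s' : T (s + s') = T s + T s' by rewrite /T mulrDr qcompD.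
have TM a s : T (a ^+ q * s) = a * T s.
  by rewrite /T mulrCA qcompM.
have TF h : T (h * F) = comp (b d) h * F.
  by rewrite /T mulrCA Fqpred mulrC qcompM // mulrC.
pose psi (x : Q) : R^o := pi (w * T (lift x)).
have psiE s : psi (pi s) = pi (w * T s).
  rewrite /psi; have [h ->] := pi_eq pi_ker (liftK (pi s)).
  rewrite TD TF mulrDr rmorphD [X in _ + X](_ : _ = 0) ?addr0 //.
  by apply/pi_ker; exists (w * comp (b d) h); rewrite mulrA.
have psi_lin : linear psi.
  move=> a x y.
  have -> : a *: x + y = pi (lift a ^+ q * lift x + lift y) :> Q.
    by rewrite rmorphD rmorphM rmorphXn !liftK.
  rewrite psiE TD TM mulrDr rmorphD /psi; congr (_ + _).
  by rewrite mulrCA rmorphM liftK.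
pose psiL := HB.pack_for {linear Q -> R^o} psi (GRing.isLinear.Build _ _ _ _ psi psi_lin).
exists psiL => a; rewrite linearZ /= [psi _]psiE wT rmorph1.
exact: mulr1.
Qed.

(** Every map [R^(1/q) -> R] is induced by a map of [S], which is
    [s |-> comp top (H * s)] for some series [H], because the coordinate at the
    top monomial generates all such maps. Compatibility with [F] forces
    [H] to be a multiple of [F^(q-1)]. If [F^(q-1) r] were in the ideal of [q]-th
    powers, the value 1 of the splitting would lie in the maximal ideal. *)
Lemma notin_of_splits r : root_map_splits chR e (pi r) -> ~ box_ideal q (F ^+ q.-1 * r).
Proof.
move=> [psi psi1] K.
pose top : 'X_{1..n} := [multinom q.-1 | i < n].
have top_lt i : (top i < q)%N by rewrite mnmE prednK.
have b_top d : (b d <= top)%MM.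
  by apply/mnm_lepP => i; rewrite mnmE -ltnS prednK.
pose h d := lift (psi (pi (mpsX k (b d)) : Q)).
have psiE s : psi (pi s : Q) = pi (\sum_d comp (b d) s * h d).
  rewrite {1}(qcomp_expand c2 bb s) !rmorph_sum linear_sum /=; apply: eq_bigr => d _.
  rewrite mulrC !rmorphM liftK -[RHS]/(pi (comp (b d) s) *: psi (pi (mpsX k (b d)) : Q)).
  by rewrite -linearZ; congr (psi _); rewrite rmorphXn.
have compX d s : comp top (mpsX k (top - b d)%MM * s) = comp (b d) s.
  apply/mps_eqP => m; rewrite /qcomp; congr qroot.
  have -> : (m *+ q + top = (top - b d) + (m *+ q + b d))%MM.
    by rewrite addmC -{1}(submK (b_top d)) -!addmA; congr (_ + _)%MM; rewrite addmC.
  exact: mpsXMD.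
pose H : S := \sum_d mpsX k (top - b d)%MM * h d ^+ q.
have compH s : comp top (H * s) = \sum_d comp (b d) s * h d.
  rewrite /H mulr_suml (qcomp_sum c2).
  apply: eq_bigr => d _.
  by rewrite mulrAC mulrC qcompM // compX mulrC.
have [W eW] : exists W, H = W * F ^+ q.-1.
  have ex d : exists w, comp (b d) (H * F) = w * F.
    have : psi (pi (F * mpsX k (top - b d)%MM) : Q) = 0.
      have /pi_ker z : exists h, F * mpsX k (top - b d)%MM = h * F.
        by exists (mpsX k (top - b d)%MM); rewrite mulrC.
      by rewrite z; apply: (linear0 psi).
    rewrite psiE => /pi_ker[w]; rewrite -compH mulrA mulrC compX => ->.
    by exists w.
  have [w ew] : exists w : 'I_D -> S, forall d, comp (b d) (H * F) = w d * F.
    by exists (fun d => sval (cid (ex d))) => d; apply: svalP (cid (ex d)).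
  exists (\sum_d mpsX k (b d) * w d ^+ q); apply: mps_mulIf.
  rewrite -mulrA Fqpred [LHS](qcomp_expand c2 bb) mulr_suml; apply: eq_bigr => d _.
  by rewrite ew exprMn mulrA.
have e1 : pi (comp top (H * r)) = 1.
  rewrite compH -psiE -[1](psi1 1) scale1r //.
have [_ _ KM] := box_ideal_ideal n k q.
have z : comp top (H * r) 0%MM = 0.
  by apply: qcomp_eq0 => //; rewrite eW -mulrA; apply: KM.
have := pi_eq0E F0 pi_ker (etrans e1 (esym (rmorph1 pi))).
by rewrite z mps1E eqxx => /eqP; rewrite eq_sym oner_eq0.
Qed.

Lemma nonsplit_row_pre r :
  nonsplit_ideal chR e (pi r) <-> row_pre (@coefrow n k _ b) (kermx (coefmx b F ^+ q.-1)) r.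
Proof.
rewrite row_pre_colon //; split=> [ns|K].
  by apply: contrapT => nK; apply: ns; apply: splits_of_notin.
by move=> /notin_of_splits.
Qed.

(** The nonsplit ideal is the colon ideal of the [q]-th powers of the variables
    by [F^(q-1)], whose colength is the rank of multiplication by [F^(q-1)]. *)
Lemma hypersurface_nonsplit_length :
  is_length (nonsplit_ideal chR e) (\rank (coefmx b F ^+ q.-1)).
Proof.
have -> : \rank (coefmx b F ^+ q.-1) = (D - \rank (kermx (coefmx b F ^+ q.-1)))%N.
  by rewrite mxrank_ker subKn // rank_leq_row.
apply: (is_length_row_pre pi_surj (coefrow_surj bb) (coefrow_nilp k bb)).
  exact: colon_ideal.
exact: nonsplit_row_pre.
Qed.

End Fedder.

(** * Substitution of power series *)

Section OrderOfVanishing.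
Context (n : nat) (A : comNzRingType).
Local Notation S := (mpseries n A).

Definition ordge (d : nat) (f : S) : Prop := forall m, (mdeg m < d)%N -> f m = 0.

Lemma ordge_le d d' f : (d <= d')%N -> ordge d' f -> ordge d f.
Proof. by move=> le h m lt; apply: h; apply: leq_trans le. Qed.

Lemma ordge_sum (I : Type) (r : seq I) (P : pred I) (G : I -> S) d :
  (forall i, P i -> ordge d (G i)) -> ordge d (\sum_(i <- r | P i) G i).
Proof. by move=> h m lt; rewrite mps_sumE big1 // => i Pi; apply: h. Qed.

Lemma ordgeM d d' f g : ordge d f -> ordge d' g -> ordge (d + d') (f * g).
Proof.
move=> of' og m lt; rewrite mpsME big1 // => a le.
have e : mdeg m = (mdeg (m - a) + mdeg a)%N by rewrite -mdegD submK.
have [lta|gea] := ltnP (mdeg a) d; first by rewrite of' ?mul0r.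
rewrite [g _]og ?mulr0 //; move: lt e gea.
by move: (mdeg m) (mdeg (m - a)) (mdeg a) => x y z; lia.
Qed.

Lemma ordgeZ d c f : ordge d f -> ordge d (c *: f).
Proof. by move=> h m lt; rewrite mpsZE h ?mulr0. Qed.

Lemma ordgeX d f l : ordge d f -> ordge (d * l) (f ^+ l).
Proof.
move=> h; elim: l => [|l IH]; first by rewrite muln0.
by rewrite mulnS exprS; apply: ordgeM.
Qed.

End OrderOfVanishing.

Section Substitution.
Context (n n' : nat) (A : comNzRingType).
Local Notation S := (mpseries n A).
Local Notation S' := (mpseries n' A).
Context (h : 'I_n -> S').

Definition poly_subst (p : {mpoly A[n]}) : S' := mmap (GRing.in_alg S') h p.

(** If the substituted series have no constant term, monomials of large degree
    do not contribute to a given coefficient, so truncating [s] loses nothing. *)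
Definition subst (s : S) : S' := fun m => poly_subst (mps_trunc (mdeg m).+1 s) m.

Hypothesis h0 : forall i, h i 0%MM = 0.

Lemma mmap1_ordge a : ordge (mdeg a) (mmap1 h a).
Proof.
rewrite mdegE /mmap1; elim/big_ind2: _ => [|d f d' g|i _] //; first exact: ordgeM.
rewrite -[X in ordge X]mul1n; apply: ordgeX => m.
by rewrite ltnS leqn0 mdeg_eq0 => /eqP ->.
Qed.

Lemma poly_substE p : poly_subst p = \sum_(a <- msupp p) p@_a *: mmap1 h a.
Proof. by apply: eq_bigr => a _; rewrite mulr_algl. Qed.

Lemma poly_subst_ordge d p : (forall a, (mdeg a < d)%N -> p@_a = 0) -> ordge d (poly_subst p).
Proof.
move=> p0; rewrite poly_substE; apply: ordge_sum => a _.
have [lt|ge] := ltnP (mdeg a) d; first by rewrite p0 // => m _; rewrite mpsZE mul0r.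
exact/ordgeZ/(ordge_le ge)/mmap1_ordge.
Qed.

Lemma poly_subst_low d p p' : (forall a, (mdeg a < d)%N -> p@_a = p'@_a) ->
  forall m, (mdeg m < d)%N -> poly_subst p m = poly_subst p' m.
Proof.
move=> pp m lt; apply/subr0_eq.
have : ordge d (poly_subst (p - p')).
  by apply: poly_subst_ordge => a la; rewrite mcoeffB pp ?subrr.
by move/(_ m lt); rewrite /poly_subst mmapB.
Qed.

Lemma substE d s m : (mdeg m < d)%N -> subst s m = poly_subst (mps_trunc d s) m.
Proof.
move=> lt; apply: (poly_subst_low _ (ltnSn _)) => a la.
by rewrite !mcoeff_trunc //; apply: leq_trans lt.
Qed.

Lemma subst_sumE s m : subst s m =
  \sum_(a : 'X_{1..n < (mdeg m).+1}) s a * mmap1 h a m.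
Proof.
rewrite /subst /mps_trunc /poly_subst raddf_sum mps_sumE; apply: eq_bigr => a _.
by rewrite /= mmapZ mmapX /= mulr_algl.
Qed.

Lemma subst_poly p : subst (mps_of_poly p) = poly_subst p.
Proof.
apply/mps_eqP => m; apply: (poly_subst_low _ (ltnSn _)) => a la.
by rewrite trunc_of_poly.
Qed.

Lemma subst_zmod : zmod_morphism subst.
Proof.
move=> s s'; apply/mps_eqP => m; rewrite mpsDE mpsNE !subst_sumE -sumrB.
by apply: eq_bigr => a _; rewrite mpsDE mpsNE mulrBl.
Qed.

Lemma subst_monoid : monoid_morphism subst.
Proof.
split=> [|s s'].
  have -> : (1 : S) = mps_of_poly 1 by rewrite rmorph1.
  by rewrite subst_poly /poly_subst rmorph1.
apply/mps_eqP => m; rewrite (substE _ (ltnSn _)).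
transitivity (poly_subst (mps_trunc (mdeg m).+1 s * mps_trunc (mdeg m).+1 s') m).
  apply: (poly_subst_low _ (ltnSn _)) => a la.
  by rewrite mcoeff_trunc // (mpsM_trunc _ _ la).
rewrite /poly_subst rmorphM; symmetry.
by apply: (mpsM_low _ _ (ltnSn _)) => a la; rewrite (substE _ la).
Qed.

Lemma substZ c s : subst (c *: s) = c *: subst s.
Proof.
apply/mps_eqP => m; rewrite mpsZE !subst_sumE mulr_sumr.
by apply: eq_bigr => a _; rewrite mpsZE mulrA.
Qed.

Lemma subst_var i : subst (mps_var A i) = h i.
Proof. by rewrite mps_varE -mps_of_polyX subst_poly /poly_subst mmapX mmap1U. Qed.

Lemma subst_ordge d s : ordge d s -> ordge d (subst s).
Proof.
move=> os m lt; rewrite subst_sumE big1 // => a _.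
have [la|ga] := ltnP (mdeg a) d; first by rewrite os ?mul0r.
by rewrite mmap1_ordge ?mulr0 //; apply: leq_trans ga.
Qed.

Lemma subst0E s : subst s 0%MM = s 0%MM.
Proof.
have s1 : subst 1 = 1 by case: subst_monoid.
have := subst_zmod s (s 0%MM)%:A; rewrite substZ s1 => /mps_eqP/(_ 0%MM).
rewrite (subst_ordge (d := 1)) ?mdeg0 // => [|m].
  by rewrite mpsDE mpsNE mpsZE mps1E eqxx mulr1 => /esym/subr0_eq.
rewrite ltnS leqn0 mdeg_eq0 => /eqP ->.
by rewrite mpsDE mpsNE mpsZE mps1E eqxx mulr1 subrr.
Qed.

Definition subst_morph : {rmorphism S -> S'} :=
  HB.pack_for {rmorphism S -> S'} subst
    (GRing.isZmodMorphism.Build _ _ subst subst_zmod)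
    (GRing.isMonoidMorphism.Build _ _ subst subst_monoid).

Lemma subst_morphE s : subst_morph s = subst s. Proof. by []. Qed.

End Substitution.

(** Morphisms that do not lower the order of vanishing are determined by their
    values on polynomials. *)
Lemma eq_from_vars n n' (A : comNzRingType) (f g : {rmorphism mpseries n A -> mpseries n' A}) :
    (forall c s, f (c *: s) = c *: f s) -> (forall c s, g (c *: s) = c *: g s) ->
    (forall d s, ordge d s -> ordge d (f s)) -> (forall d s, ordge d s -> ordge d (g s)) ->
    (forall i, f (mps_var A i) = g (mps_var A i)) ->
  f =1 g.
Proof.
move=> fZ gZ fo go fg s; apply/mps_eqP => m; set d := (mdeg m).+1.
have monE a : f (mpsX A a) = g (mpsX A a).
  rewrite -mps_of_polyX mpolyXE_id !rmorph_prod; apply: eq_bigr => i _.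
  by rewrite !rmorphXn /= mps_of_polyX -mps_varE fg.
have polyE p : f (mps_of_poly p) = g (mps_of_poly p).
  rewrite [p]mpolyE !rmorph_sum /=; apply: eq_bigr => a _.
  have -> : mps_of_poly (p@_a *: 'X_[a]) = p@_a *: mpsX A a.
    by apply/mps_eqP => l; rewrite mpsZE /mps_of_poly mcoeffZ mcoeffX mpsXE eq_sym.
  by rewrite fZ gZ monE.
have osm : ordge d (s - mps_of_poly (mps_trunc d s)).
  by move=> a la; rewrite mpsDE mpsNE /mps_of_poly mcoeff_trunc // subrr.
rewrite -(subrK (mps_of_poly (mps_trunc d s)) s) (rmorphD f) (rmorphD g) !mpsDE polyE.
by rewrite (fo _ _ osm) ?(go _ _ osm) /d ?ltnSn.
Qed.

Lemma subst_comp n1 n2 n3 (A : comNzRingType) (h : 'I_n1 -> mpseries n2 A)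
    (g : 'I_n2 -> mpseries n3 A) s :
    (forall i, h i 0%MM = 0) -> (forall i, g i 0%MM = 0) ->
  subst g (subst h s) = subst (fun i => subst g (h i)) s.
Proof.
move=> h0 g0; have gh0 i : subst g (h i) 0%MM = 0 by rewrite subst0E.
rewrite -[LHS]/((subst_morph g0 \o subst_morph h0) s) -[RHS]/(subst_morph gh0 s).
apply: eq_from_vars => [c x|c x|d x ox|d x ox|i] /=.
- by rewrite !substZ.
- by rewrite substZ.
- by do 2! apply: subst_ordge => //.
- exact: subst_ordge.
- by rewrite !subst_var.
Qed.

Lemma subst_id n (A : comNzRingType) s : subst (fun i => mps_var A i : mpseries n A) s = s.
Proof.
have v0 i : (mps_var A i : mpseries n A) 0%MM = 0 by rewrite /mps_var eq_sym mnm1_eq0.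
rewrite -[LHS]/(subst_morph v0 s) -[RHS]/(idfun s).
apply: eq_from_vars => [c x|c x|d x ox|d x ox|i] //=.
- by rewrite substZ.
- exact: subst_ordge.
- by rewrite subst_var.
Qed.

(** * Weierstrass division *)

Lemma mps_var0E m (A : comNzRingType) (i : 'I_m) : (mps_var A i : mpseries m A) 0%MM = 0.
Proof. by rewrite /mps_var eq_sym mnm1_eq0. Qed.

Section Weierstrass.
Context (n : nat) (K : fieldType).
Local Notation S := (mpseries n.+1 K).
Local Notation A := (mpseries n K).
Local Notation x := (mps_var K (@ord_max n) : S).
Local Notation U := (U_(@ord_max n))%MM.
Local Notation wid := (widen_ord (leqnSn n)).

Let wid_inj : injective wid. Proof. by move=> i j /(congr1 (@nat_of_ord _)) h; apply: ord_inj. Qed.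

Lemma codom_widen i : (i \in codom wid) = (i != ord_max).
Proof.
apply/codomP/idP => [[j ->]|ne].
  by rewrite -(inj_eq (@ord_inj _)) /= neq_ltn ltn_ord.
have lt : (i < n)%N.
  by move: ne (ltn_ord i); rewrite -(inj_eq (@ord_inj _)) /= ltnS leq_eqVlt => /negPf ->.
by exists (Ordinal lt); apply/ord_inj.
Qed.

Definition mps_widen : {rmorphism A -> S} :=
  subst_morph (h := fun i => mps_var K (wid i)) (fun i => mps_var0E K (wid i)).

Lemma mps_widen_onto (s : S) : (forall m, s m != 0 -> m ord_max = 0%N) ->
  exists a, mps_widen a = s.
Proof.
move=> s0; exists (fun c => s (mnm_push wid c)).
apply/mps_eqP => m; rewrite /mps_widen subst_morphE subst_sumE.
under eq_bigr do rewrite mmap1_push mpsXE.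
have [m0|m1] := eqVneq (m ord_max) 0%N; last first.
  rewrite big1 => [|c _].
    by apply/esym/eqP; apply: contraNT m1 => /s0 ->.
  case: eqP => [e|_]; last exact: mulr0.
  have /eqP := m1; case; have -> : m ord_max = mnm_push wid c ord_max by rewrite -e.
  by rewrite mnm_push_out // codom_widen eqxx.
have em : m = mnm_push wid [multinom m (wid j) | j < n].
  by apply: mnm_pushP => // i; rewrite codom_widen negbK => /eqP ->.
set c := [multinom _ | _ < _] in em.
have lt : (mdeg c < (mdeg m).+1)%N by rewrite {1}em mdeg_push.
rewrite (bigD1 (BMultinom lt)) //= -em eqxx mulr1 big1 ?addr0 // => c' ne.
case: eqP => [e|_]; last exact: mulr0.
by case/eqP: ne; apply/val_inj/(mnm_push_inj wid_inj); rewrite /= -e.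
Qed.

(** The degree in all variables but the last one. *)
Definition outer_deg (m : 'X_{1..n.+1}) : nat := \sum_(i < n) m (wid i).

Lemma outer_degD m m' : outer_deg (m + m') = (outer_deg m + outer_deg m')%N.
Proof. by rewrite /outer_deg -big_split; apply: eq_bigr => i _; rewrite mnmDE. Qed.

Lemma outer_degU j : outer_deg (U *+ j) = 0%N.
Proof.
rewrite /outer_deg big1 // => i _; rewrite mulmnE mnm1E.
by rewrite -(inj_eq (@ord_inj _)) /= gtn_eqF.
Qed.

Lemma outer_deg0 m : outer_deg m = 0%N -> m = (U *+ m ord_max)%MM.
Proof.
move=> /eqP; rewrite sum_nat_eq0 => /forallP h; apply/mnmP => i; rewrite mulmnE mnm1E.
have [<-|ne] := eqVneq ord_max i; first by rewrite mul1n.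
have : i \in codom wid by rewrite codom_widen eq_sym.
by move=> /codomP[j ->]; apply/eqP/h.
Qed.

Section Division.
Context (f : S) (d : nat).
Hypothesis fd : f (U *+ d)%MM != 0.
Hypothesis flow : forall j, (j < d)%N -> f (U *+ j)%MM = 0.

Let tau (s : S) : S := fun m => s (m + U *+ d)%MM.
Let low (j : nat) (s : S) : S := fun m => if m ord_max == 0%N then s (m + U *+ j)%MM else 0.

Let Ule j (m : 'X_{1..n.+1}) : (U *+ j <= m)%MM = (j <= m ord_max)%N.
Proof.
apply/mnm_lepP/idP => [/(_ ord_max)|le i]; rewrite mulmnE mnm1E ?eqxx ?mul1n //.
by case: eqP => [<-|_]; rewrite ?mul1n ?mul0n.
Qed.

Let split s : s = x ^+ d * tau s + \sum_(j < d) x ^+ j * low j s.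
Proof.
apply/mps_eqP => m; rewrite mpsDE mps_sumE mps_varE mpsXn mpsXM Ule.
have E (j : 'I_d) : (mpsX K U ^+ j * low j s) m = if (m ord_max == j)%N then s m else 0.
  rewrite mpsXn mpsXM Ule /low; case: leqP => [le|lt]; last by rewrite ltn_eqF.
  by rewrite mnmBE mulmnE mnm1E eqxx mul1n subn_eq0 submK ?Ule // eqn_leq le andbT.
under eq_bigr do rewrite E.
case: leqP => [le|lt].
  rewrite big1 => [|j _]; last by rewrite gtn_eqF // (leq_trans _ le).
  by rewrite /tau submK ?Ule // addr0.
rewrite add0r (bigD1 (Ordinal lt)) //= eqxx big1 ?addr0 // => j ne.
by case: eqP => // e; case/eqP: ne; apply/ord_inj.
Qed.

Let tauD s s' : tau (s + s') = tau s + tau s'. Proof. by []. Qed.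
Let tauN s : tau (- s) = - tau s. Proof. by []. Qed.
Let tau_mulx g : tau (x ^+ d * g) = g.
Proof. by apply/mps_eqP => m; rewrite /tau mps_varE mpsXn addmC mpsXMD. Qed.

(** Write [tau s] for the quotient of [s] by [x ^ d], so that [tau f] is
    invertible. Division amounts to finding [h] with [tau (s - h f) = 0], which
    is a fixed point equation for a map raising the degree in the variables
    other than [x]. *)
Lemma weierstrass_division s :
  exists h (a : 'I_d -> A), s = h * f + \sum_(j < d) mps_widen (a j) * x ^+ j.
Proof.
have [w wf] : exists w, w * tau f = 1.
  by apply: mps_inv; rewrite /tau add0m.
pose ell := \sum_(j < d) x ^+ j * low j f.
have ell0 m : outer_deg m = 0%N -> ell m = 0.
  move=> /outer_deg0 em; rewrite /ell mps_sumE big1 // => j _.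
  rewrite mps_varE mpsXn mpsXM Ule; case: ifP => // le.
  rewrite /low mnmBE mulmnE mnm1E eqxx mul1n subn_eq0; case: ifP => // ge.
  have eq : m ord_max = j by apply/eqP; rewrite eqn_leq ge le.
  by rewrite submK ?Ule // em eq flow.
pose wl := w * ell.
have wl0 m : outer_deg m = 0%N -> wl m = 0.
  move=> om; rewrite /wl mulrC mpsME big1 // => a le.
  have := congr1 outer_deg (submK le); rewrite outer_degD om => /eqP.
  by rewrite addn_eq0 => /andP[_ /eqP oa]; rewrite ell0 ?mul0r.
have [|d' g g0 m lt|g eg] := @mps_contraction _ _ outer_deg (fun g => - tau (wl * g)) _ _ (tau s).
- by move=> g g'; rewrite mulrDr tauD opprD.
- rewrite mpsNE /tau mpsME big1 ?oppr0 // => a le.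
  have e := submK le; have := congr1 outer_deg e.
  rewrite !outer_degD outer_degU addn0 => e'.
  have [oa|oa] := eqVneq (outer_deg a) 0%N; first by rewrite wl0 ?mul0r.
  by rewrite g0 ?mulr0 //; move: lt e' oa; move: (outer_deg _) (outer_deg _) (outer_deg _); lia.
pose r := s - w * g * f.
have tr : tau r = 0.
  have ef : w * g * f = x ^+ d * g + wl * g.
    rewrite {1}(split f) -/ell mulrDr; congr (_ + _); last by rewrite /wl; ring.
    by rewrite -[RHS]mulr1 -wf; ring.
  by rewrite /r tauD tauN ef tauD tau_mulx -eg opprK; apply/subrr.
have ra (j : 'I_d) : exists a, mps_widen a = low j r.
  by apply: mps_widen_onto => m; rewrite /low; case: (m ord_max =P 0%N) => //; rewrite eqxx.
exists (w * g), (fun j => sval (cid (ra j))).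
rewrite -[LHS](subrK (w * g * f)) addrC -/r; congr (_ + _).
rewrite {1}(split r) tr mulr0 add0r; apply: eq_bigr => j _.
by rewrite (svalP (cid (ra j))) mulrC.
Qed.

(** By division, multiplication by [s] modulo [f] has a matrix over the series
    in one variable less, with respect to the powers [x ^ j], [j < d]; the
    Cayley-Hamilton argument gives a monic equation. *)
Lemma integral_mod s : exists p : {poly A}, p \is monic /\
  exists h, (map_poly mps_widen p).[s] = h * f.
Proof.
have ex (i : 'I_d) : exists ha : S * ('I_d -> A),
    s * x ^+ i = ha.1 * f + \sum_(j < d) mps_widen (ha.2 j) * x ^+ j.
  by have [h [a e]] := weierstrass_division (s * x ^+ i); exists (h, a).
pose c i := sval (cid (ex i)); have cE i := svalP (cid (ex i)).
pose M : 'M[A]_d := \matrix_(i, j) (c i).2 j.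
pose B : 'M[S]_d := s%:M - map_mx mps_widen M.
exists (char_poly M); split; first exact: char_poly_monic.
have -> : (map_poly mps_widen (char_poly M)).[s] = \det B.
  rewrite map_char_poly -horner_evalE -det_map_mx; congr (\det _).
  apply/matrixP => i j; rewrite !mxE /= /horner_eval hornerD hornerN hornerC hornerMn hornerX.
  by rewrite mulrb; case: eqP.
have [d0|d0] := posnP d.
  have [h [a e]] := weierstrass_division 1; exists h.
  have -> : \det B = 1 by move: B; rewrite d0 => B; rewrite det_mx00.
  by rewrite e big1 ?addr0 // => j _; have := ltn_ord j; rewrite {2}d0.
pose col : 'cV[S]_d := \col_i x ^+ i.
have Bcol : B *m col = f *: (\col_i (c i).1).
  suff e : s%:M *m col = f *: (\col_i (c i).1) + map_mx mps_widen M *m col.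
    by rewrite mulmxBl e addrK.
  apply/matrixP => i l; rewrite mul_scalar_mx !mxE cE mulrC; congr (_ + _).
  by apply: eq_bigr => j _; rewrite !mxE.
exists ((\adj B *m (\col_i (c i).1)) (Ordinal d0) 0).
have := congr1 (mulmx (\adj B)) Bcol; rewrite mulmxA mul_adj_mx mul_scalar_mx -scalemxAr.
by move=> /matrixP/(_ (Ordinal d0) 0); rewrite !mxE expr0 mulr1 mulrC.
Qed.

End Division.
End Weierstrass.

(** * Chains of primes in power series rings *)

Section Preimages.
Context (R R' : comNzRingType) (f : {rmorphism R -> R'}).

Lemma prime_preim (P : set R') : is_prime_ideal P -> is_prime_ideal (f @^-1` P).
Proof.
move=> [Pid P1 PM]; split; first exact: (ideal_preim f Pid).
  by rewrite /preimage /= rmorph1.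
by move=> x y; rewrite /preimage /= rmorphM; apply: PM.
Qed.

End Preimages.

Section Incomparability.
Context (A S : comNzRingType) (phi : {rmorphism A -> S}) (J : set S).
Hypothesis integral : forall s, exists p : {poly A}, p \is monic /\ J (map_poly phi p).[s].

(** Let [s] be in [P'] but not in [P], with a monic equation modulo [P]. If the
    contractions agreed, the constant coefficient of the equation would lie in
    [P]; dividing by [s] gives an equation of smaller degree. *)
Lemma contract_strict (P P' : set S) : is_prime_ideal P -> is_prime_ideal P' ->
  J `<=` P -> P `<` P' -> phi @^-1` P `<` phi @^-1` P'.
Proof.
move=> [[P0 PD PM] P1 Pp] [[P'0 P'D P'M] P'1 P'p] JP [sub nsub].
split=> [a|sub']; first exact: sub.
have [s P's nPs] : exists2 s, P' s & ~ P s.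
  apply: contrapT => no; apply: nsub => s P's.
  by apply: contrapT => nP; apply: no; exists s.
suff H : forall l (p : {poly A}), (size p <= l)%N -> p \is monic -> ~ P (map_poly phi p).[s].
  by have [p [pm /JP]] := integral s; apply: (H (size p)).
elim=> [|l IH] p.
  by rewrite leqn0 size_poly_eq0 => /eqP ->; rewrite monicE lead_coef0 eq_sym oner_eq0.
elim/poly_ind: p => [|p1 c _]; first by rewrite monicE lead_coef0 eq_sym oner_eq0.
rewrite size_MXaddC; have [->|nz] := eqVneq p1 0.
  rewrite mul0r add0r monicE lead_coefC => _ /eqP ->.
  by rewrite map_polyC /= hornerC rmorph1.
rewrite andFb ltnS => sz pm hP.
have p1m : p1 \is monic.
  move: pm; rewrite !monicE lead_coefDl ?lead_coefMX // size_polyC size_mulX //.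
  by case: (c != 0) => //; rewrite ltnS lt0n size_poly_eq0.
move: hP; rewrite rmorphD rmorphM /= map_polyX map_polyC /= hornerD hornerMX hornerC => hP.
have Pc : P (phi c).
  apply: sub'; rewrite /preimage /=.
  have -> : phi c = ((map_poly phi p1).[s] * s + phi c) - (map_poly phi p1).[s] * s by rewrite addrC addKr.
  apply: (P'D); first exact: sub.
  by rewrite -mulNr; apply: (P'M).
have : P ((map_poly phi p1).[s] * s).
  rewrite -[X in P X](addrK (phi c)); apply: (PD) => //.
  by rewrite -mulN1r; apply: (PM).
by move=> /Pp[|//]; apply: IH.
Qed.

End Incomparability.

Section ChangeOfVariables.
Context (n : nat) (K : fieldType) (f : mpseries n.+1 K).
Local Notation S := (mpseries n.+1 K).
Local Notation U := (U_(@ord_max n))%MM.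
Hypothesis f_neq0 : f != 0.

(** The exponents are minimized one variable at a time, among the monomials that
    agree with the choices made so far. *)
Lemma lex_least : exists2 a, f a != 0 & forall b, f b != 0 -> b <> a ->
  exists i : 'I_n.+1, (forall j : 'I_n.+1, (j < i)%N -> b j = a j) /\ (a i < b i)%N.
Proof.
suff H l : (l <= n.+1)%N -> exists2 a, f a != 0 & forall b, f b != 0 ->
  (exists i : 'I_n.+1, (forall j : 'I_n.+1, (j < i)%N -> b j = a j) /\ (a i < b i)%N) \/
  (forall j : 'I_n.+1, (j < l)%N -> b j = a j).
  have [a fa h] := H n.+1 (leqnn _); exists a => // b fb ne.
  case: (h b fb) => // e; case: ne; apply/mnmP => j; exact: e.
elim: l => [|l IH] ln.
  have [a fa _] := mps_least f_neq0; exists a => // b _; by right.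
have [a fa h] := IH (ltnW ln); pose il := Ordinal ln.
pose P d := `[< exists b, [/\ f b != 0, forall j : 'I_n.+1, (j < l)%N -> b j = a j & b il = d] >].
have exP : exists d, P d by exists (a il); apply/asboolP; exists a.
case: (ex_minnP exP) => d /asboolP[a' [fa' ea' ed]] dmin.
exists a' => // b fb.
have agree : (forall j : 'I_n.+1, (j < l)%N -> b j = a j) ->
    (exists i : 'I_n.+1, (forall j : 'I_n.+1, (j < i)%N -> b j = a' j) /\ (a' i < b i)%N) \/
    (forall j : 'I_n.+1, (j < l.+1)%N -> b j = a' j).
  move=> e; have : (d <= b il)%N by apply: dmin; apply/asboolP; exists b.
  rewrite leq_eqVlt => /orP[/eqP eb|lt]; [right=> j | left; exists il].
    rewrite ltnS leq_eqVlt => /orP[/eqP ej|lj]; last by rewrite e // ea' //.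
    have -> : j = il by apply: ord_inj.
    by rewrite ed.
  by rewrite ed; split=> // j lj; rewrite e // ea'.
case: (h b fb) => [[i [e1 e2]]|//]; have [lt|ge] := ltnP i l; last first.
  by apply: agree => j lj; apply: e1; apply: leq_trans ge.
left; exists i; rewrite ea' //; split=> // j ji; rewrite ea' ?e1 //.
exact: ltn_trans lt.
Qed.

(** With rapidly decreasing weights the lexicographically least monomial has
    the least weight, and it is the only monomial with that weight. *)
Lemma unique_least_weight : exists (w : 'I_n.+1 -> nat) (a : 'X_{1..n.+1}),
  [/\ w ord_max = 1%N, forall i, (0 < w i)%N, f a != 0 &
      forall b, f b != 0 -> b <> a ->
        (\sum_i w i * a i < \sum_i w i * b i)%N].
Proof.
have [a fa la] := lex_least; set B := (mdeg a).+1.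
exists (fun i => B ^ (n - i))%N, a; split=> //; first by rewrite subnn.
  by move=> i; rewrite expn_gt0.
move=> b fb ne; have [i [e1 e2]] := la b fb ne.
have B0 c : (0 < B ^ c)%N by rewrite expn_gt0.
have key : (\sum_(j < n.+1) (B ^ (n - j) * a j + (j == i) * B ^ (n - i)) <=
            \sum_(j < n.+1) (B ^ (n - j) * b j + (i < j) * (a j * B ^ (n - i).-1)))%N.
  apply: leq_sum => j _; have [->|nji] := eqVneq j i.
    by rewrite ltnn mul0n addn0 mul1n -mulnSr leq_pmul2l.
  rewrite mul0n addn0; have [lt|lt|e] := ltngtP j i.
  - by rewrite e1 // leq_addr.
  - rewrite mul1n mulnC; apply: leq_trans (leq_addl _ _); rewrite leq_mul2l.
    by rewrite leq_pexp2l ?orbT //; have := ltn_ord j; lia.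
  - by case/eqP: nji; apply: ord_inj.
have single : (\sum_(j < n.+1) (j == i) * B ^ (n - i) = B ^ (n - i))%N.
  rewrite (bigD1 i) //= eqxx mul1n big1 ?addn0 // => j /negPf ->; exact: mul0n.
move: key; rewrite !big_split /= single.
have ai : (\sum_(j < n.+1) (i < j) * (a j * B ^ (n - i).-1) < B ^ (n - i))%N.
  have [im|im] := eqVneq (i : nat) n.
    rewrite big1 // => j _; have := ltn_ord j; rewrite ltnS im => le.
    by rewrite ltnNge le.
  have -> : (n - i = (n - i).-1.+1)%N by have := ltn_ord i; move/eqP: im; lia.
  rewrite expnS /=; apply: (@leq_ltn_trans (mdeg a * B ^ (n - i).-1)); last by rewrite ltn_pmul2r.
  rewrite mdegE big_distrl; apply: leq_sum => j _ /=.
  by case: (i < j)%N; rewrite ?mul1n ?mul0n.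
move=> key; move: key ai => /=; move: (\sum_(j < n.+1) (i < j) * _)%N (B ^ _)%N => X Y.
move: (\sum_(j < _) _)%N (\sum_(j < _) _)%N => Z T; lia.
Qed.

(** The substitution [x_i |-> x_i + x_n ^ (w i)] is invertible; setting the
    other variables to zero afterwards leaves the monomials [x_n ^ (w . c)],
    and the one of the least weight does not cancel. *)
Lemma regular_coordinates : exists (g h : 'I_n.+1 -> S),
  [/\ forall i, g i 0%MM = 0, forall i, h i 0%MM = 0,
      forall s, subst h (subst g s) = s & exists d, subst g f (U *+ d)%MM != 0].
Proof.
have [w [a [w1 w0 fa aw]]] := unique_least_weight.
pose y i : S := mps_var K (@ord_max n) ^+ w i.
have y0 i : y i 0%MM = 0.
  rewrite /y mps_varE mpsXn mpsXE; case: eqP => // /mnmP/(_ ord_max).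
  by rewrite mnm0E mulmnE mnm1E eqxx mul1n => e; have := w0 i; rewrite -e.
pose g i : S := if i == ord_max then mps_var K i else mps_var K i + y i.
pose h i : S := if i == ord_max then mps_var K i else mps_var K i - y i.
have v0 := @mps_var0E n.+1 K.
have g0 i : g i 0%MM = 0 by rewrite /g; case: ifP; rewrite ?mpsDE ?y0 ?v0 ?addr0.
have h0 i : h i 0%MM = 0 by rewrite /h; case: ifP; rewrite ?mpsDE ?mpsNE ?y0 ?v0 ?subr0.
exists g, h; split=> // [s|].
  rewrite subst_comp // -[RHS]subst_id; congr (subst _ s); apply/funext => i.
  rewrite -[LHS]/(subst_morph h0 (g i)) {1}/g; case: ifP => [/eqP ->|ne].
    by rewrite subst_morphE subst_var // /h eqxx.
  rewrite rmorphD rmorphXn /= !subst_var // /h ne eqxx /y subrK //.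
pose W := (\sum_i w i * a i)%N; exists W.
pose Z : set S := [set s | forall c, s (U *+ c)%MM = 0].
have [Z0 ZD ZM] : is_ideal Z.
  split=> [c|s s' Zs Zs' c|r s Zs c]; rewrite /= ?mpsDE ?Zs ?Zs' ?addr0 //.
  rewrite mpsME big1 // => l /mnm_lepP le.
  have -> : (U *+ c - l = U *+ (c - l ord_max))%MM.
    apply/mnmP => i; rewrite mnmBE !mulmnE !mnm1E; have := le i; rewrite mulmnE mnm1E.
    by case: eqP => [<-|_]; lia.
  by rewrite Zs mulr0.
have gy i : Z (g i - y i).
  rewrite /g; case: eqP => [->|/eqP ne]; first by rewrite /y w1 expr1 subrr.
  rewrite addrK => c /=; rewrite mps_varE mpsXE; case: eqP => // /mnmP/(_ i).
  by rewrite mulmnE !mnm1E eqxx eq_sym (negPf ne).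
have monZ c : Z (mmap1 g c - mmap1 y c).
  pose E (p r : S) := Z (p - r).
  have EM p p' r r' : E p p' -> E r r' -> E (p * r) (p' * r').
    move=> hp hr; rewrite /E; have -> : p * r - p' * r' = p * (r - r') + r' * (p - p') by ring.
    by apply: (ZD); apply: (ZM).
  rewrite -/(E _ _) /mmap1; elim/big_ind2: _ => [|p p' r r'|i _].
  - by rewrite /E subrr.
  - exact: EM.
  elim: (c i) => [|l IH]; first by rewrite /E !expr0 subrr.
  by rewrite !exprS; apply: EM; [apply: gy | apply: IH].
have monE c W' : mmap1 g c (U *+ W')%MM = (W' == \sum_i w i * c i)%N%:R.
  have /subr0_eq -> := monZ c W'.
  have -> : mmap1 y c = mpsX K (U *+ (\sum_i w i * c i))%MM.
    rewrite /mmap1 /y; elim/big_ind2: _ => [|p u r v -> ->|i _].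
    - by rewrite -mpsX0; congr mpsX; apply/mnmP => i; rewrite mulmnE muln0 mnm0E.
    - by rewrite -mpsXD; congr mpsX; apply/mnmP => i; rewrite mnmDE !mulmnE mulnDr.
    - by rewrite -exprM mps_varE mpsXn.
  rewrite mpsXE; congr (_%:R); congr nat_of_bool; apply/eqP/eqP => [/mnmP/(_ ord_max)|->//].
  by rewrite !mulmnE mnm1E eqxx !mul1n.
rewrite subst_sumE.
have lt : (mdeg a < (mdeg (U *+ W)).+1)%N.
  rewrite ltnS mdegMn mdeg1 mul1n mdegE; apply: leq_sum => i _.
  by rewrite leq_pmull.
rewrite (bigD1 (BMultinom lt)) //= monE eqxx mulr1 big1 ?addr0 // => c ne.
rewrite monE; case: eqP => [e|_]; last exact: mulr0.
have [->|fc] := eqVneq (f c) 0; first exact: mul0r.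
have [ec|nec] := pselect (bmnm c = a); first by case/eqP: ne; apply/val_inj.
by have := aw c fc nec; rewrite -e ltnn.
Qed.

End ChangeOfVariables.

Section PrimeChains.

(** The dimension of a power series ring is at most the number of variables:
    after a change of coordinates the ring is integral, modulo a nonzero
    element of the second prime, over the series in one variable less. *)
Theorem prime_chain_le n (K : fieldType) l (P : nat -> set (mpseries n K)) :
  (forall i, (i <= l)%N -> is_prime_ideal (P i)) ->
  (forall i, (i < l)%N -> P i `<` P i.+1) -> (l <= n)%N.
Proof.
elim: n l P => [|n IH] [|l] P Pp Plt //.
  have [sub nsub] := Plt 0%N (ltn0Sn l); case: nsub => s P1s.
  have [[_ _ PM] P1 _] := Pp 1%N (ltn0Sn l); have [[P00 _ _] _ _] := Pp 0%N (leq0n _).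
  suff -> : s = 0 by [].
  apply: contrapT => nz; apply: P1; have s0 : s 0%MM != 0.
    apply/eqP => s0; apply: nz; apply/mps_eqP => m; rewrite -[RHS]s0; congr (s _).
    by apply/mnmP => -[].
  by have [g <-] := mps_inv s0; apply: PM.
have [f P1f nP0f] : exists2 f, P 1%N f & ~ P 0%N f.
  have [_ nsub] := Plt 0%N (ltn0Sn l).
  apply: contrapT => no; apply: nsub => s P1s.
  by apply: contrapT => nP; apply: no; exists s.
have f0 : f != 0 by apply/eqP => f0; apply: nP0f; rewrite f0; case: (Pp 0%N (leq0n _)) => -[].
have [g [h [g0 h0 hg exd]]] := regular_coordinates f0.
case: (ex_minnP exd) => d fd dmin.
have low j : (j < d)%N -> subst g f (U_(ord_max) *+ j)%MM = 0.
  by move=> lt; apply/eqP; apply: contraTT lt => /dmin; rewrite -leqNgt.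
pose P' i := subst_morph h0 @^-1` P i.
have P'p i : (i <= l.+1)%N -> is_prime_ideal (P' i) by move=> /Pp; apply: prime_preim.
have P'lt i : (i < l.+1)%N -> P' i `<` P' i.+1.
  move=> /Plt[sub nsub]; split=> [s|sub']; first exact: sub.
  by apply: nsub => s; rewrite -(hg s); apply: sub'.
pose J : set (mpseries n.+1 K) := [set s | exists r, s = r * subst g f].
have JP i : (0 < i <= l.+1)%N -> J `<=` P' i.
  move=> + s [r ->]; elim: i => // -[_ _|i IHi le].
    rewrite /P' /preimage /=; have [[_ _ PM] _ _] := Pp 1%N (ltn0Sn l).
    by rewrite -subst_morphE rmorphM /= hg; apply: PM.
  by have [sub _] := P'lt i.+1 le; apply: sub; apply: IHi; apply: ltnW.
have int s := integral_mod fd low s.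
rewrite ltnS; apply: (IH l (fun i => mps_widen n K @^-1` P' i.+1)) => i le.
  by apply: prime_preim; apply: P'p.
apply: (contract_strict (J := J)); first exact: int.
- by apply: P'p; apply: ltnW.
- exact: P'p.
- by apply: JP; rewrite ltn0Sn leqW.
- exact: P'lt.
Qed.

End PrimeChains.

(** * The Krull dimension of the hypersurface *)

Section QuotientPrimes.
Context (n : nat) (K : fieldType) (R : comNzRingType).
Local Notation S := (mpseries n K).
Context (F : S) (pi : {rmorphism S -> R}).
Hypothesis F_neq0 : F != 0.
Hypothesis pi_surj : forall x, exists s, pi s = x.
Hypothesis pi_ker : forall s, pi s = 0 <-> exists h, s = h * F.

Lemma zero_prime : is_prime_ideal [set 0 : S].
Proof.
split=> [|/eqP|x y /mps_mulf_eq0 //]; last by rewrite oner_eq0.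
by split=> [//|x y -> ->|a x ->]; rewrite /= ?addr0 ?mulr0.
Qed.

(** A chain of primes of [R = S / (F)] lifts to [S], where it can be extended
    downwards by the zero ideal. *)
Lemma quotient_prime_chain_lt l (P : nat -> set R) :
  (forall i, (i <= l)%N -> is_prime_ideal (P i)) ->
  (forall i, (i < l)%N -> P i `<` P i.+1) -> (l < n)%N.
Proof.
move=> Pp Plt.
apply: (@prime_chain_le n K l.+1 (fun i => if i is i'.+1 then pi @^-1` P i' else [set 0])).
  by move=> [_|i le]; [exact: zero_prime | apply: prime_preim; apply: Pp].
have P0 i x : (i <= l)%N -> pi x = 0 -> P i (pi x) by move=> /Pp[[]] h _ _ _ _ ->.
move=> [_|i lt]; last first.
  have [sub nsub] := Plt i lt; split=> [s|sub']; first exact: sub.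
  by apply: nsub => x; have [s <-] := pi_surj x; apply: sub'.
split=> [s ->|sub]; first by apply: (P0 0%N) => //; rewrite rmorph0.
have : [set (0 : S)] F.
  by apply: sub; apply: (P0 0%N) => //; apply/pi_ker; exists 1; rewrite mul1r.
by move/eqP; rewrite (negPf F_neq0).
Qed.

Lemma image_prime (P : set S) : is_prime_ideal P -> P F ->
  is_prime_ideal (pi @` P) /\ forall s, (pi @` P) (pi s) <-> P s.
Proof.
move=> [[P0 PD PM] P1 Pp] PF.
have imP s : (pi @` P) (pi s) <-> P s.
  split=> [[s' Ps' e]|Ps]; last by exists s.
  have /pi_ker[h eh] : pi (s - s') = 0 by rewrite rmorphB e subrr.
  rewrite -(subrK s' s) eh; apply: (PD) => //; exact: (PM).
split=> //; split; first split.
- by exists 0; rewrite ?rmorph0.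
- by move=> _ _ [s Ps <-] [s' Ps' <-]; exists (s + s'); rewrite ?rmorphD //; apply: (PD).
- move=> a _ [s Ps <-]; have [a' <-] := pi_surj a.
  by exists (a' * s); rewrite ?rmorphM //; apply: (PM).
- by rewrite -(rmorph1 pi) imP.
move=> x y; have [s <-] := pi_surj x; have [s' <-] := pi_surj y.
by rewrite -rmorphM !imP; apply: Pp.
Qed.

Lemma kernel_prime (th : {rmorphism S -> S}) : is_prime_ideal (th @^-1` [set 0]).
Proof. exact: prime_preim zero_prime. Qed.

End QuotientPrimes.

Section BlowUpChain.
Context (k : closedFieldType) (iota : {rmorphism 'F_2 -> k}).
Context (t : nat) (alpha : 'I_t -> k).
Local Notation N := (3 * t).+2.
Local Notation S := (mpseries N k).
Local Notation var j := (mps_var k (inord j : 'I_N) : S).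
Local Notation u := (var (3 * t)%N).

Lemma quartic_morph (f : {rmorphism S -> S}) a x y z : (forall c s, f (c *: s) = c *: f s) ->
  f (quartic a x y z) = quartic a (f x) (f y) (f z).
Proof.
move=> fZ; rewrite /quartic !rmorphD fZ.
by rewrite rmorphM [f (x * y * _)]rmorphM [f (x * y)]rmorphM [f (_ * z)]rmorphM rmorphD !rmorphXn.
Qed.

Lemma quartic_homog a (w x y z : S) :
  quartic a (w * x) (w * y) (w * z) = w ^+ 4 * quartic a x y z.
Proof.
have [X eX] : exists X, forall y : S, a *: y = X * y.
  by exists a%:A => y'; rewrite mulr_algl.
by rewrite /quartic !eX; ring.
Qed.

(** The hypersurface [u v + G = 0] is parametrized by the blow-up chart
    [x_i = u x_i'], [v = u^3 G(x')], because [G] is homogeneous of degree 4 and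
    the characteristic is two. The first [j] of the [x_i'] are set to zero. *)
Definition kill (j l : nat) : S := if (l < j)%N then 0 else var l.

Definition killed_sum (j : nat) : S :=
  \sum_(r < t) quartic (alpha r) (kill j (3 * r)) (kill j (3 * r).+1) (kill j (3 * r).+2).

Definition chart (j : nat) (i : 'I_N) : S :=
  if (i < 3 * t)%N then u * kill j i
  else if i == 3 * t :> nat then u else u ^+ 3 * killed_sum j.

Let u0 : u 0%MM = 0. Proof. exact: mps_var0E. Qed.

Lemma chart0 j i : chart j i 0%MM = 0.
Proof.
rewrite /chart; case: ifP => _; first by rewrite mps_mul0E u0 mul0r.
by case: ifP => _; rewrite ?u0 // exprS !mps_mul0E u0 !mul0r.
Qed.

Definition chart_morph j : {rmorphism S -> S} := subst_morph (@chart0 j).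

Lemma chart_x j l : (l < 3 * t)%N -> chart_morph j (var l) = u * kill j l.
Proof. by move=> lt; rewrite /= (subst_var (@chart0 j)) /chart inordK ?lt //; lia. Qed.

Lemma chart_u j : chart_morph j u = u.
Proof. by rewrite /= (subst_var (@chart0 j)) /chart inordK // ltnn eqxx. Qed.

Lemma chart_v j : chart_morph j (var (3 * t).+1) = u ^+ 3 * killed_sum j.
Proof.
by rewrite /= (subst_var (@chart0 j)) /chart inordK // ltnNge leqnSn /= gtn_eqF.
Qed.

Lemma chart_hyp j : chart_morph j (hyp_eq alpha) = 0.
Proof.
rewrite /hyp_eq rmorphD rmorphM chart_u chart_v rmorph_sum.
rewrite (eq_bigr (fun r : 'I_t => u ^+ 4 *
   quartic (alpha r) (kill j (3 * r)) (kill j (3 * r).+1) (kill j (3 * r).+2))).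
  rewrite -mulr_sumr -/(killed_sum j) mulrA -exprS.
  by apply: addrr_pchar2; apply: (rmorph_pchar (GRing.in_alg S)); exact: char2 iota.
move=> r _; rewrite -quartic_homog quartic_morph; last exact: substZ.
by rewrite !chart_x //; have := ltn_ord r; lia.
Qed.

Lemma var_neq0 l : var l != 0.
Proof.
apply/eqP => /mps_eqP/(_ U_(inord l)%MM); rewrite mps_varE mpsXE eqxx => /eqP.
by rewrite oner_eq0.
Qed.

(** Killing one more variable factors through the previous chart. *)
Lemma chart_le j s : (j < 3 * t)%N -> chart_morph j s = 0 -> chart_morph j.+1 s = 0.
Proof.
move=> jt s0.
pose kap (i : 'I_N) : S := if i == j :> nat then 0 else mps_var k i.
have kap0 i : kap i 0%MM = 0 by rewrite /kap; case: ifP => // _; apply: mps_var0E.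
have kapv l : (l < N)%N -> subst_morph kap0 (var l) = if l == j then 0 else var l.
  by move=> lt; rewrite /= subst_var // /kap inordK.
have kapu : subst_morph kap0 u = u by rewrite kapv // gtn_eqF.
have kapk l : (l < 3 * t)%N -> subst_morph kap0 (kill j l) = kill j.+1 l.
  move=> lt; have e : (l < j.+1)%N = (l == j) || (l < j)%N by rewrite ltnS leq_eqVlt.
  rewrite /kill e; case: ltnP => [lj|jl]; first by rewrite orbT rmorph0.
  by rewrite orbF kapv //; lia.
rewrite -[LHS]/(subst (chart j.+1) s).
have -> : chart j.+1 = fun i => subst kap (chart j i).
  apply/funext => i; rewrite -[RHS]/(subst_morph kap0 (chart j i)) /chart.
  case: ifP => [lt|_]; first by rewrite rmorphM kapu kapk.
  case: ifP => _ //; rewrite rmorphM rmorphXn kapu; congr (_ * _).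
  rewrite /killed_sum rmorph_sum; apply: eq_bigr => r _.
  rewrite quartic_morph; last exact: substZ.
  by rewrite !kapk //; have := ltn_ord r; lia.
rewrite -subst_comp //; last exact: chart0.
by move: s0; rewrite -[LHS]/(subst (chart j) s) => ->; apply: (rmorph0 (subst_morph kap0)).
Qed.

(** The kernels of the charts: first the prime of the hypersurface, then one
    more coordinate vanishes at each step until only [u] is left, and at the end
    the maximal ideal. *)
Definition chart_chain (i : nat) : set S :=
  if (i <= 3 * t)%N then chart_morph i @^-1` [set 0] else [set s : S | s 0%MM = 0].

Lemma chart_chain_prime i : is_prime_ideal (chart_chain i).
Proof.
rewrite /chart_chain; case: ifP => _; first exact: kernel_prime.
split=> [||x y].
- split=> [//|x y x0 y0|a x x0] /=; first by rewrite mpsDE x0 y0 addr0.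
  by rewrite mps_mul0E x0 mulr0.
- by rewrite /= mps1E eqxx => /eqP; rewrite oner_eq0.
by rewrite /= mps_mul0E => /eqP; rewrite mulf_eq0 => /orP[] /eqP; [left|right].
Qed.

Lemma chart_chain_lt i : (i < 3 * t + 1)%N -> chart_chain i `<` chart_chain i.+1.
Proof.
rewrite addn1 ltnS => le; rewrite /chart_chain le; case: ifP => [lt|_]; split.
- by move=> s; apply: chart_le.
- move=> sub; have /sub : (chart_morph i.+1 @^-1` [set 0]) (var i).
    by change (chart_morph i.+1 (var i) = 0); rewrite chart_x // /kill ltnSn mulr0.
  change (chart_morph i (var i) = 0 -> False); rewrite chart_x // /kill ltnn => /mps_mulf_eq0[] /eqP.
    by rewrite (negPf (var_neq0 _)).
  by rewrite (negPf (var_neq0 _)).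
- move=> s; rewrite /preimage /= => s0.
  by rewrite -(subst0E (@chart0 i)) s0.
- move=> /(_ u u0); change (chart_morph i u = 0 -> False); rewrite chart_u => /eqP.
  by rewrite (negPf (var_neq0 _)).
Qed.

Lemma hyp_eq0E : hyp_eq alpha 0%MM = 0.
Proof.
have := subst0E (@chart0 0) (hyp_eq alpha).
by rewrite -[subst _ _]/(chart_morph 0 _) chart_hyp => <-.
Qed.

Lemma chart_chain_hyp i : chart_chain i (hyp_eq alpha).
Proof. by rewrite /chart_chain; case: ifP => _; [apply: chart_hyp|apply: hyp_eq0E]. Qed.

Lemma hyp_eq_neq0 : hyp_eq alpha != 0.
Proof.
apply/eqP => z; pose h (i : 'I_N) : S := if (i < 3 * t)%N then 0 else mps_var k i.
have h0 i : h i 0%MM = 0 by rewrite /h; case: ifP => // _; apply: mps_var0E.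
have := congr1 (subst_morph h0) z; rewrite /hyp_eq rmorphD rmorphM rmorph_sum rmorph0.
rewrite big1 => [|r _]; last first.
  rewrite quartic_morph; last exact: substZ.
  have hx l : (l < 3 * t)%N -> subst_morph h0 (var l) = 0.
    by move=> lt; rewrite /= subst_var // /h inordK ?lt //; lia.
  rewrite !hx; try by have := ltn_ord r; lia.
  by rewrite /quartic; rewrite !(expr0n, mul0r, mulr0, addr0, scaler0).
rewrite addr0 /= !subst_var // /h !inordK // ltnn ltnNge leqnSn /=.
by case/mps_mulf_eq0 => /eqP; rewrite (negPf (var_neq0 _)).
Qed.

(** The images of [chart_chain] form a chain of length [3 t + 1], and
    [quotient_prime_chain_lt] excludes longer ones. *)
Lemma hyp_krull_dim (R : comNzRingType) (pi : {rmorphism S -> R}) :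
    (forall x, exists s, pi s = x) ->
    (forall s, pi s = 0 <-> exists h, s = h * hyp_eq alpha) ->
  is_krull_dim R (3 * t + 1).
Proof.
move=> pi_surj pi_ker.
have im i := image_prime pi_surj pi_ker (chart_chain_prime i) (chart_chain_hyp i).
split.
  exists (fun i => pi @` chart_chain i); split=> i lt; first by case: (im i).
  have [[_ hi] [_ hi1]] := (im i, im i.+1).
  have [sub nsub] := chart_chain_lt lt; split=> [x|sub'].
    by have [s <-] := pi_surj x; rewrite hi hi1; apply: sub.
  by apply: nsub => s /hi1 /sub' /hi.
move=> l J [Jp Jlt].
by have := quotient_prime_chain_lt hyp_eq_neq0 pi_surj pi_ker Jp Jlt; rewrite addn1 ltnS.
Qed.

End BlowUpChain.

(** * Geometric series *)

Section Limit.
Context (RR : realType).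

Lemma cvg_geometric_bound (x : nat -> RR) (l C : RR) :
  (forall n, `|l - x n| <= C / 2 ^+ n) -> x @ \oo --> l.
Proof.
move=> bound A [/= e e0 sub].
pose N := Num.bound (C / e).
exists N => // n /= Nn; apply: sub; rewrite /=.
apply: le_lt_trans (bound n) _.
rewrite ltr_pdivrMr ?exprn_gt0 // mulrC -ltr_pdivrMr //.
have C0 : 0 <= C by have := le_trans (normr_ge0 _) (bound 0%N); rewrite expr0 divr1.
have h : C / e < N%:R by apply: archi_boundP; rewrite divr_ge0 // ltW.
apply: lt_le_trans h _; rewrite -natrX ler_nat; apply: leq_trans Nn _.
exact/ltnW/ltn_expl.
Qed.

(** The tail of the geometric series over the positive multiples of [L] starts
    at an exponent of at least [n]. *)
Lemma geometric_multiples (c : RR) (L n : nat) : 0 < c -> c <= 2^-1 -> (0 < L)%N -> (0 < n)%N ->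
  0 <= c ^+ L / (1 - c ^+ L) - \sum_(1 <= s < n | (L %| s)%N) c ^+ s <= 2 * c ^+ n.
Proof.
move=> c0 c2 L0 n0.
have c1 : c < 1 by apply: le_lt_trans c2 _; lra.
have cL : c ^+ L <= 2^-1.
  by case: L L0 => // L _; rewrite exprS; apply: le_trans c2; rewrite ger_pMr ?exprn_ile1 ?ltW.
have d0 : 0 < 1 - c ^+ L by apply: lt_le_trans (_ : 0 < 2^-1) _; lra.
suff -> : c ^+ L / (1 - c ^+ L) - \sum_(1 <= s < n | (L %| s)%N) c ^+ s =
    c ^+ (L * (n.-1 %/ L).+1) / (1 - c ^+ L).
  rewrite divr_ge0 ?exprn_ge0 ?(ltW c0) ?(ltW d0) //= ler_pdivrMr //.
  apply: (@le_trans _ _ (c ^+ n)).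
    apply: ler_wiXn2l; rewrite ?(ltW c0) ?(ltW c1) //.
    by rewrite -{1}(prednK n0) mulnC ltn_ceil.
  rewrite -mulrA mulrCA ler_peMr ?exprn_ge0 ?(ltW c0) //; lra.
case: n n0 => // n _; elim: n => [|n IH].
  by rewrite big_geq // subr0 div0n muln1.
rewrite big_mkcond big_nat_recr //= -big_mkcond /= opprD addrA IH /= divnS //.
have nz : 1 - c ^+ L != 0 by rewrite gt_eqF.
case: ifP => [dv|_]; last by rewrite add0n subr0.
have e1 : (n.+1 = L * (n %/ L).+1)%N.
  by rewrite -{1}(divnK dv) divnS // dv mulnC.
rewrite add1n [(L * _.+2)%N]mulnS exprD -e1.
by field.
Qed.

End Limit.

(** * The limits *)

Section PrincipalProjection.
Context (S : comNzRingType) (F : S) (hF : ~ exists h, h * F = 1).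

Definition quot_pi : {rmorphism S -> principal_quot hF} :=
  \pi_{ideal_quot (principal_idealr hF)}%qT.

Lemma quot_pi_surj x : exists s, quot_pi s = x.
Proof. by exists (repr x); rewrite /quot_pi /= reprK. Qed.

Lemma quot_pi_ker s : quot_pi s = 0 <-> exists h, s = h * F.
Proof.
have e : (quot_pi s == 0) = (s \in principal_idealr hF).
  by rewrite -[s in RHS]subr0 Quotient.idealrBE -(rmorph0 quot_pi).
split=> [/eqP|h]; first by rewrite e => /asboolP.
by apply/eqP; rewrite e; apply/asboolP.
Qed.

End PrincipalProjection.

Section Numerics.
Context (RR : realType) (t : nat) (m : 'I_t -> nat).
Hypothesis m_gt1 : forall i, (1 < m i)%N.

Definition common_ratio : RR := (2 ^+ (2 * t + 1))^-1.

(** The product over all blocks of the numbers [bracket_weight]. *)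
Definition block_weight (s : nat) : nat :=
  \prod_(i < t) (if s == 0%N then 4 else (2 ^ s.+1 * (3 + (m i %| s)))%N).

Definition lcm_of (I : {set 'I_t}) : nat := \big[lcmn/1%N]_(i in I) m i.

Definition geometric_term (I : {set 'I_t}) : RR := 3 ^+ (t - #|I|) / 2 ^+ t.+1.

Definition limit_term (I : {set 'I_t}) : RR :=
  3 ^+ (t - #|I|) / (2 ^+ ((2 * t + 1) * lcm_of I + t + 1) - 2 ^+ (t + 1)).

Lemma lcm_of_gt0 I : (0 < lcm_of I)%N.
Proof.
rewrite /lcm_of; elim/big_ind: _ => // [x y x0 y0|i _]; first by rewrite lcmn_gt0 x0.
exact: ltnW.
Qed.

(** Expanding the product over the subsets [I] of blocks with [m i] dividing
    [s], which holds for all of [I] exactly if the least common multiple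
    divides [s]. *)
Lemma prod_divides (s : nat) :
  \prod_(i < t) (3 + (m i %| s))%N%:R =
  \sum_(I : {set 'I_t}) 3 ^+ (t - #|I|) * (lcm_of I %| s)%:R :> RR.
Proof.
under eq_bigr do rewrite addnC natrD.
rewrite bigA_distr; apply: eq_bigr => I _.
have -> : (lcm_of I %| s)%:R = \prod_(i in I) (m i %| s)%:R :> RR.
  have [dv|ndv] := boolP (lcm_of I %| s)%N.
    rewrite big1 // => i iI; rewrite (dvdn_trans _ dv) //.
    by rewrite /lcm_of (bigD1 i) //= dvdn_lcml.
  have [i iI nd] : exists2 i, i \in I & ~~ (m i %| s)%N.
    apply/exists_inP; apply: contraNT ndv => /exists_inPn h.
    by apply/dvdn_biglcmP => i iI; have := h i iI; rewrite negbK.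
  by rewrite (bigD1 i) //= (negPf nd) mul0r.
rewrite mulrC (bigID (mem I)) /=; congr (_ * _).
  by apply: eq_bigr => i ->.
rewrite (eq_bigr (fun _ => 3)) => [|i /negPf-> //].
rewrite prodr_const; congr (_ ^+ _).
have -> : (t - #|I|)%N = #|~: I| by have := cardsC I; rewrite card_ord; lia.
by apply: eq_card => i; rewrite !inE.
Qed.

Lemma common_ratio_bounds : 0 < common_ratio /\ common_ratio <= 2^-1.
Proof.
rewrite /common_ratio; split; first by rewrite invr_gt0 exprn_gt0.
by rewrite lef_pV2 ?posrE ?exprn_gt0 // addn1 exprS ler_peMr // exprn_ege1 // ler1n.
Qed.

Lemma limit_termE I :
  limit_term I = geometric_term I * (common_ratio ^+ lcm_of I / (1 - common_ratio ^+ lcm_of I)).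
Proof.
rewrite /limit_term /geometric_term /common_ratio exprVn -exprM -addnA [(t + 1)%N]addn1 [2 ^+ (_ + t.+1)]exprD.
have := lcm_of_gt0 I; set L := lcm_of I => L0.
set x : RR := 2 ^+ (_ * L); set y : RR := 2 ^+ t.+1.
have y0 : y != 0 by rewrite expf_neq0 // pnatr_eq0.
have x1 : 1 < x by rewrite exprn_egt1 // ?ltr1n // muln_eq0; move: L0; lia.
have x0 : x != 0 by rewrite gt_eqF // (lt_trans ltr01).
have x10 : x - 1 != 0 by rewrite subr_eq0 gt_eqF.
have d0 : 1 - x^-1 != 0 by rewrite subr_eq0 eq_sym invr_eq1 gt_eqF.
have d1 : x * y - y != 0 by rewrite -{2}[y]mul1r -mulrBl mulf_neq0.
by field; rewrite x0 y0 x10 d1.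
Qed.

(** The relative deviation of the colengths from [q ^ d] at [q = 2 ^ e], with
    the digit positions counted from the top. *)
Definition relative_correction (e : nat) : RR :=
  \sum_(s < e) (block_weight s)%:R * 2 ^+ t / 2 ^+ ((3 * t + 1) * s.+1).

(** The term [s = 0] contributes [1 / 2]; the others are a combination of
    truncated geometric series over the multiples of the numbers [lcm_of I]. *)
Lemma relative_correctionE e : relative_correction e.+1 =
  1 / 2 + \sum_(I : {set 'I_t}) geometric_term I *
     \sum_(1 <= s < e.+1 | (lcm_of I %| s)%N) common_ratio ^+ s.
Proof.
rewrite /relative_correction big_ord_recl; congr (_ + _).
  have -> : (block_weight 0)%:R = 2 ^+ (2 * t) :> RR.
    by rewrite /block_weight /= prod_nat_const card_ord natrX exprM; congr (_ ^+ _); ring.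
  rewrite muln1 -exprD (_ : 3 * t + 1 = (2 * t + t).+1)%N; last lia.
  by rewrite exprS invfM mulrCA divff ?mulr1 ?mul1r // expf_neq0 // pnatr_eq0.
under eq_bigr do rewrite lift0.
rewrite -(big_mkord xpredT (fun s => (block_weight s.+1)%:R * 2 ^+ t / 2 ^+ ((3 * t + 1) * s.+2))).
under [RHS]eq_bigr do rewrite big_add1 big_mkcond mulr_sumr.
rewrite exchange_big /=; apply: eq_bigr => s _.
transitivity (common_ratio ^+ s.+1 / 2 ^+ t.+1 * \prod_(i < t) (3 + (m i %| s.+1))%N%:R).
  rewrite /block_weight /= big_split /= natrM prod_nat_const card_ord natr_prod !natrX.
  set P := \prod_(i < t) _; rewrite -exprM.
  rewrite (_ : (3 * t + 1) * s.+2 = (s.+2 * t + t) + ((2 * t + 1) * s.+1 + t.+1))%N; last by ring.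
  rewrite /common_ratio exprVn -exprM -invfM -exprD [2 ^+ (_ + _ + _)]exprD [2 ^+ (_ + t)]exprD.
  have n0 n : 2 ^+ n != 0 :> RR by rewrite expf_neq0 // pnatr_eq0.
  by field; rewrite !n0.
rewrite prod_divides mulr_sumr; apply: eq_bigr => I _; rewrite /geometric_term.
by case: (lcm_of I %| _)%N; rewrite ?mulr1 ?mulr0 //; ring.
Qed.

End Numerics.

Section Limits.
Context (RR : realType) (t : nat) (m : 'I_t -> nat).
Hypothesis m_gt1 : forall i, (1 < m i)%N.

Definition limit_sum : RR := \sum_(I : {set 'I_t}) limit_term RR m I.

(** The deviation consists of tails of geometric series of ratio at most
    [1 / 2]. *)
Lemma relative_correction_rate : exists C : RR, forall e,
  `|1 / 2 + limit_sum - relative_correction RR m e| <= C / 2 ^+ e.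
Proof.
pose G : RR := \sum_(I : {set 'I_t}) geometric_term RR I * 2.
have g0 (I : {set 'I_t}) : 0 <= geometric_term RR I :> RR.
  by rewrite /geometric_term divr_ge0 ?exprn_ge0.
have G0 : 0 <= G by apply: sumr_ge0 => I _; rewrite mulr_ge0.
have [r0 r2] := common_ratio_bounds RR t.
exists (`|1 / 2 + limit_sum| + G) => -[|e].
  by rewrite /relative_correction big_ord0 subr0 divr1 lerDl.
have -> : 1 / 2 + limit_sum - relative_correction RR m e.+1 =
    \sum_(I : {set 'I_t}) geometric_term RR I * (common_ratio RR t ^+ lcm_of m I / (1 - common_ratio RR t ^+ lcm_of m I) -
     \sum_(1 <= s < e.+1 | (lcm_of m I %| s)%N) common_ratio RR t ^+ s).
  rewrite relative_correctionE opprD addrACA subrr add0r -sumrB.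
  by apply: eq_bigr => I _; rewrite limit_termE // mulrBr.
apply: (@le_trans _ _ (G / 2 ^+ e.+1)); last first.
  by rewrite ler_wpM2r ?invr_ge0 ?exprn_ge0 // lerDr.
rewrite mulr_suml; apply: (le_trans (ler_norm_sum _ _ _)); apply: ler_sum => I _.
have /andP[l0 l1] := geometric_multiples r0 r2 (lcm_of_gt0 m_gt1 I) (ltn0Sn e).
rewrite normrM (ger0_norm (g0 I)) (ger0_norm l0) -mulrA ler_wpM2l //; apply: le_trans l1 _.
by rewrite ler_wpM2l // -exprVn; apply: lerXn2r; rewrite ?nnegrE ?invr_ge0 ?exprn_ge0.
Qed.

(** Sorting the subsets by size; the empty one gives the first summand. *)
Lemma limit_sumE : limit_sum = 3 ^+ t / (2 ^+ (3 * t + 2) - 2 ^+ (t + 1))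
    + \sum_(1 <= r < t.+1) \sum_(I : {set 'I_t} | #|I| == r)
        3 ^+ (t - r)
        / (2 ^+ ((2 * t + 1) * \big[lcmn/1%N]_(i in I) m i + t + 1)
           - 2 ^+ (t + 1)).
Proof.
transitivity (\sum_(0 <= r < t.+1) \sum_(I : {set 'I_t} | #|I| == r) limit_term RR m I).
  rewrite big_mkord /limit_sum (partition_big (fun I : {set 'I_t} => inord #|I| : 'I_t.+1) xpredT) //.
  apply: eq_bigr => r _; apply: eq_bigl => I.
  rewrite -val_eqE /= inordK // ltnS -[X in (_ <= X)%N](card_ord t); exact: max_card.
rewrite big_ltn //; congr (_ + _).
  rewrite (eq_bigl (fun I => I == finset.set0)) => [|I]; last by rewrite cards_eq0.
  rewrite big_pred1_eq /limit_term /lcm_of cards0 subn0 big_set0 muln1.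
  by congr (_ / (2 ^+ _ - _)); ring.
by apply: eq_bigr => r _; apply: eq_bigr => I /eqP <-.
Qed.

End Limits.

Section Correction.
Context (k : closedFieldType) (iota : {rmorphism 'F_2 -> k}).
Context (t : nat) (alpha : 'I_t -> k) (m : 'I_t -> nat).
Hypothesis m_deg : forall i, m i = degF2 iota (alpha i).
Hypothesis m_gt1 : forall i, (1 < m i)%N.
Hypothesis alpha_neq0 : forall i, alpha i != 0.
Hypothesis bracketE : forall (alpha : k) (n j : nat),
       alpha != 0 -> (1 <= n)%N -> (j < 2 ^ n)%N ->
       bracket iota alpha n j =
         (e_n n.+1 (quartic_poly alpha ^+ (2 * j).+1))%:R
         - 1 / 2 * ((e_n n.+1 (quartic_poly alpha ^+ (2 * j)))%:R
                    + (e_n n.+1 (quartic_poly alpha ^+ (2 * j).+2))%:R).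

Lemma correctionE e : correction alpha e =
  \sum_(b < e) (2 ^ b * (8 ^ (t * b) * (2 ^ t * block_weight m (e - b).-1)))%N%:Z.
Proof.
apply: eq_bigr => b _; rewrite PoszM; congr (_ * _).
rewrite big_mkord.
rewrite (eq_bigr (fun i => (8 ^ b * (2 * bracket_weight iota (alpha i) (e - b).-1))%N%:Z)); last first.
  move=> i _; rewrite /alphaN valK; apply: altsum_quartic => //.
  - by rewrite -m_deg.
  - by move=> n j; apply: bracketE.
  - exact: full_box_basis.
rewrite -(big_morph _ PoszM (erefl 1%:Z)); congr Posz.
rewrite !big_split /= !prod_nat_const card_ord -expnM [(b * t)%N]mulnC; congr (_ * (_ * _))%N.
by apply: eq_bigr => i _; rewrite /bracket_weight m_deg.
Qed.

(** The digit [b] of [correction] becomes the term [s = e - 1 - b]. *)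
Lemma correction_relative (RR : realType) e :
  (correction alpha e)%:~R / 2 ^+ (e * (3 * t + 1)) = relative_correction RR m e.
Proof.
rewrite correctionE rmorph_sum mulr_suml /relative_correction (reindex_inj rev_ord_inj) /=.
apply: eq_bigr => s _.
have se := ltn_ord s; rewrite (_ : (e - (e - s.+1)).-1 = s)%N; last lia.
rewrite -[_%:~R]/(_%:R) !natrM !natrX -natrX.
set b := (e - s.+1)%N; have eE : (e = b + s.+1)%N by rewrite /b subnK.
rewrite (_ : e * _ = (b + s.+1) * (3 * t + 1))%N; last by rewrite -eE.
rewrite [in LHS]mulnDl exprD [(s.+1 * _)%N]mulnC (_ : 8 ^+ (t * b) = 2 ^+ (3 * t * b)); last first.
  by rewrite -mulnA [RHS]exprM -(natrX _ 2 3).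
have bE : (b * (3 * t + 1) = 3 * t * b + b)%N by ring.
rewrite {}bE.
have n0 n : 2 ^+ n != 0 :> RR by rewrite expf_neq0 // pnatr_eq0.
by rewrite natrX exprD; field; rewrite !n0.
Qed.

End Correction.

Section Lengths.
Context (k : closedFieldType) (iota : {rmorphism 'F_2 -> k}).
Context (t : nat) (alpha : 'I_t -> k).
Local Notation R := (hyp_ring alpha).
Local Notation pi := (quot_pi (@hyp_eq_nonunit k t alpha)).

Let tower_total e : (2 ^ e)%N%:Z * (tower_dim e t)%:Z = (2 ^ (e * (3 * t + 1)))%N%:Z.
Proof. by rewrite -PoszM tower_dimE -expnD; congr (2 ^ _)%N%:Z; ring. Qed.

Lemma hyp_HK_length e : exists2 l : nat,
  is_length (frob_power (max_ideal pi) (2 ^ e)) l &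
  l%:Z = (2 ^ (e * (3 * t + 1)))%N%:Z + correction alpha e.
Proof.
have bb := @hyp_box_basis t e.
exists (2 ^ e * 2 ^ e * tower_dim e t - \rank (coefmx (@hyp_box t e) (hyp_eq alpha)))%N.
  apply: hypersurface_HK_length (bb); last exact: (char2 iota).
  - exact: quot_pi_surj.
  - exact: quot_pi_ker.
by rewrite -tower_total -(corank_hyp iota) -subzn // rank_leq_col.
Qed.

Lemma hyp_nonsplit_length e : exists2 l : nat,
  is_length (nonsplit_ideal (hyp_ring_char2 iota alpha) e) l &
  l%:Z = (2 ^ (e * (3 * t + 1)))%N%:Z - correction alpha e.
Proof.
have bb := @hyp_box_basis t e.
exists (\rank (coefmx (@hyp_box t e) (hyp_eq alpha) ^+ (2 ^ e).-1)).
  apply: (@hypersurface_nonsplit_length _ _ _ (hyp_eq alpha) pi) (bb); last exact: (char2 iota).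
  - exact: (hyp_eq0E iota).
  - exact: hyp_eq_neq0.
  - exact: quot_pi_surj.
  - exact: quot_pi_ker.
by rewrite -tower_total (rank_hyp_pred iota).
Qed.

End Lengths.

(** With [s = 1] this is the limit of the Hilbert-Kunz colengths, with [s = -1]
    that of the splitting colengths. *)
Lemma cvg_corrected (RR : realType) (d : nat) (corr : nat -> int) (len : nat -> nat)
    (l c s : RR) :
    (forall e, `|l - (corr e)%:~R / 2 ^+ (e * d)| <= c / 2 ^+ e) -> s ^+ 2 = 1 ->
    (forall e, (len e)%:R = 2 ^+ (e * d) + s * (corr e)%:~R) ->
  (fun e => (len e)%:R / (2 ^ (e * d))%:R : RR) @ \oo --> 1 + s * l.
Proof.
move=> rate s2 lenE; apply: (@cvg_geometric_bound _ _ _ c) => e.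
rewrite lenE natrX mulrDl divff ?expf_neq0 ?pnatr_eq0 // opprD addrACA subrr add0r.
rewrite -mulrA -mulrBr normrM; suff -> : `|s| = 1 by rewrite mul1r.
by apply/eqP; rewrite -(@eqrXn2 _ 2) // -normrX s2 normr1 expr1n.
Qed.

Theorem theorem3p2 (RR : realType) (k : closedFieldType)
    (iota : {rmorphism 'F_2 -> k})
    (k_alg : forall x : k, algebraicOver iota x)
    (bracketE : forall (alpha : k) (n j : nat),
       alpha != 0 -> (1 <= n)%N -> (j < 2 ^ n)%N ->
       bracket iota alpha n j =
         (e_n n.+1 (quartic_poly alpha ^+ (2 * j).+1))%:R
         - 1 / 2 * ((e_n n.+1 (quartic_poly alpha ^+ (2 * j)))%:R
                    + (e_n n.+1 (quartic_poly alpha ^+ (2 * j).+2))%:R))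
    (t : nat) (alpha : 'I_t -> k) (m : 'I_t -> nat)
    (t_ge1 : (1 <= t)%N)
    (alpha_neq0 : forall i, alpha i != 0)
    (m_deg : forall i, m i = degF2 iota (alpha i))
    (m_gt1 : forall i, (1 < m i)%N) :
  let T : RR :=
    3 ^+ t / (2 ^+ (3 * t + 2) - 2 ^+ (t + 1))
    + \sum_(1 <= r < t.+1) \sum_(I : {set 'I_t} | #|I| == r)
        3 ^+ (t - r)
        / (2 ^+ ((2 * t + 1) * \big[lcmn/1%N]_(i in I) m i + t + 1)
           - 2 ^+ (t + 1)) in
  [/\ is_krull_dim (hyp_ring alpha) (3 * t + 1),
      is_HK_multiplicity 2 (hyp_ring alpha) (3 / 2 + T) &
      is_F_signature (hyp_ring_char2 iota alpha) (1 / 2 - T)].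
Proof.
move=> T.
have [C rate] := relative_correction_rate RR m_gt1.
rewrite limit_sumE -/T in rate.
have corr := correction_relative m_deg m_gt1 alpha_neq0 bracketE RR.
have rate' e : `|1 / 2 + T - (correction alpha e)%:~R / 2 ^+ (e * (3 * t + 1))| <= C / 2 ^+ e.
  by rewrite corr.
pose pi := quot_pi (@hyp_eq_nonunit k t alpha).
have surj := quot_pi_surj (hF := @hyp_eq_nonunit k t alpha).
have ker := quot_pi_ker (@hyp_eq_nonunit k t alpha).
have dim : is_krull_dim (hyp_ring alpha) (3 * t + 1) by apply: (hyp_krull_dim iota surj ker).
split=> //.
  have [len lenP lenE] := all_sig2 (fun e => cid2 (hyp_HK_length iota alpha e)).
  exists (max_ideal pi), (3 * t + 1)%N, len; split=> //.
    exact: hypersurface_local (hyp_eq0E iota alpha) surj ker.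
  have -> : 3 / 2 + T = 1 + 1 * (1 / 2 + T) by field.
  apply: cvg_corrected rate' _ _ => [|e]; first by rewrite expr1n.
  by rewrite mul1r -natrX -[LHS]/((len e)%:Z%:~R) lenE rmorphD.
have [len lenP lenE] := all_sig2 (fun e => cid2 (hyp_nonsplit_length iota alpha e)).
exists (3 * t + 1)%N, len; split=> //.
have -> : 1 / 2 - T = 1 + - 1 * (1 / 2 + T) by field.
apply: cvg_corrected rate' _ _ => [|e]; first by rewrite sqrrN expr1n.
by rewrite mulN1r -natrX -[LHS]/((len e)%:Z%:~R) lenE rmorphB.
Qed.
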